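(* Let $\kappa\ge84$ be a numerical constant and let $w$ be either the Bayesian weights (for some $\eta\in\mathbb N$) or the model selection weights, built from $\tilde f_k$ and the penalties $\mathrm{pen}_k=\kappa k\Lambda_k/n$, $1\le k\le n$; let $\tilde f_w=\sum_{k=1}^nw_k\tilde f_k$. Let $(\mathfrak f_k)_{k\in\mathbb N_0}$ and $(\mathfrak s_k)_{k\in\mathbb N_0}$ be strictly positive sequences such that $\mathfrak f_k$ and $1/\mathfrak s_k$ are monotonically non-increasing in $k$, $\mathfrak f_0=1=\mathfrak s_0$, $\lim_k\mathfrak f_k=0=\lim_k\mathfrak s_k^{-1}$ and $\|\mathfrak f/\mathfrak s\|_{\ell^1}:=\sum_{k\in\mathbb N_0}\mathfrak f_k/\mathfrak s_k<\infty$, and let $r,d\ge1$. Put $\zeta_d:=d(1+\log d)^2$ and $k_{\mathfrak f\mathfrak s}:=\lfloor3(400)^2r\zeta_d\|\mathfrak f/\mathfrak s\|_{\ell^1}\rfloor$. Then there are a finite constant $C>0$ depending only on $\kappa$ and a finite constant $C'$ depending only on the classes $\mathcal F_{\mathfrak f}^r$ and $\mathcal E_{\mathfrak s}^d$ (and $\kappa$) such that for all $n\in\mathbb N$ $$\sup_{f\in\mathcal F_{\mathfrak f}^r,\ \varphi\in\mathcal E_{\mathfrak s}^d}\mathbb E^n_{f,\varphi}\|\tilde f_w-f\|^2\le C(r+\zeta_d)\,\mathcal R_n^{a}+C'n^{-1},\qquad\mathcal R_n^{a}:=\min_{1\le k\le n}\Big[\mathfrak f_k\vee\frac{k\Lambda^{\mathfrak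 s}_k}{n}\vee\exp\Big(\frac{-\lambda^{\mathfrak s}_kk}{k_{\mathfrak f\mathfrak s}}\Big)\Big].$$
   Context: Notation: $\mathbb N=\{1,2,\dots\}$, $\mathbb N_0=\mathbb N\cup\{0\}$, $a\vee b=\max(a,b)$. $L^2=L^2([0,1))$ is the space of square-integrable complex functions with norm $\|\cdot\|$ and inner product $\langle h,h'\rangle=\int h\overline{h'}$; $e_j(x)=\exp(-2\pi\iota jx)$ with $\iota^2=-1$, and $h_j:=\langle h,e_j\rangle$, $j\in\mathbb Z$. $\mathcal D$ is the set of real-valued Lebesgue probability densities on $[0,1)$ lying in $L^2$. Classes: $\mathcal F_{\mathfrak f}^r:=\{p\in\mathcal D:\sum_{j\in\mathbb Z}|p_j|^2/\mathfrak f_{|j|}\le r\}$, $\mathcal E_{\mathfrak s}^d:=\{p\in\mathcal D:d^{-1}\le\mathfrak s_{|j|}|p_j|^2\le d\ \forall j\in\mathbb Z\}$. For $k\in\mathbb N_0$: $\mathfrak s_{(k)}:=\max_{0\le j\le k}\mathfrak s_j$ $(=\mathfrak s_k)$, $\lambda^{\mathfrak s}_k:=\frac{|\log(k\mathfrak s_{(k)}\vee(k+2))|^2}{|\log(k+2)|^2}$, $\Lambda^{\mathfrak s}_k:=\lambda^{\mathfrak s}_k\mathfrak s_{(k)}$. Model: $f,\varphi\in\mathcal D$; $g=f\circledast\varphi$ is the circular convolution on $[0,1)$, so $g_j=f_j\varphi_j$. The error density $\varphi$ is known (to the estimator), and $Y_1,\dots,Y_n$ are i.i.d. with density $g$; $\mathbb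 E^n_{f,\varphi}$ is the expectation under their joint law. For $k\in\mathbb N_0$: $v_k:=|\varphi_k|^{-2}$, $v_{(k)}:=\max_{0\le j\le k}v_j$, $\lambda_k:=\frac{|\log(kv_{(k)}\vee(k+2))|^2}{|\log(k+2)|^2}$, $\Lambda_k:=\lambda_kv_{(k)}$, and $\mathrm{pen}_k:=\kappa k\Lambda_k/n$. Estimators: $\hat g_j:=n^{-1}\sum_{i=1}^ne_j(-Y_i)$, $\tilde f_k:=e_0+\sum_{1\le|j|\le k}\varphi_j^{-1}\hat g_je_j$. Weights: Bayesian weights $w_k:=\frac{\exp(-\eta n\{-\|\tilde f_k\|^2+\mathrm{pen}_k\})}{\sum_{l=1}^n\exp(-\eta n\{-\|\tilde f_l\|^2+\mathrm{pen}_l\})}$; model selection weights $w_k:=\mathbf 1\{k=\tilde k\}$ with $\tilde k$ the smallest minimiser of $k\mapsto-\|\tilde f_k\|^2+\mathrm{pen}_k$ over $\{1,\dots,n\}$. *)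

(* Defs.v *)
From HB Require Import structures.
From mathcomp Require Import all_boot all_order all_algebra.
From mathcomp Require Import all_classical all_reals all_analysis.
From mathcomp Require Import complex.

Set Implicit Arguments.
Unset Strict Implicit.
Unset Printing Implicit Defensive.
Import Order.TTheory GRing.Theory Num.Theory.
Import numFieldNormedType.Exports.

Local Open Scope classical_set_scope.
Local Open Scope ring_scope.

(* Functions on [0,1) are represented by functions on R whose values outside
   [0,1) are never used. *)

Section L2.
Context {R : realType}.
Local Notation mu := (@lebesgue_measure R).

Definition unitI : set R := `[0, 1[%classic.

Definition cabs (z : R[i]) : R := ComplexField.Normc.normc z.

Definition cintegral (h : R -> R[i]) : R[i] :=
  Complex
    (\int[mu]_(x in unitI) complex.Re (h x))
    (\int[mu]_(x in unitI) complex.Im (h x)).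

Definition inner (h h' : R -> R[i]) : R[i] :=
  cintegral (fun x => h x * conjc (h' x)).

(* Extended-real valued, +oo outside L^2 *)
Definition normsq (h : R -> R[i]) : \bar R :=
  (\int[mu]_(x in unitI) (cabs (h x) ^+ 2)%R%:E)%E.

Definition ebasis (j : int) (x : R) : R[i] :=
  let t := - (2 * pi * j%:~R * x) in Complex (cos t) (sin t).

Definition ofreal (p : R -> R) (x : R) : R[i] := Complex (p x) 0.

Definition fcoef (p : R -> R) (j : int) : R[i] := inner (ofreal p) (ebasis j).

Definition density (p : R -> R) : Prop :=
  [/\ measurable_fun unitI p,
      (forall x, unitI x -> 0 <= p x),
      (\int[mu]_(x in unitI) (p x)%:E = 1)%E &
      (normsq (ofreal p) < +oo)%E].

Definition fracpart (x : R) : R := x - (Num.floor x)%:~R.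

Definition cconv (f phi : R -> R) (x : R) : R :=
  \int[mu]_(y in unitI) (f (fracpart (x - y)) * phi y).

End L2.

Section sequences.
Context {R : realType}.
Implicit Types u s ff : nat -> R.

(* The argument u k of the lower bound is one of the terms: this is the
   maximum of u over {0,...,k}. *)
Definition runmax u (k : nat) : R := \big[Num.max/u k]_(0 <= j < k.+1) u j.

Definition lam u (k : nat) : R :=
  `|ln (Num.max (k%:R * runmax u k) k.+2%:R)| ^+ 2 / `|ln (k.+2%:R : R)| ^+ 2.

Definition Lam u (k : nat) : R := lam u k * runmax u k.

Definition classF ff (r : R) (p : R -> R) : Prop :=
  density p /\
  (\esum_(j in [set: int]) (cabs (fcoef p j) ^+ 2 / ff `|j|%N)%R%:E <= r%:E)%E.

Definition classE s (d : R) (p : R -> R) : Prop :=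
  density p /\
  (forall j : int, d^-1 <= s `|j|%N * cabs (fcoef p j) ^+ 2 <= d).

Definition l1norm u : \bar R := (\sum_(0 <= k <oo) `|u k|%R%:E)%E.

Definition zeta (d : R) : R := d * (1 + ln d) ^+ 2.

Definition kfs ff s (r d : R) : int :=
  Num.floor (3 * 400 ^+ 2 * r * zeta d * fine (l1norm (fun k => ff k / s k))).

(* Minimum over the non-empty range {1,...,n}, for 1 <= n *)
Definition rate ff s (r d : R) (n : nat) : R :=
  let F k := Num.max (ff k)
    (Num.max (k%:R * Lam s k / n%:R)
             (expR (- lam s k * k%:R / (kfs ff s r d)%:~R))) in
  \big[Num.min/F 1%N]_(1 <= k < n.+1) F k.

End sequences.

Section estimators.
Context {R : realType}.
Variables (n : nat) (kappa : R) (phi : R -> R).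
Implicit Types y : 'I_n -> R.

Definition vseq (k : nat) : R := (cabs (fcoef phi k%:Z) ^+ 2)^-1.

Definition pen (k : nat) : R := kappa * k%:R * Lam vseq k / n%:R.

Definition ghat y (j : int) : R[i] :=
  (n%:R)^-1 * \sum_(i < n) ebasis j (- y i).

Definition ftilde y (k : nat) (x : R) : R[i] :=
  ebasis 0 x +
  \sum_(1 <= j < k.+1)
     ((fcoef phi j%:Z)^-1 * ghat y j%:Z * ebasis j%:Z x +
      (fcoef phi (- j%:Z))^-1 * ghat y (- j%:Z) * ebasis (- j%:Z) x).

Definition crit y (k : nat) : R := - fine (normsq (ftilde y k)) + pen k.

(* In the weighting schemes below c stands for the criterion
   k |-> - ||ftilde_k||^2 + pen_k. *)
Definition bayes_weights (eta : nat) (c : nat -> R) (k : nat) : R :=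
  expR (- eta%:R * n%:R * c k) /
  \sum_(1 <= l < n.+1) expR (- eta%:R * n%:R * c l).

Definition argmin (c : nat -> R) : nat :=
  head 0%N [seq k <- iota 1 n | all (fun l => c k <= c l) (iota 1 n)].

Definition ms_weights (c : nat -> R) (k : nat) : R := (k == argmin c)%:R.

Definition admissible_weights (W : (nat -> R) -> nat -> R) : Prop :=
  (exists2 eta : nat, (0 < eta)%N & W = bayes_weights eta) \/ W = ms_weights.

Definition ftilde_agg (W : (nat -> R) -> nat -> R) y (x : R) : R[i] :=
  \sum_(1 <= k < n.+1) Complex (W (crit y) k) 0 * ftilde y k x.

End estimators.

Section model.
Context {R : realType}.
Local Notation mu := (@lebesgue_measure R).

Definition mutually_independent d (T : measurableType d) (P : probability T R)
    (n : nat) (Y : 'I_n -> {RV P >-> R}) : Prop :=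
  forall (J : {set 'I_n}) (B : 'I_n -> set R),
    (forall i, measurable (B i)) ->
    P (\bigcap_(i in [set` J]) (Y i @^-1` B i)) =
    (\prod_(i in J) P (Y i @^-1` B i))%E.

Definition has_density d (T : measurableType d) (P : probability T R)
    (X : {RV P >-> R}) (g : R -> R) : Prop :=
  forall B : set R, measurable B ->
    distribution P X B = (\int[mu]_(x in B `&` unitI) (g x)%:E)%E.

Definition iid_sample d (T : measurableType d) (P : probability T R)
    (n : nat) (Y : 'I_n -> {RV P >-> R}) (g : R -> R) : Prop :=
  mutually_independent Y /\ (forall i, has_density (Y i) g).

(* e is the risk of ftilde_w for the squared L^2 loss, computed from some iid
   sample with density the circular convolution of f and phi; only the joint law of the sample matters, so e does
   not depend on the probability space carrying it. *)
Definition is_risk (kappa : R) (n : nat) (W : (nat -> R) -> nat -> R)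
    (f phi : R -> R) (e : \bar R) : Prop :=
  exists (d : measure_display) (T : measurableType d) (P : probability T R)
         (Y : 'I_n -> {RV P >-> R}),
    iid_sample Y (cconv f phi) /\
    e = (\int[P]_w normsq (fun x =>
           (ftilde_agg kappa phi W (fun i => Y i w) x - ofreal f x)%R))%E.

Definition maximal_risk (kappa : R) (ff s : nat -> R) (r d : R) (n : nat)
    (W : (nat -> R) -> nat -> R) : \bar R :=
  ereal_sup [set e | exists f phi : R -> R,
    [/\ classF ff r f, classE s d phi & is_risk kappa n W f phi e]].

End model.

(* Main.v *)
(* In Fourier coordinates the estimators are trigonometric polynomials and their
   losses are, by Parseval, sums over frequencies; by convexity the loss of the
   aggregate is at most the weighted mean of the losses of the f~_k.  Both
   weighting schemes satisfy w_k <= exp(-n (crit_k - crit_m)) for all k and m,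
   so w_k is exponentially small as soon as f~_k has a much larger bias than
   f~_m (for k < m) or a much larger penalty (for k > m).  What remains is the
   excess of the weighted noise, the sum of 2 |phi_j|^-2 |g^_j - g_j|^2 over
   1 <= j <= k, above 24 k Lambda_k / n.

   This excess is bounded without Talagrand's inequality: for a sum S of
   independent centred vectors, the exponential moment of sqrt(A + |S|^2) is
   controlled by adding the summands one at a time.  The covariance of the
   trigonometric system under the density g is bounded, by Schur's test, by the
   l1-norm of the Fourier coefficients of g, which is bounded over the classes
   since |f_j phi_j| <= |f_j|^2 / ff_j + ff_j |phi_j|^2.  The expected excess is
   of order v_(k) exp(-sqrt(k lambda_k) / 2) / n up to a power of k lambda_k, and
   k v_(k) <= exp(sqrt(lambda_k) log(k + 2)) makes it summable in k, uniformly
   over the class of phi. *)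
Require Import Defs.
From HB Require Import structures.
From mathcomp Require Import all_boot all_order all_algebra.
From mathcomp Require Import all_classical all_reals all_analysis measurable_realfun.
From mathcomp Require Import complex ring lra.
Import Order.TTheory GRing.Theory Num.Theory.
Import numFieldNormedType.Exports.
Local Open Scope classical_set_scope.
Local Open Scope ring_scope.
Set Implicit Arguments.
Unset Strict Implicit.
Unset Printing Implicit Defensive.

(** * Circular convolution and moments *)

(** The shape of [lam] decides the summation over [k]: the noise excess decays like
    [exp(- sqrt(k lam) / 2)], while [k v_(k)] is at most [exp(sqrt(lam) log(k + 2))]. Both exponents
    carry the same factor [sqrt(lam)], so the comparison reduces to [log(k + 2) <= sqrt(k) / 4],
    which holds from a fixed [k] on, whatever [phi] is. The squared logarithms in [lam] match an
    exponential moment of a norm rather than of its square.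

    The constant 84 is 7/2 times 24. Noise below twice the threshold [24 k Lambda_k / n] then costs
    at most 6/7 of the penalty, up to the bias, and the remaining 1/7 makes the weight small. The 24
    is twice 12 (frequencies [j] and [-j]), and 12 is [4^2 - 4] from the smoothed norm.

    The l1-bound [M] on the coefficients of [g] enters only through [exp(3 M / 2)] in the [1/n]
    remainder; this is why [C] depends on [kappa] alone and [C'] on the classes.

    Measurability of the loss in the sample is never established: each excess is dominated pointwise
    by a bounded random variable, and the integral of a non-negative function is monotone in any
    case. *)

Section rotation.
Context {R : realType}.
Local Notation mu := (@lebesgue_measure R).

(** Lebesgue measure is determined by its values on half-open intervals, and a shift preserves their
    length. *)
Lemma lebesgue_measure_shift (a : R) (A : set R) : measurable A ->
  pushforward mu ((fun x => x + a) : _ -> measurableTypeR R) A = mu A.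
Proof.
move=> mA; have ms : measurable_fun setT ((fun x => x + a) : R -> measurableTypeR R).
  exact: measurable_funD.
pose sm := isMeasurableFun.Build _ _ _ _ _ ms.
pose s : {mfun R >-> measurableTypeR R} := HB.pack ((fun x => x + a) : R -> measurableTypeR R) sm.
change (pushforward mu s A = mu A).
apply/esym/lebesgue_measure_unique => //= _ [[b c]] _ <-.
rewrite /pushforward.
rewrite (_ : _ @^-1` _ = `]b - a, c - a]%classic); last first.
  by apply/seteqP; split => x /=; rewrite !in_itv/= ltrBlDr lerBrDr.
rewrite !lebesgue_measure_itv/= !lte_fin ltrD2r; case: ifP => // _.
by rewrite !EFinB; congr (_%:E); rewrite /=; ring.
Qed.

Lemma ge0_integral_shift (a : R) (D : set R) (h : R -> \bar R) :
  measurable D -> measurable_fun setT h -> (forall x, 0 <= h x)%E ->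
  (\int[mu]_(x in [set x | D (x + a)%R]) h (x + a)%R = \int[mu]_(x in D) h x)%E.
Proof.
move=> mD mh h0.
have ms : measurable_fun setT ((fun x => x + a) : R -> measurableTypeR R).
  exact: measurable_funD.
rewrite (_ : [set x | D (x + a)%R] = ((fun x => x + a) : R -> measurableTypeR R) @^-1` D) //.
rewrite -[LHS](@ge0_integral_pushforward _ _ (measurableTypeR R) (measurableTypeR R)
  _ _ ms mu D h) //; last exact: measurable_funS mh.
by apply: eq_measure_integral => //= A mA AS; exact/lebesgue_measure_shift.
Qed.

Lemma measurable_floor (D : set R) : measurable D ->
  measurable_fun D (fun x : R => (Num.floor x)%:~R : R).
Proof.
by move=> mD; apply: nondecreasing_measurable => // x y xy; rewrite ler_int le_floor.
Qed.

Lemma measurable_fracpart : measurable_fun setT (@fracpart R).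
Proof. by apply: measurable_funB => //; exact: measurable_floor. Qed.

Lemma fracpart_itv (x : R) : unitI (fracpart x).
Proof.
rewrite /unitI /= in_itv/= /fracpart subr_ge0 floor_le /=.
by have := lt_succ_floor x; rewrite intrD; lra.
Qed.

Lemma fracpart_id (x : R) : unitI x -> fracpart x = x.
Proof.
rewrite /unitI /= in_itv/= => /andP[x0 x1]; rewrite /fracpart.
by rewrite (@floor_def _ x 0) ?subr0 //= x0 /= x1.
Qed.

Lemma fracpartDz (x : R) (z : int) : fracpart (x + z%:~R) = fracpart x.
Proof.
by rewrite /fracpart floorDrz ?intr_int// rmorphD/= [X in _ - (_ + X)]floorK ?intr_int//; ring.
Qed.

Lemma fracpartDl (x y : R) : fracpart (fracpart x + y) = fracpart (x + y).
Proof.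
by rewrite -[RHS](fracpartDz _ (- Num.floor x)) rmorphN/= addrAC.
Qed.

Lemma ge0_integral_rotation_lt1 (a : R) (h : R -> \bar R) : unitI a ->
  measurable_fun setT h -> (forall x, 0 <= h x)%E ->
  (\int[mu]_(x in unitI) h (fracpart (x + a))%R = \int[mu]_(x in unitI) h x)%E.
Proof.
rewrite /unitI /= in_itv/= => /andP[a0 a1] mh h0.
have mhf (D : set R) : measurable_fun D (fun x => h (fracpart (x + a))).
  apply: measurable_funTS; apply: measurableT_comp => //.
  by apply: measurableT_comp; [exact: measurable_fracpart|exact: measurable_funD].
have U (b : R) : 0 <= b <= 1 -> `[0, 1[%classic = `[0, b[%classic `|` `[b, 1[%classic :> set R.
  move=> b01; apply/seteqP; split => x /=; rewrite !in_itv/=; last first.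
    by case=> /andP[? ?]; apply/andP; split; lra.
  by move=> /andP[? ?]; case: (ltP x b) => ?; [left|right]; apply/andP; split; lra.
have dj (b : R) : [disjoint `[0, b[%classic & (`[b, 1[%classic : set R)].
  by rewrite disj_set2E; apply/eqP/seteqP; split => // x []/=; rewrite !in_itv/=; lra.
(* The left side is cut at [1 - a] and the right side at [a]. The part beyond [1 - a] wraps around
   onto [[0, a[], the other one is translated onto [[a, 1[]; hence the swap [addeC]. *)
have Ua := U (1 - a); rewrite [in LHS]Ua; last by lra.
rewrite [in RHS](U a); last by lra.
rewrite [LHS]ge0_integral_setU//; last exact: mhf.
rewrite [RHS]ge0_integral_setU//; last exact: measurable_funTS.
rewrite addeC; congr (_ + _)%E.
- rewrite -[RHS](ge0_integral_shift (a - 1)) //.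
  rewrite (_ : [set x | `[0%R, a[%classic (x + (a - 1))%R] = `[1 - a, 1[%classic); last first.
    by apply/seteqP; split => x /=; rewrite !in_itv/=; lra.
  apply: eq_integral => x; rewrite inE/= in_itv/= => xa; congr h.
  rewrite -(fracpartDz _ (-1)) rmorphN1 -addrA fracpart_id//.
  by rewrite /unitI/= in_itv/=; lra.
- rewrite -[RHS](ge0_integral_shift a) //.
  rewrite (_ : [set x | `[a, 1%R[%classic (x + a)%R] = `[0, 1 - a[%classic); last first.
    by apply/seteqP; split => x /=; rewrite !in_itv/=; lra.
  apply: eq_integral => x; rewrite inE/= in_itv/= => xa; congr h.
  by rewrite fracpart_id// /unitI/= in_itv/=; lra.
Qed.

Lemma ge0_integral_rotation (a : R) (h : R -> \bar R) :
  measurable_fun setT h -> (forall x, 0 <= h x)%E ->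
  (\int[mu]_(x in unitI) h (fracpart (x + a))%R = \int[mu]_(x in unitI) h x)%E.
Proof.
move=> mh h0; rewrite -[RHS](@ge0_integral_rotation_lt1 (fracpart a))//; last exact: fracpart_itv.
by apply: eq_integral => x _; rewrite [X in _ = h (fracpart X)]addrC fracpartDl addrC.
Qed.

End rotation.

Section moments.
Context {R : realType}.
Local Notation mu := (@lebesgue_measure R).

Lemma measurable_unitI : measurable (@unitI R).
Proof. exact: measurable_itv. Qed.

Lemma lebesgue_unitI : mu unitI = 1%E.
Proof. by rewrite /unitI lebesgue_measure_itv/= lte_fin ltr01 oppr0 adde0. Qed.

(** [has_density] describes the law on sets only. To integrate functions, the law is compared with
    its Radon-Nikodym derivative, which agrees almost everywhere with the zero extension [G] of [g]
    because both have the same integral over every measurable set. *)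
Lemma ge0_expectation_density d (T : measurableType d)
    (P : probability T R) (X : {RV P >-> R}) (g : R -> R) (h : R -> \bar R) :
  has_density X g -> measurable_fun unitI g -> (forall x, unitI x -> 0 <= g x) ->
  measurable_fun setT h -> (forall x, 0 <= h x)%E ->
  (\int[P]_w h (X w) = \int[mu]_(x in unitI) (h x * (g x)%:E))%E.
Proof.
move=> dX mg g0 mh h0.
have mX : measurable_fun setT (X : T -> measurableTypeR R) by move=> _ B mB; exact: (@measurable_funPT _ _ _ _ X _ B mB).
pose mX_mixin := isMeasurableFun.Build _ _ _ _ _ mX.
pose X' : {mfun T >-> measurableTypeR R} := HB.pack (X : T -> measurableTypeR R) mX_mixin.
pose nu : {finite_measure set (measurableTypeR R) -> \bar R} := distribution P X'.
pose G : R -> \bar R := (EFin \o g) \_ unitI.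
have nuE B : measurable B -> nu B = (\int[mu]_(x in B) G x)%E.
  move=> mB; rewrite [LHS]dX// integral_mkcondr; apply: eq_integral => x _.
  by rewrite /G !patchE.
have mG : measurable_fun setT G.
  by apply/(measurable_restrictT _ measurable_unitI); exact/measurable_EFinP.
have G0 x : (0 <= G x)%E.
  by rewrite /G patchE; case: ifPn => //; rewrite inE lee_fin => /g0.
have iG : mu.-integrable setT G.
  apply/integrableP; split=> //; under eq_integral do rewrite gee0_abs//.
  by rewrite -nuE//; apply: (@le_lt_trans _ _ 1%E); rewrite ?ltry// probability_le1.
have nl : nu `<< mu.
  by apply/null_content_dominatesP => A mA A0; rewrite [LHS]nuE//; apply: null_set_integral => //; exact: measurable_funTS.
transitivity (\int[nu]_x h x)%E; first by rewrite (ge0_integral_pushforward mX).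
rewrite -[LHS](Radon_Nikodym_SigmaFinite.change_of_variables nl)//.
have fi := Radon_Nikodym_SigmaFinite.f_integrable nl.
have mf := measurable_int _ fi.
transitivity (\int[mu]_x (h x * G x))%E.
  apply: ae_eq_integral => //; try exact: emeasurable_funM.
  apply: ae_eqe_mul2l; apply: integral_ae_eq => // E _ mE.
  by rewrite -nuE// -Radon_Nikodym_SigmaFinite.f_integral.
rewrite [RHS]integral_mkcond; apply: eq_integral => x _; rewrite /G !patchE.
by case: ifP => //; rewrite mule0.
Qed.

Lemma cabs_sqr (z : R[i]) : cabs z ^+ 2 = complex.Re z ^+ 2 + complex.Im z ^+ 2.
Proof. by case: z => a b; rewrite /cabs/= sqr_sqrtr// addr_ge0 ?sqr_ge0. Qed.

Lemma cabs_ge0 (z : R[i]) : 0 <= cabs z.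
Proof. by case: z => a b; rewrite /cabs/= sqrtr_ge0. Qed.

Lemma measurable_restrict_density (p : R -> R) :
  density p -> measurable_fun setT (p \_ unitI).
Proof.
by case=> mp _ _ _; apply/(measurable_restrictT _ measurable_unitI).
Qed.

Lemma restrict_density_ge0 (p : R -> R) (x : R) : density p -> 0 <= (p \_ unitI) x.
Proof.
by case=> _ p0 _ _; rewrite patchE; case: ifPn => //; rewrite inE => /p0.
Qed.

Lemma restrict_unitIE (p : R -> R) (x : R) : unitI x -> (p \_ unitI) x = p x.
Proof. by move=> Ix; rewrite patchE mem_set. Qed.

Section convolution_kernel.
Variables (f phi h : R -> R).
Hypotheses (df : density f) (dphi : density phi).
Hypothesis mh : measurable_fun setT h.
Hypothesis h0 : forall x, 0 <= h x.

(** Densities are constrained on [unitI] only, so Tonelli is applied to their extensions by zero.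
    Since [fracpart] always lands in [unitI], the truncation of [f] is invisible. *)
Let K (z : R * R) : \bar R :=
  (h z.1 * ((f \_ unitI) (fracpart (z.1 - z.2)) * (phi \_ unitI) z.2))%:E.

Let mK : measurable_fun setT K.
Proof.
apply/measurable_EFinP; apply: measurable_funM.
  by apply: measurableT_comp => //; exact: measurable_fst.
apply: measurable_funM; last first.
  apply: measurableT_comp; [exact: measurable_restrict_density|exact: measurable_snd].
apply: measurableT_comp; first exact: measurable_restrict_density.
apply: measurableT_comp; first exact: measurable_fracpart.
by apply: measurable_funB; [exact: measurable_fst|exact: measurable_snd].
Qed.

Let K0 z : (0 <= K z)%E.
Proof.
by rewrite lee_fin !mulr_ge0 ?restrict_density_ge0.
Qed.

Lemma ge0_convolution_fubini :
  (\int[mu]_(x in unitI) \int[mu]_(y in unitI) (h x * (f (fracpart (x - y)) * phi y))%:E =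
   \int[mu]_(y in unitI) \int[mu]_(x in unitI) (h x * (f (fracpart (x - y)) * phi y))%:E)%E.
Proof.
pose KI (z : R * R) : \bar R := (K z * (\1_unitI z.1)%:E)%E.
have mKI : measurable_fun setT KI.
  apply: emeasurable_funM => //; apply/measurable_EFinP.
  apply: measurableT_comp; last exact: measurable_fst.
  by apply: measurable_indic; exact: measurable_unitI.
have KI0 z : (0 <= KI z)%E by rewrite mule_ge0// lee_fin.
have E x y : KI (x, y) =
    (((fun x' => (((fun y' => (h x' * (f (fracpart (x' - y')) * phi y'))%:E)
       \_ unitI) y)) \_ unitI) x)%E.
  rewrite /KI /K/= indicE !patchE; case: (x \in unitI); last by rewrite mule0.
  rewrite mule1 (mem_set (fracpart_itv _)); case: (y \in unitI) => //.
  by rewrite (_ : point = 0)// !mulr0.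
have := @fubini_tonelli _ _ (measurableTypeR R) (measurableTypeR R) R mu mu KI mKI KI0.
rewrite /fubini_F /fubini_G => FT.
transitivity (\int[mu]_x \int[mu]_y KI (x, y))%E; last rewrite FT.
- rewrite [LHS]integral_mkcond; apply: eq_integral => x _.
  rewrite patchE; case: ifPn => xI.
    rewrite [LHS]integral_mkcond; apply: eq_integral => y _.
    by rewrite E !patchE xI.
  by apply/esym/integral0_eq => y _; rewrite E patchE (negbTE xI).
- rewrite [RHS]integral_mkcond; apply: eq_integral => y _.
  rewrite patchE; case: ifPn => yI.
    rewrite [RHS]integral_mkcond; apply: eq_integral => x _.
    by rewrite E !patchE yI.
  apply: integral0_eq => x _; rewrite E patchE.
  by case: ifPn => [_|_]; [rewrite patchE (negbTE yI)|].
Qed.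

Lemma measurable_convolution :
  measurable_fun unitI (fun x => \int[mu]_(y in unitI) (h x * (f (fracpart (x - y)) * phi y))%:E)%E.
Proof.
have := @measurable_fun_fubini_tonelli_F _ _ (measurableTypeR R) (measurableTypeR R) R mu K mK K0.
move=> /(@measurable_funTS _ _ _ _ unitI); apply: eq_measurable_fun => x xI.
rewrite /fubini_F [RHS]integral_mkcond; apply: eq_integral => y _.
rewrite patchE /K/= [(phi \_ _) _]patchE; case: ifPn => yI.
  by rewrite restrict_unitIE//; exact: fracpart_itv.
by rewrite (_ : point = 0)// !mulr0.
Qed.

(** For fixed [y], the substitution [u = x - y] modulo 1 is a rotation of [unitI]; periodicity of
    [h] allows evaluation at the unreduced point [u + y]. *)
Lemma ge0_convolution_periodic : (forall x, h (fracpart x) = h x) ->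
  (\int[mu]_(x in unitI) \int[mu]_(y in unitI) (h x * (f (fracpart (x - y)) * phi y))%:E =
   \int[mu]_(y in unitI) \int[mu]_(u in unitI) (h (u + y) * (f u * phi y))%:E)%E.
Proof.
move=> hper; rewrite ge0_convolution_fubini; apply: eq_integral => y /set_mem yI.
pose H u := (h (u + y) * ((f \_ unitI) u * phi y))%:E.
have py : 0 <= phi y by case: dphi => _ + _ _; exact.
have H0 u : (0 <= H u)%E by rewrite lee_fin !mulr_ge0 ?restrict_density_ge0.
have mH : measurable_fun setT H.
  apply/measurable_EFinP; apply: measurable_funM.
    by apply: measurableT_comp => //; exact: measurable_funD.
  by apply: measurable_funM => //; exact: measurable_restrict_density.
transitivity (\int[mu]_(u in unitI) H u)%E; last first.
  by apply: eq_integral => u /set_mem uI; rewrite /H restrict_unitIE.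
rewrite -(ge0_integral_rotation (- y) mH H0).
apply: eq_integral => x _; rewrite /H restrict_unitIE; last exact: fracpart_itv.
by rewrite -[h (_ + y)]hper fracpartDl subrK hper.
Qed.

End convolution_kernel.

Lemma integral_density p : density p -> (\int[mu]_(x in unitI) (p x)%:E = 1)%E.
Proof. by case. Qed.

Lemma ge0_expectation_convolution d (T : measurableType d) (P : probability T R)
    (X : {RV P >-> R}) (f phi h : R -> R) :
  density f -> density phi -> has_density X (cconv f phi) ->
  measurable_fun setT h -> (forall x, 0 <= h x) -> (forall x, h (fracpart x) = h x) ->
  (\int[P]_w (h (X w))%:E =
   \int[mu]_(y in unitI) \int[mu]_(u in unitI) (h (u + y) * (f u * phi y))%:E)%E.
Proof.
move=> df dphi dX mh h0 hper.
pose F (x : R) := (\int[mu]_(y in unitI) (f (fracpart (x - y)) * phi y)%:E)%E.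
have k0 x y : unitI y -> 0 <= f (fracpart (x - y)) * phi y.
  move=> yI; rewrite mulr_ge0//; first by case: df => _ + _ _; apply; exact: fracpart_itv.
  by case: dphi => _ + _ _; exact.
have F0 x : (0 <= F x)%E by apply: integral_ge0 => y yI; rewrite lee_fin k0.
have mF : measurable_fun unitI F.
  have := @measurable_convolution f phi (cst 1) df dphi (measurable_cst _) (fun=> ler01).
  by apply: eq_measurable_fun => x _; apply: eq_integral => y _ /=; rewrite mul1r.
have FE x : cconv f phi x = fine (F x) by [].
have iF : mu.-integrable unitI F.
  apply/integrableP; split => //.
  under eq_integral do rewrite gee0_abs//.
  rewrite (_ : (\int[mu]_(x in _) _)%E = 1%E) ?ltry//.
  transitivity (\int[mu]_(x in unitI) \int[mu]_(y in unitI)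
      ((cst 1 x : R) * (f (fracpart (x - y)) * phi y))%:E)%E.
    by apply: eq_integral => x _; apply: eq_integral => y _ /=; rewrite mul1r.
  rewrite (@ge0_convolution_periodic f phi (cst 1) df dphi (measurable_cst _) (fun=> ler01) (fun=> erefl)).
  rewrite -(integral_density dphi); apply: eq_integral => y /set_mem yI.
  transitivity ((phi y)%:E * \int[mu]_(u in unitI) (f u)%:E)%E; last first.
    by rewrite (integral_density df) mule1.
  rewrite -ge0_integralZl_EFin//.
  - by apply: eq_integral => u _ /=; rewrite mul1r mulrC EFinM.
  - exact: measurable_unitI.
  - by move=> x xI; rewrite lee_fin; case: df => _ + _ _; exact.
  - by apply/measurable_EFinP; case: df.
  - by case: dphi => _ + _ _; exact.
(* [cconv] is [fine] of the extended integral [F], hence 0 wherever [F] is infinite. As [F] has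
   total mass 1, this happens on a null set only. *)
have aeF : ae_eq mu unitI F (EFin \o cconv f phi).
  have mI : measurable (@unitI R : set (measurableTypeR R)) := measurable_unitI.
  have := integrable_ae mI iF; apply: filterS => x Fx xI.
  by rewrite /= FE fineK// Fx.
have mg : measurable_fun unitI (cconv f phi).
  by apply: measurableT_comp mF => //; exact: fine_measurable.
have g0 x : unitI x -> 0 <= cconv f phi x by move=> _; rewrite FE fine_ge0.
rewrite -(ge0_convolution_periodic df dphi mh h0 hper).
rewrite (@ge0_expectation_density _ _ _ _ _ (EFin \o h) dX mg g0)//; last first.
  exact/measurable_EFinP.
transitivity (\int[mu]_(x in unitI) ((h x)%:E * F x))%E.
  apply: ae_eq_integral.
  - exact: measurable_unitI.
  - by apply: emeasurable_funM; apply/measurable_EFinP => //; exact: measurable_funTS.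
  - by apply: emeasurable_funM => //; apply/measurable_EFinP; exact: measurable_funTS.
  - by apply: ae_eqe_mul2l; exact: ae_eq_sym.
apply: eq_integral => x xI; rewrite -ge0_integralZl_EFin//.
- exact: measurable_unitI.
- by move=> y yI; rewrite lee_fin k0.
- apply/measurable_EFinP; apply: measurable_funM; last by case: dphi.
  have m1 : measurable_fun unitI (fun y : R => (f \_ unitI) (fracpart ((x : R) - y))).
    apply: measurable_funTS; apply: measurableT_comp; first exact: measurable_restrict_density.
    by apply: measurableT_comp; [exact: measurable_fracpart|exact: measurable_funB].
  apply: eq_measurable_fun m1 => y _.
  by rewrite restrict_unitIE//; exact: fracpart_itv.
Qed.

End moments.

(** * Linearity and comparison for integrals of real-valued functions *)

Section real_integrals.
Context d (T : measurableType d) (R : realType).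
Variables (m : {measure set T -> \bar R}) (D : set T).
Hypothesis mD : measurable D.
Implicit Types p q h : T -> R.

Lemma EFin_Rintegral p : m.-integrable D (EFin \o p) ->
  (\int[m]_(x in D) (p x)%:E)%E = (\int[m]_(x in D) p x)%:E.
Proof. by move=> ip; rewrite /Rintegral fineK//; exact: integrable_fin_num. Qed.

Lemma integrable_bounded p (M : R) : (m D < +oo)%E -> measurable_fun D p ->
  (forall x, D x -> `|p x| <= M) -> m.-integrable D (EFin \o p).
Proof.
move=> mDoo mp pM; apply: measurable_bounded_integrable => //.
exists M; split; first exact: num_real.
by move=> x Mx y Dy /=; rewrite (le_trans (pM _ Dy))// ltW.
Qed.

Lemma integrable_mul_bounded p h (M : R) : m.-integrable D (EFin \o p) ->
  measurable_fun D h -> (forall x, D x -> `|h x| <= M) ->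
  m.-integrable D (EFin \o (fun x => p x * h x)).
Proof.
move=> ip mh hM.
have bh : [bounded h x | x in D].
  exists M; split; first exact: num_real.
  by move=> x Mx y Dy /=; rewrite (le_trans (hM _ Dy))// ltW.
by have := integrableMl mD ip mh bh.
Qed.

Lemma integrable_add p q : m.-integrable D (EFin \o p) -> m.-integrable D (EFin \o q) ->
  m.-integrable D (EFin \o (fun x => p x + q x)).
Proof. by move=> ip iq; have := integrableD mD ip iq. Qed.

Lemma integrable_sub p q : m.-integrable D (EFin \o p) -> m.-integrable D (EFin \o q) ->
  m.-integrable D (EFin \o (fun x => p x - q x)).
Proof. by move=> ip iq; have := integrableB mD ip iq. Qed.

Lemma integrable_scale p (c : R) : m.-integrable D (EFin \o p) ->
  m.-integrable D (EFin \o (fun x => c * p x)).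
Proof. by move=> ip; have := integrableZl mD c ip. Qed.

Lemma integrable_bigsum (I : Type) (s : seq I) (P : pred I) (F : I -> T -> R) :
  (forall i, m.-integrable D (EFin \o F i)) ->
  m.-integrable D (EFin \o (fun x => \sum_(i <- s | P i) F i x)).
Proof.
move=> iF; elim: s => [|i s IH].
  rewrite (_ : _ \o _ = cst 0%E); first exact: integrable0.
  by apply/funext => x /=; rewrite big_nil.
rewrite (_ : _ \o _ = EFin \o (fun x => if P i then F i x + \sum_(i <- s | P i) F i x
   else \sum_(i <- s | P i) F i x)); last by apply/funext => x /=; rewrite big_cons.
by case: (P i) => //; exact: integrable_add.
Qed.

Lemma Rintegral_bigsum (I : Type) (s : seq I) (P : pred I) (F : I -> T -> R) :
  (forall i, m.-integrable D (EFin \o F i)) ->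
  \int[m]_(x in D) (\sum_(i <- s | P i) F i x) = \sum_(i <- s | P i) \int[m]_(x in D) F i x.
Proof.
move=> iF; elim: s => [|i s IH].
  rewrite big_nil; under eq_Rintegral do rewrite big_nil.
  by rewrite /Rintegral integral0.
rewrite big_cons; under eq_Rintegral do rewrite big_cons; case: ifP => // _.
by rewrite RintegralD//; [rewrite IH|exact: integrable_bigsum].
Qed.

(* No measurability is required of the smaller function: the Lebesgue integral
   of a non-negative function is a supremum over simple functions below it. *)
Lemma ge0_le_integral_nonmeasurable (f1 f2 : T -> \bar R) :
  (forall x, D x -> 0 <= f1 x)%E -> (forall x, D x -> f1 x <= f2 x)%E ->
  (\int[m]_(x in D) f1 x <= \int[m]_(x in D) f2 x)%E.
Proof.
move=> f10 f12; rewrite !ge0_integralE//; last first.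
  by move=> x Dx; rewrite (le_trans _ (f12 _ Dx))// f10.
apply: le_ereal_sup => _ [h /= hf <-]; exists h => // x.
rewrite (le_trans (hf x))// !patchE; case: ifPn => // /set_mem Dx; exact: f12.
Qed.

End real_integrals.

(** * Trigonometric moments *)

Section trigonometric_moments.
Context {R : realType}.
Local Notation mu := (@lebesgue_measure R).
Implicit Types (p : R -> R) (j l : nat).

Definition cosn j (x : R) : R := cos (2 * pi * j%:R * x).
Definition sinn j (x : R) : R := sin (2 * pi * j%:R * x).
(** Since [e_j] carries the exponent [-2 pi i j x] and is conjugated in the inner product, [cosfc]
    and [sinfc] are the real and imaginary parts of [p_j], both with a plus sign. *)
Definition cosfc p j : R := \int[mu]_(x in unitI) (p x * cosn j x).
Definition sinfc p j : R := \int[mu]_(x in unitI) (p x * sinn j x).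

Lemma measurable_cosn D j : measurable_fun D (cosn j).
Proof.
apply: measurable_funTS; apply: measurableT_comp; last exact: mulrl_measurable.
by apply: continuous_measurable_fun; exact: continuous_cos.
Qed.

Lemma measurable_sinn D j : measurable_fun D (sinn j).
Proof.
apply: measurable_funTS; apply: measurableT_comp; last exact: mulrl_measurable.
by apply: continuous_measurable_fun; exact: continuous_sin.
Qed.

Lemma normr_cosn j x : `|cosn j x| <= 1.
Proof. by rewrite ler_norml cos_geN1 cos_le1. Qed.

Lemma normr_sinn j x : `|sinn j x| <= 1.
Proof. by rewrite ler_norml sin_geN1 sin_le1. Qed.

Lemma cosn_sqrD_sinn_sqr j x : cosn j x ^+ 2 + sinn j x ^+ 2 = 1.
Proof. exact: cos2Dsin2. Qed.

Lemma cosnD j x y : cosn j (x + y) = cosn j x * cosn j y - sinn j x * sinn j y.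
Proof. by rewrite /cosn mulrDr cosD. Qed.

Lemma sinnD j x y : sinn j (x + y) = sinn j x * cosn j y + cosn j x * sinn j y.
Proof. by rewrite /sinn mulrDr sinD. Qed.

Lemma angleB j l x : (l <= j)%N ->
  2 * pi * (j - l)%:R * x = 2 * pi * j%:R * x - 2 * pi * l%:R * x :> R.
Proof. by move=> lj; rewrite natrB//; ring. Qed.

Lemma angleD j l x : 2 * pi * (j + l)%:R * x = 2 * pi * j%:R * x + 2 * pi * l%:R * x :> R.
Proof. by rewrite natrD; ring. Qed.

Lemma cosn_cosn j l x : (l <= j)%N ->
  cosn j x * cosn l x = 2^-1 * (cosn (j - l) x + cosn (j + l) x).
Proof.
by move=> lj; rewrite /cosn (angleB _ lj) angleD cosB cosD; lra.
Qed.

Lemma sinn_sinn j l x : (l <= j)%N ->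
  sinn j x * sinn l x = 2^-1 * (cosn (j - l) x - cosn (j + l) x).
Proof.
by move=> lj; rewrite /sinn /cosn (angleB _ lj) angleD cosB cosD; lra.
Qed.

Lemma sinn_cosn j l x : (l <= j)%N ->
  sinn j x * cosn l x = 2^-1 * (sinn (j - l) x + sinn (j + l) x).
Proof.
by move=> lj; rewrite /sinn /cosn (angleB _ lj) angleD sinB sinD; lra.
Qed.

Lemma cosn_sinn j l x : (l <= j)%N ->
  cosn j x * sinn l x = 2^-1 * (sinn (j + l) x - sinn (j - l) x).
Proof.
by move=> lj; rewrite /sinn /cosn (angleB _ lj) angleD sinB sinD; lra.
Qed.

Lemma cosn0 x : cosn 0 x = 1. Proof. by rewrite /cosn mulr0 mul0r cos0. Qed.
Lemma sinn0 x : sinn 0 x = 0. Proof. by rewrite /sinn mulr0 mul0r sin0. Qed.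

Lemma cossin_period (n : nat) (x : R) :
  (cos (x + 2 * pi * n%:R) = cos x) * (sin (x + 2 * pi * n%:R) = sin x).
Proof.
rewrite (_ : 2 * pi * n%:R = pi *+ 2 *+ n); last by rewrite -(mulr_natr (pi *+ 2) n) -(mulr_natr pi 2); ring.
by split; apply: periodicn; [exact: cosD2pi|exact: sinD2pi].
Qed.

Lemma cossinnDn j (n : nat) x :
  (cosn j (x + n%:R) = cosn j x) * (sinn j (x + n%:R) = sinn j x).
Proof.
rewrite /cosn /sinn (_ : _ * (x + n%:R) = 2 * pi * j%:R * x + 2 * pi * (j * n)%:R).
  by split; rewrite cossin_period.
by rewrite natrM; ring.
Qed.

Lemma cossinn_fracpart j x : (cosn j (fracpart x) = cosn j x) * (sinn j (fracpart x) = sinn j x).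
Proof.
rewrite /fracpart; case: (Num.floor x) => n.
  by have [<- <-] := cossinnDn j n (x - n%:R); rewrite subrK.
by rewrite NegzE rmorphN/= opprK !cossinnDn.
Qed.

Lemma measurable_unitR : measurable (@unitI R : set (measurableTypeR R)).
Proof. exact: measurable_unitI. Qed.

Local Notation L1 p := (mu.-integrable unitI (EFin \o p)).

Lemma unitI_finite : (mu unitI < +oo)%E.
Proof. by rewrite lebesgue_unitI ltry. Qed.

Lemma integrable_unitI_bounded p (M : R) : measurable_fun setT p ->
  (forall x, `|p x| <= M) -> L1 p.
Proof.
move=> mp pM; apply: (@integrable_bounded _ _ _ _ _ measurable_unitR _ M) => //.
- exact: unitI_finite.
- exact: measurable_funTS.
Qed.

Lemma integrable_cosn j : L1 (cosn j).
Proof. by apply: (@integrable_unitI_bounded _ 1) => //; [exact: measurable_cosn|exact: normr_cosn]. Qed.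

Lemma integrable_sinn j : L1 (sinn j).
Proof. by apply: (@integrable_unitI_bounded _ 1) => //; [exact: measurable_sinn|exact: normr_sinn]. Qed.

Lemma integrable_mul_cosn p j : L1 p -> L1 (fun x => p x * cosn j x).
Proof.
move=> ip; apply: (@integrable_mul_bounded _ _ _ _ _ measurable_unitR _ _ 1) => //.
  exact: measurable_cosn.
by move=> x _; exact: normr_cosn.
Qed.

Lemma integrable_mul_sinn p j : L1 p -> L1 (fun x => p x * sinn j x).
Proof.
move=> ip; apply: (@integrable_mul_bounded _ _ _ _ _ measurable_unitR _ _ 1) => //.
  exact: measurable_sinn.
by move=> x _; exact: normr_sinn.
Qed.

Lemma integrable_cst_unitI (c : R) : L1 (fun=> c).
Proof. by apply: (@integrable_unitI_bounded _ `|c|). Qed.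

Lemma Rintegral_cst_unitI (c : R) : \int[mu]_(x in unitI) c = c.
Proof.
rewrite Rintegral_cst; last exact: measurable_unitR.
by rewrite [X in fine X]lebesgue_unitI /= mulr1.
Qed.

(* Rotating by half a period [1/(2j)] changes the sign of both functions. *)
Lemma Rintegral_cossinn j : (0 < j)%N ->
  (\int[mu]_(x in unitI) cosn j x = 0) * (\int[mu]_(x in unitI) sinn j x = 0).
Proof.
move=> j0; have jR : (j%:R : R) != 0 by rewrite pnatr_eq0 -lt0n.
pose a : R := (2 * j%:R)^-1.
have aE : 2 * pi * j%:R * a = pi :> R by rewrite /a; field.
have cosa : cosn j a = -1 by rewrite /cosn aE cospi.
have sina : sinn j a = 0 by rewrite /sinn aE sinpi.
(* Rotation invariance is available for non-negative functions, so it is applied to [1 + h]; the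
   rotation turns this into [1 - h], and equality of the two integrals forces that of [h] to
   vanish. *)
have shift (h : R -> R) : measurable_fun setT h -> (forall x, `|h x| <= 1) ->
    (forall x, h (fracpart x) = h x) -> (forall x, h (x + a) = - h x) ->
    \int[mu]_(x in unitI) h x = 0.
  move=> mh h1 hper ha.
  have ih : L1 h by exact: (integrable_unitI_bounded mh h1).
  have iN : L1 (fun x => 1 - h x) by apply: (integrable_sub measurable_unitR) => //; exact: integrable_cst_unitI.
  have iP : L1 (fun x => 1 + h x) by apply: (integrable_add measurable_unitR) => //; exact: integrable_cst_unitI.
  have m1 : measurable_fun setT (fun x => (1 + h x)%:E).
    by apply/measurable_EFinP; exact: measurable_funD.
  have p1 x : (0 <= (1 + h x)%:E)%E.
    by rewrite lee_fin; have := h1 x; rewrite ler_norml; lra.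
  have := ge0_integral_rotation a m1 p1.
  rewrite [X in _ = X -> _](EFin_Rintegral measurable_unitR iP).
  under eq_integral do rewrite hper ha.
  rewrite (EFin_Rintegral measurable_unitR iN) => -[].
  rewrite RintegralB ?RintegralD//; try exact: measurable_unitR; try exact: integrable_cst_unitI.
  by lra.
split; apply: shift.
- exact: measurable_cosn.
- exact: normr_cosn.
- by move=> x; rewrite cossinn_fracpart.
- by move=> x; rewrite cosnD cosa sina; lra.
- exact: measurable_sinn.
- exact: normr_sinn.
- by move=> x; rewrite cossinn_fracpart.
- by move=> x; rewrite sinnD cosa sina; lra.
Qed.

Lemma Rintegral_cosn j : \int[mu]_(x in unitI) cosn j x = (j == 0%N)%:R.
Proof.
have [->|j0] := eqVneq j 0%N.
  by under eq_Rintegral do rewrite cosn0; rewrite Rintegral_cst_unitI.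
by rewrite Rintegral_cossinn ?lt0n.
Qed.

Lemma Rintegral_sinn j : \int[mu]_(x in unitI) sinn j x = 0.
Proof.
have [->|j0] := eqVneq j 0%N.
  by under eq_Rintegral do rewrite sinn0; rewrite Rintegral_cst_unitI.
by rewrite Rintegral_cossinn ?lt0n.
Qed.

Lemma integrable_density p : density p -> L1 p.
Proof.
move=> dp; have [mp p0 p1 _] := dp; apply/integrableP; split; first exact/measurable_EFinP.
apply: (@le_lt_trans _ _ 1%E); last exact: ltry.
rewrite -p1 le_eqVlt; apply/orP; left; apply/eqP; apply: eq_integral.
by move=> x /set_mem xI /=; rewrite ger0_norm// p0.
Qed.

Lemma fcoef_nat p j : fcoef p j%:Z = Complex (cosfc p j) (sinfc p j).
Proof.
rewrite /fcoef /inner /cintegral; congr Complex; apply: eq_Rintegral => x _ /=;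
  rewrite !(cosN, sinN) -/(cosn j x) -/(sinn j x); ring.
Qed.

Lemma fcoef_oppn p j : L1 p -> fcoef p (- j%:Z) = Complex (cosfc p j) (- sinfc p j).
Proof.
move=> ip; have e (x : R) : - (2 * pi * (- j%:Z)%:~R * x) = 2 * pi * j%:R * x.
  by rewrite rmorphN/= -pmulrn; ring.
rewrite -[X in Complex _ X]mulN1r /fcoef /inner /cintegral; congr Complex.
  by apply: eq_Rintegral => x _ /=; rewrite e; rewrite -/(cosn j x) -/(sinn j x); ring.
rewrite /sinfc -RintegralZl; [|exact: measurable_unitR|exact: integrable_mul_sinn].
by apply: eq_Rintegral => x _ /=; rewrite e; rewrite -/(cosn j x) -/(sinn j x); ring.
Qed.

Section moments_of_convolution.
Context d (T : measurableType d) (P : probability T R).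
Variables (X : {RV P >-> R}) (f phi : R -> R).
Hypotheses (df : density f) (dphi : density phi) (dX : has_density X (cconv f phi)).

(** The addition formula separates the variables of the double integral. With [t] a cosine or a sine
    this gives the real and imaginary parts of [g_j = f_j phi_j]. Again [1 + t] replaces [t] to stay
    among non-negative functions. *)
Lemma expectation_convolution_trig j (t : R -> R) (a b : R -> R) :
  measurable_fun setT t -> (forall x, `|t x| <= 1) -> (forall x, t (fracpart x) = t x) ->
  L1 (fun x => f x * a x) -> L1 (fun x => f x * b x) ->
  (forall u y, t (u + y) = a u * cosn j y + b u * sinn j y) ->
  \int[P]_w t (X w) = (\int[mu]_(x in unitI) (f x * a x)) * cosfc phi j +
    (\int[mu]_(x in unitI) (f x * b x)) * sinfc phi j.
Proof.
move=> mt t1 tper; set A := fun x => f x * a x; set B := fun x => f x * b x.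
move=> iA iB tD; have mI := measurable_unitR.
have [iphi fi] := (integrable_density dphi, integrable_density df).
have mh : measurable_fun setT (fun x => 1 + t x) by exact: measurable_funD.
have h0 x : 0 <= 1 + t x by have := t1 x; rewrite ler_norml; lra.
have hper x : 1 + t (fracpart x) = 1 + t x by rewrite tper.
have := ge0_expectation_convolution df dphi dX mh h0 hper.
have itX : P.-integrable setT (EFin \o (fun w => t (X w))).
  apply: (@integrable_bounded _ _ _ _ _ _ _ 1) => //.
    by rewrite (le_lt_trans (probability_le1 _ _)) ?ltry.
  exact: measurableT_comp.
have i1 : P.-integrable setT (EFin \o (fun w : T => 1 : R)).
  apply: (@integrable_bounded _ _ _ _ _ _ _ 1) => //.
    by rewrite (le_lt_trans (probability_le1 _ _)) ?ltry.
  by move=> x _; rewrite normr1.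
have E1 : \int[P]_w (1 : R) = 1 by rewrite Rintegral_cst// [X in fine X]probability_setT mulr1.
rewrite (EFin_Rintegral measurableT (integrable_add measurableT i1 itX)) RintegralD// E1.
set a0 := \int[mu]_(x in unitI) A x; set b0 := \int[mu]_(x in unitI) B x.
have f1 : \int[mu]_(x in unitI) f x = 1 by rewrite /Rintegral (integral_density df).
have phi1 : \int[mu]_(x in unitI) phi x = 1 by rewrite /Rintegral (integral_density dphi).
have inner y : (\int[mu]_(u in unitI) ((1 + t (u + y)) * (f u * phi y))%:E)%E =
    (phi y + a0 * (phi y * cosn j y) + b0 * (phi y * sinn j y))%:E.
  have iu : L1 (fun u => phi y * f u + (phi y * cosn j y) * A u + (phi y * sinn j y) * B u).
    by do 2?[apply: (integrable_add mI)]; exact: (integrable_scale mI).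
  transitivity (\int[mu]_(u in unitI) (phi y * f u + (phi y * cosn j y) * A u +
      (phi y * sinn j y) * B u)%:E)%E.
    by apply: eq_integral => u _; rewrite tD /A /B; congr (_%:E); ring.
  rewrite (EFin_Rintegral mI iu) !RintegralD//; try exact: (integrable_scale mI).
    by rewrite !RintegralZl// -/a0 -/b0 f1; congr (_%:E); ring.
  by apply: (integrable_add mI); exact: (integrable_scale mI).
rewrite [X in _ = X -> _](_ : _ = \int[mu]_(y in unitI)
    (phi y + a0 * (phi y * cosn j y) + b0 * (phi y * sinn j y))%:E)%E; last first.
  by apply: eq_integral => y _; exact: inner.
have ic := integrable_scale mI a0 (integrable_mul_cosn j iphi).
have isn := integrable_scale mI b0 (integrable_mul_sinn j iphi).
rewrite (EFin_Rintegral mI); last by do 2?[apply: (integrable_add mI)].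
rewrite !RintegralD//; last exact: (integrable_add mI).
rewrite !RintegralZl//; [|exact: integrable_mul_sinn|exact: integrable_mul_cosn].
by rewrite phi1 => -[]; rewrite -/(cosfc phi j) -/(sinfc phi j); lra.
Qed.

Lemma expectation_cosn j :
  \int[P]_w cosn j (X w) = cosfc f j * cosfc phi j - sinfc f j * sinfc phi j.
Proof.
have fi := integrable_density df; have mI := measurable_unitR.
have iN := integrable_scale mI (-1) (integrable_mul_sinn j fi).
rewrite (@expectation_convolution_trig j _ (cosn j) (fun x => - sinn j x)).
- rewrite -mulNr; congr (_ + _ * _); rewrite -[RHS]mulN1r -RintegralZl//; last exact: integrable_mul_sinn.
  by apply: eq_Rintegral => x _; ring.
- exact: measurable_cosn.
- exact: normr_cosn.
- by move=> x; rewrite cossinn_fracpart.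
- exact: integrable_mul_cosn.
- by apply: eq_integrable iN => // x _ /=; congr (_%:E); ring.
- by move=> u y; rewrite cosnD; ring.
Qed.

Lemma expectation_sinn j :
  \int[P]_w sinn j (X w) = sinfc f j * cosfc phi j + cosfc f j * sinfc phi j.
Proof.
have fi := integrable_density df.
rewrite (@expectation_convolution_trig j _ (sinn j) (cosn j)) //.
- exact: measurable_sinn.
- exact: normr_sinn.
- by move=> x; rewrite cossinn_fracpart.
- exact: integrable_mul_sinn.
- exact: integrable_mul_cosn.
- by move=> u y; rewrite sinnD.
Qed.

End moments_of_convolution.
End trigonometric_moments.

(** * Parseval *)

Lemma Rintegral_dominated_le d (T : measurableType d) (R : realType)
    (m : {measure set T -> \bar R}) (D : set T) (u : nat -> T -> R) (v g : T -> R) (c : R) :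
  measurable D -> (forall n, measurable_fun D (u n)) -> measurable_fun D v ->
  {ae m, forall x, D x -> u ^~ x @ \oo --> v x} ->
  m.-integrable D (EFin \o g) ->
  (forall n x, D x -> `|u n x| <= g x) ->
  (forall n, \int[m]_(x in D) u n x <= c) ->
  m.-integrable D (EFin \o v) /\ \int[m]_(x in D) v x <= c.
Proof.
move=> mD mu_ mv uv ig ug uc.
have iu n : m.-integrable D (EFin \o u n).
  apply: le_integrable ig => //; first exact/measurable_EFinP.
  by move=> x Dx /=; rewrite lee_fin (le_trans (ug n x Dx))// ler_norm.
have [|||//||iv _] := @dominated_convergence _ _ _ m D mD (fun n => EFin \o u n) (EFin \o v) (EFin \o g).
- by move=> n; exact/measurable_EFinP.
- exact/measurable_EFinP.
- apply: filterS uv => x H Dx; apply: cvg_EFin; last exact: H.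
  by apply: nearW => n.
- by apply: aeW => x n Dx /=; rewrite lee_fin ug.
move=> cv; split=> //.
have H : (\int[m]_(x in D) (v x)%:E <= c%:E)%E.
  rewrite -(cvg_lim _ cv)//; apply: lime_le; first by apply/cvg_ex; eexists; exact: cv.
  by apply: nearW => n /=; rewrite (EFin_Rintegral mD (iu n)) lee_fin.
by move: H; rewrite EFin_Rintegral// lee_fin.
Qed.

Section parseval.
Context {R : realType}.
Local Notation mu := (@lebesgue_measure R).
Local Notation L1 p := (mu.-integrable unitI (EFin \o p)).
Implicit Types (p q G h : R -> R) (a b : nat -> R).
Local Notation mI := measurable_unitR.

(** The factor 2 merges the conjugate frequencies [j] and [-j] of a real function. The bound [N] is
    exclusive, so the estimator with cutoff [k] is a [trigpoly k.+1]. *)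
Definition trigpoly (N : nat) a b (x : R) : R :=
  a 0%N + 2 * \sum_(1 <= j < N) (a j * cosn j x + b j * sinn j x).

Lemma integrable_trigpoly_terms p a b : L1 p ->
  forall j, L1 (fun x => a j * (p x * cosn j x) + b j * (p x * sinn j x)).
Proof.
move=> ip j; apply: (integrable_add mI); apply: (integrable_scale mI).
  exact: integrable_mul_cosn.
exact: integrable_mul_sinn.
Qed.

Lemma mul_trigpolyE p N a b x : p x * trigpoly N a b x =
  a 0%N * p x + 2 * \sum_(1 <= j < N) (a j * (p x * cosn j x) + b j * (p x * sinn j x)).
Proof.
rewrite /trigpoly mulrDr [p x * a _]mulrC [p x * (2 * _)]mulrCA [p x * bigop _ _ _]mulr_sumr; congr (_ + _ * _).
by apply: eq_bigr => j _; ring.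
Qed.

Lemma integrable_mul_trigpoly p N a b : L1 p -> L1 (fun x => p x * trigpoly N a b x).
Proof.
move=> ip; under eq_fun do rewrite mul_trigpolyE.
apply: (integrable_add mI); first exact: (integrable_scale mI).
apply: (integrable_scale mI); apply: (integrable_bigsum mI).
exact: integrable_trigpoly_terms.
Qed.

Lemma Rintegral_mul_trigpoly p N a b : L1 p ->
  \int[mu]_(x in unitI) (p x * trigpoly N a b x) =
  a 0%N * \int[mu]_(x in unitI) p x +
  2 * \sum_(1 <= j < N) (a j * cosfc p j + b j * sinfc p j).
Proof.
move=> ip; under eq_Rintegral do rewrite mul_trigpolyE.
have isum := integrable_bigsum mI (index_iota 1 N) xpredT (integrable_trigpoly_terms a b ip).
rewrite RintegralD; [|exact: mI|exact: (integrable_scale mI)|exact: (integrable_scale mI)].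
rewrite !RintegralZl//; try exact: mI.
congr (_ + _ * _); rewrite (Rintegral_bigsum mI _ _ (integrable_trigpoly_terms a b ip)).
apply: eq_bigr => j _; rewrite RintegralD; [|exact: mI|apply: (integrable_scale mI)..].
- by rewrite !RintegralZl//; [exact: mI|exact: integrable_mul_sinn|exact: mI|exact: integrable_mul_cosn].
- exact: integrable_mul_cosn.
- exact: integrable_mul_sinn.
Qed.

Lemma orthogonality j l : (0 < j)%N -> (0 < l)%N ->
  ((cosfc (@cosn R j) l = 2^-1 * (l == j)%:R) * (sinfc (@cosn R j) l = 0)) *
  ((cosfc (@sinn R j) l = 0) * (sinfc (@sinn R j) l = 2^-1 * (l == j)%:R)).
Proof.
have half (s t : R) (u v : R -> R) : L1 u -> L1 v ->
    \int[mu]_(x in unitI) (2^-1 * (s * u x + t * v x)) =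
    2^-1 * (s * \int[mu]_(x in unitI) u x + t * \int[mu]_(x in unitI) v x).
  move=> iu iv; rewrite RintegralZl//; [|exact: mI|]; last first.
    by apply: (integrable_add mI); exact: (integrable_scale mI).
  rewrite RintegralD; [|exact: mI|exact: (integrable_scale mI)..].
  by rewrite !RintegralZl//; exact: mI.
have [cc sc] : (forall j, L1 (@cosn R j)) /\ (forall j, L1 (@sinn R j)).
  by split; [exact: integrable_cosn|exact: integrable_sinn].
move=> j0 l0; rewrite /cosfc /sinfc.
have E0 : (j + l == 0)%N = false by rewrite addn_eq0 -leqn0 leqNgt j0.
have [lj|/ltnW jl] := leqP l j.
- have -> : (l == j)%:R = ((j - l == 0)%N)%:R :> R by rewrite subn_eq0 eqn_leq lj.
  have [ccE ssE] := (half 1 1 _ _ (cc (j - l)%N) (cc (j + l)%N), half 1 (-1) _ _ (cc (j - l)%N) (cc (j + l)%N)).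
  have [scE csE] := (half 1 1 _ _ (sc (j - l)%N) (sc (j + l)%N), half 1 (-1) _ _ (sc (j + l)%N) (sc (j - l)%N)).
  rewrite !Rintegral_cosn E0 in ccE ssE; rewrite !Rintegral_sinn in scE csE.
  split; split.
  + by apply: (etrans _ (etrans ccE _)); [apply: eq_Rintegral => x _; rewrite cosn_cosn//; ring|rewrite ?mul1r ?mulr0 ?addr0 ?mulr0//].
  + by apply: (etrans _ (etrans csE _)); [apply: eq_Rintegral => x _; rewrite cosn_sinn//; ring|rewrite ?mul1r ?mulr0 ?addr0 ?mulr0//].
  + by apply: (etrans _ (etrans scE _)); [apply: eq_Rintegral => x _; rewrite sinn_cosn//; ring|rewrite ?mul1r ?mulr0 ?addr0 ?mulr0//].
  + by apply: (etrans _ (etrans ssE _)); [apply: eq_Rintegral => x _; rewrite sinn_sinn//; ring|rewrite ?mul1r ?mulr0 ?addr0 ?mulr0//].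
- have -> : (l == j)%:R = ((l - j == 0)%N)%:R :> R by rewrite subn_eq0 eqn_leq jl andbT.
  rewrite addnC in E0.
  have [ccE ssE] := (half 1 1 _ _ (cc (l - j)%N) (cc (l + j)%N), half 1 (-1) _ _ (cc (l - j)%N) (cc (l + j)%N)).
  have [scE csE] := (half 1 1 _ _ (sc (l - j)%N) (sc (l + j)%N), half 1 (-1) _ _ (sc (l + j)%N) (sc (l - j)%N)).
  rewrite !Rintegral_cosn E0 in ccE ssE; rewrite !Rintegral_sinn in scE csE.
  split; split.
  + by apply: (etrans _ (etrans ccE _)); [apply: eq_Rintegral => x _; rewrite [LHS]mulrC cosn_cosn//; ring|rewrite ?mul1r ?mulr0 ?addr0 ?mulr0//].
  + by apply: (etrans _ (etrans scE _)); [apply: eq_Rintegral => x _; rewrite [LHS]mulrC sinn_cosn//; ring|rewrite ?mul1r ?mulr0 ?addr0 ?mulr0//].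
  + by apply: (etrans _ (etrans csE _)); [apply: eq_Rintegral => x _; rewrite [LHS]mulrC cosn_sinn//; ring|rewrite ?mul1r ?mulr0 ?addr0 ?mulr0//].
  + by apply: (etrans _ (etrans ssE _)); [apply: eq_Rintegral => x _; rewrite [LHS]mulrC sinn_sinn//; ring|rewrite ?mul1r ?mulr0 ?addr0 ?mulr0//].
Qed.

Lemma integrable_trigpoly N a b : L1 (trigpoly N a b).
Proof.
have := integrable_mul_trigpoly N a b (integrable_cst_unitI 1).
by under eq_fun do rewrite mul1r.
Qed.

Lemma Rintegral_trigpoly N a b : \int[mu]_(x in unitI) trigpoly N a b x = a 0%N.
Proof.
have := Rintegral_mul_trigpoly N a b (integrable_cst_unitI 1).
under eq_Rintegral do rewrite mul1r.
move=> ->; rewrite Rintegral_cst_unitI mulr1 big1_seq ?mulr0 ?addr0// => j.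
rewrite mem_index_iota => /andP[_ /andP[j0 _]]; rewrite /cosfc /sinfc.
under eq_Rintegral do rewrite mul1r; under [X in _ + _ * X]eq_Rintegral do rewrite mul1r.
by rewrite Rintegral_cosn Rintegral_sinn -leqn0 leqNgt j0/= !mulr0 addr0.
Qed.

Lemma fourier_trigpoly N a b j : (0 < j < N)%N ->
  (cosfc (trigpoly N a b) j = a j) * (sinfc (trigpoly N a b) j = b j).
Proof.
move=> /andP[j0 jN].
have jE (F : nat -> R) : \sum_(1 <= l < N) F l * (l == j)%:R = F j.
  rewrite (bigD1_seq j) ?mem_index_iota ?iota_uniq ?j0//= eqxx mulr1 big1 ?addr0//.
  by move=> l /negbTE ->; rewrite mulr0.
split; rewrite /cosfc /sinfc.
- under eq_Rintegral do rewrite mulrC.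
  rewrite Rintegral_mul_trigpoly; last exact: integrable_cosn.
  rewrite Rintegral_cossinn// mulr0 add0r -[RHS](jE a) mulr_sumr !big_nat.
  apply: eq_bigr => l /andP[l0 _]; rewrite orthogonality// (orthogonality j0 l0).1.2; lra.
- under eq_Rintegral do rewrite mulrC.
  rewrite Rintegral_mul_trigpoly; last exact: integrable_sinn.
  rewrite Rintegral_cossinn// mulr0 add0r -[RHS](jE b) mulr_sumr !big_nat.
  apply: eq_bigr => l /andP[l0 _]; rewrite (orthogonality j0 l0).2.1 (orthogonality j0 l0).2.2; lra.
Qed.

Lemma Rintegral_trigpoly_sqr N a b : \int[mu]_(x in unitI) (trigpoly N a b x ^+ 2) =
  a 0%N ^+ 2 + 2 * \sum_(1 <= j < N) (a j ^+ 2 + b j ^+ 2).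
Proof.
under eq_Rintegral do rewrite expr2.
rewrite Rintegral_mul_trigpoly; last exact: integrable_trigpoly.
rewrite Rintegral_trigpoly -expr2; congr (_ + _ * _); rewrite !big_nat.
by apply: eq_bigr => j jN; rewrite !fourier_trigpoly// !expr2.
Qed.

(** * The Fejer kernel and convergence of Fejer means *)

Definition fejer (N : nat) (u : R) : R :=
  1 + 2 * \sum_(1 <= j < N) (1 - j%:R / N%:R) * cosn j u.

Lemma cosn_rec n (u : R) : cosn n.+2 u = 2 * cosn 1 u * cosn n.+1 u - cosn n u.
Proof.
have := cosn_cosn u (ltn0Sn n : (1 <= n.+1)%N).
by rewrite subn1 addn1 /=; lra.
Qed.

Lemma dirichletM n (u : R) :
  (1 + 2 * \sum_(1 <= j < n.+1) cosn j u) * (2 - 2 * cosn 1 u) = 2 * cosn n u - 2 * cosn n.+1 u.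
Proof.
elim: n => [|n IH]; first by rewrite big_geq// cosn0; ring.
rewrite big_nat_recr//= cosn_rec; move: IH; set S := bigop _ _ _ => IH.
rewrite (_ : (1 + _) * _ = (1 + 2 * S) * (2 - 2 * cosn 1 u) + 2 * cosn n.+1 u * (2 - 2 * cosn 1 u)).
  by rewrite IH; ring.
by ring.
Qed.

(** [N * fejer N] is the sum of the first [N] Dirichlet kernels, so [dirichletM] telescopes. This is
    the closed form [sin^2(pi N u) / (N sin^2(pi u))] with the denominator, zero at integers,
    multiplied out. *)
Lemma fejerM N (u : R) : (0 < N)%N ->
  N%:R * fejer N u * (2 - 2 * cosn 1 u) = 2 - 2 * cosn N u.
Proof.
move=> N0; have NR : (N%:R : R) != 0 by rewrite pnatr_eq0 -lt0n.
have -> : N%:R * fejer N u = N%:R + 2 * \sum_(1 <= j < N) (N%:R - j%:R) * cosn j u.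
  rewrite /fejer mulrDr mulr1 [N%:R * (2 * _)]mulrCA [N%:R * bigop _ _ _]mulr_sumr; congr (_ + 2 * _).
  by apply: eq_bigr => j _; field.
elim: N {N0 NR} => [|N IH].
  by rewrite big_geq// cosn0; ring.
have -> : N.+1%:R + 2 * \sum_(1 <= j < N.+1) (N.+1%:R - j%:R) * cosn j u =
    (N%:R + 2 * \sum_(1 <= j < N) (N%:R - j%:R) * cosn j u) +
    (1 + 2 * \sum_(1 <= j < N.+1) cosn j u).
  have -> : \sum_(1 <= j < N.+1) (N.+1%:R - j%:R) * cosn j u =
     \sum_(1 <= j < N.+1) (N%:R - j%:R) * cosn j u + \sum_(1 <= j < N.+1) cosn j u.
    by rewrite -big_split/=; apply: eq_bigr => j _; rewrite -(addn1 N) natrD; ring.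
  case: N {IH} => [|N]; first by rewrite !big_geq//; ring.
  by rewrite [\sum_(1 <= j < N.+2) (_ - _) * _]big_nat_recr//= subrr mul0r addr0 -(addn1 N.+1) natrD; ring.
by rewrite mulrDl IH dirichletM; ring.
Qed.

(** Off the zeros of [2 - 2 * cosn 1 u] the sign is read off [fejerM]. At a zero, the recurrence
    gives [cosn j u = 1] for all [j], and the weights [1 - j / N] are non-negative. *)
Lemma fejer_ge0 N (u : R) : (0 < N)%N -> 0 <= fejer N u.
Proof.
move=> N0; have N0' : (0 : R) < N%:R by rewrite ltr0n.
have := fejerM u N0; have := normr_cosn 1 u; have := normr_cosn N u.
rewrite !ler_norml => /andP[_ cN] /andP[_]; rewrite le_eqVlt => /predU1P[c1 _|c1 E].
  have s1 : sinn 1 u = 0.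
    by apply/eqP; rewrite -sqrf_eq0; apply/eqP; have := cosn_sqrD_sinn_sqr 1 u; rewrite c1; lra.
  have cj j : cosn j u = 1.
    elim/ltn_ind: j => -[|[|j]] IH; rewrite ?cosn0 ?c1// cosn_rec c1 !IH//; ring.
  rewrite /fejer addr_ge0// mulr_ge0// big_nat sumr_ge0// => j /andP[_ jN].
  by rewrite cj mulr1 subr_ge0 ler_pdivrMr// mul1r ler_nat ltnW.
have : 0 <= N%:R * fejer N u * (2 - 2 * cosn 1 u) by lra.
by rewrite pmulr_lge0 ?pmulr_rge0//; lra.
Qed.

Lemma fejer_le N (u : R) : (0 < N)%N -> fejer N u * (2 - 2 * cosn 1 u) <= 4 / N%:R.
Proof.
move=> N0; rewrite ler_pdivlMr ?ltr0n// mulrC mulrA fejerM//.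
by have := normr_cosn N u; rewrite ler_norml; lra.
Qed.

Definition fejer_mean (N : nat) G (x : R) : R :=
  \int[mu]_(t in unitI) (G t * fejer N (x - t)).

Lemma fejer_subE N (x t : R) : fejer N (x - t) =
  trigpoly N (fun j => (1 - j%:R / N%:R) * cosn j x)
    (fun j => (1 - j%:R / N%:R) * sinn j x) t.
Proof.
rewrite /fejer /trigpoly cosn0 mul0r subr0 mulr1; congr (_ + _ * _).
apply: eq_bigr => j _; rewrite cosnD.
by rewrite (_ : cosn j (- t) = cosn j t) 1?(_ : sinn j (- t) = - sinn j t);
  [ring|rewrite /sinn mulrN sinN|rewrite /cosn mulrN cosN].
Qed.

Lemma integrable_fejer N G x : L1 G -> L1 (fun t => G t * fejer N (x - t)).
Proof. by move=> iG; under eq_fun do rewrite fejer_subE; exact: integrable_mul_trigpoly. Qed.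

Lemma fejer_meanE N G : L1 G -> fejer_mean N G =
  trigpoly N (fun j => (1 - j%:R / N%:R) * cosfc G j)
    (fun j => (1 - j%:R / N%:R) * sinfc G j).
Proof.
move=> iG; apply/funext => x; rewrite /fejer_mean.
under eq_Rintegral do rewrite fejer_subE.
rewrite Rintegral_mul_trigpoly// /trigpoly cosn0 mul0r subr0 mulr1 !mul1r; congr (_ + _ * _).
  by rewrite /cosfc; under [RHS]eq_Rintegral do rewrite cosn0 mulr1.
by apply: eq_bigr => j _; ring.
Qed.

Lemma Rintegral_fejer N (x : R) : \int[mu]_(t in unitI) fejer N (x - t) = 1.
Proof.
under eq_Rintegral do rewrite fejer_subE.
by rewrite Rintegral_trigpoly cosn0 mul0r subr0 mulr1.
Qed.

Lemma cosnN j (x : R) : cosn j (- x) = cosn j x.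
Proof. by rewrite /cosn mulrN cosN. Qed.

Lemma cosn1_le (e u : R) : 0 < e -> e <= 2^-1 -> e <= `|u| <= 1 - e -> cosn 1 u <= cosn 1 e.
Proof.
move=> e0 e2 /andP[eu u1].
have cle (s t : R) : 0 <= s -> s <= t -> t <= 2^-1 -> cosn 1 t <= cosn 1 s.
  move=> s0; rewrite le_eqVlt => /predU1P[->//|st] t2; apply: ltW.
  have pp := pi_gt0 R.
  rewrite /cosn mulr1 ltr_cos ?in_itv/=; first by rewrite ltr_pM2l// mulr_gt0.
    by apply/andP; split; nra.
  by apply/andP; split; nra.
have -> : cosn 1 u = cosn 1 `|u|.
  by case: ger0P => // _; rewrite cosnN.
have [u2|/ltW u2] := leP `|u| 2^-1; first by apply: cle => //; exact: ltW.
have -> : cosn 1 `|u| = cosn 1 (1 - `|u|).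
  by rewrite addrC (cossinnDn 1 1) cosnN.
by apply: cle; lra.
Qed.

(** No splitting of the integral near and far from [x]: in the pointwise majorant, [e] is integrated
    against a kernel of mass 1, and the other term is reduced by the kernel to at most [K * (4 / N)]
    by [fejer_le]. *)
Lemma fejer_mean_dist N G (M x : R) : (0 < N)%N -> measurable_fun setT G -> (forall t, `|G t| <= M) ->
  forall e K, 0 <= K -> (forall t, unitI t -> `|G t - G x| <= e + K * (2 - 2 * cosn 1 (x - t))) ->
  `|fejer_mean N G x - G x| <= e + K * (4 / N%:R).
Proof.
move=> N0 mG GM e K K0 GK.
have iG : L1 G by exact: integrable_unitI_bounded mG GM.
have iF : L1 (fun t => fejer N (x - t)).
  by under eq_fun do rewrite fejer_subE; exact: integrable_trigpoly.
have iGF := integrable_fejer N x iG.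
have -> : fejer_mean N G x - G x = \int[mu]_(t in unitI) ((G t - G x) * fejer N (x - t)).
  under [RHS]eq_Rintegral do rewrite mulrBl.
  rewrite RintegralB//; [|exact: mI|exact: (integrable_scale mI)].
  by rewrite RintegralZl//; [rewrite Rintegral_fejer mulr1|exact: mI].
have iD : L1 (fun t => (G t - G x) * fejer N (x - t)).
  under eq_fun do rewrite mulrBl.
  by apply: (integrable_sub mI) => //; exact: (integrable_scale mI).
apply: (le_trans (le_normr_Rintegral _ iD)); first exact: mI.
have -> : e + K * (4 / N%:R) = \int[mu]_(t in unitI) (e * fejer N (x - t) + K * (4 / N%:R)).
  rewrite RintegralD//; [|exact: mI|exact: (integrable_scale mI)|exact: integrable_cst_unitI].
  rewrite RintegralZl//; last exact: mI.
  by rewrite Rintegral_fejer Rintegral_cst_unitI mulr1.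
apply: le_Rintegral.
- exact: mI.
- by have := integrable_norm iD.
- by apply: (integrable_add mI); [exact: (integrable_scale mI)|exact: integrable_cst_unitI].
move=> t It; have F0 := fejer_ge0 (x - t) N0; rewrite normrM (ger0_norm F0).
apply: (le_trans (ler_wpM2r F0 (GK t It))); rewrite mulrDl lerD2l -mulrA ler_wpM2l//.
by rewrite mulrC fejer_le.
Qed.

Lemma fejer_mean_bound N G (M x : R) : (0 < N)%N -> measurable_fun setT G ->
  (forall t, `|G t| <= M) -> `|fejer_mean N G x| <= M.
Proof.
move=> N0 mG GM.
have iG : L1 G by exact: integrable_unitI_bounded mG GM.
have iGF := integrable_fejer N x iG.
have iF : L1 (fun t => fejer N (x - t)).
  by under eq_fun do rewrite fejer_subE; exact: integrable_trigpoly.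
apply: (le_trans (le_normr_Rintegral _ iGF)); first exact: mI.
have -> : M = \int[mu]_(t in unitI) (M * fejer N (x - t)).
  by rewrite RintegralZl//; [rewrite Rintegral_fejer mulr1|exact: mI].
apply: le_Rintegral.
- exact: mI.
- by have := integrable_norm iGF.
- exact: (integrable_scale mI).
by move=> t It; have F0 := fejer_ge0 (x - t) N0; rewrite normrM (ger0_norm F0) ler_wpM2r.
Qed.

Lemma fejer_mean_cvg G (M x : R) : continuous G -> (forall t, `|G t| <= M) -> 0 < x < 1 ->
  fejer_mean N.+1 G x @[N --> \oo] --> G x.
Proof.
move=> cG GM /andP[x0 x1].
have mG : measurable_fun setT G by exact: continuous_measurable_fun.
have M0 : 0 <= M by rewrite (le_trans _ (GM 0)).
apply/cvgrPdist_le => /= e e0.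
have e20 : 0 < e / 2 by rewrite divr_gt0.
have := cG x; move=> /cvgrPdist_le /(_ _ e20) [/= de de0 Gd].
(* [G] need not be periodic, so [x] is interior. The bounds by [x] and [1 - x] give
   [|x - t| <= 1 - dl] on [unitI], which keeps the periodic factor [2 - 2 * cosn 1 (x - t)] at least
   [k] as soon as [|x - t| >= dl]. *)
pose dl := Num.min de (Num.min x (Num.min (1 - x) 2^-1)).
have dl0 : 0 < dl by rewrite /dl !lt_min de0 x0 subr_gt0 x1 invr_gt0 ltr0n.
have dlE : [/\ dl <= de, dl <= x, dl <= 1 - x & dl <= 2^-1].
  by rewrite /dl; split; rewrite !ge_min lexx ?orbT.
have [d1 d2 d3 d4] := dlE.
pose k : R := 2 - 2 * cosn 1 dl.
have k0 : 0 < k.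
  rewrite /k subr_gt0 -[ltRHS]mulr1 ltr_pM2l// -[ltRHS]cos0 /cosn mulr1.
  have pp := pi_gt0 R.
  by rewrite ltr_cos ?in_itv/= ?lexx ?pi_ge0 ?mulr_gt0//; apply/andP; split; nra.
pose K := 2 * M / k.
have K0 : 0 <= K by rewrite divr_ge0 ?mulr_ge0// ltW.
have GK t : unitI t -> `|G t - G x| <= e / 2 + K * (2 - 2 * cosn 1 (x - t)).
  rewrite /unitI/= in_itv/= => /andP[t0 t1].
  have c1 : 0 <= 2 - 2 * cosn 1 (x - t) by have := normr_cosn 1 (x - t); rewrite ler_norml; lra.
  have [tx|tx] := ltP `|x - t| dl.
    have : `|G x - G t| <= e / 2 by apply: Gd; rewrite /ball/=; exact: lt_le_trans d1.
    by rewrite distrC => /le_trans; apply; rewrite lerDl mulr_ge0.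
  apply: (@le_trans _ _ (2 * M)).
    by rewrite (le_trans (ler_normB _ _))//; have := GM t; have := GM x; lra.
  apply: (@le_trans _ _ (K * k)); first by rewrite /K divfK// gt_eqF.
  apply: (@le_trans _ _ (K * (2 - 2 * cosn 1 (x - t)))); last by rewrite lerDr ltW.
  apply: ler_wpM2l => //.
  rewrite /k lerD2l lerN2 ler_pM2l//; apply: cosn1_le => //.
  rewrite tx/= ler_norml; apply/andP; split; lra.
near=> N.
rewrite distrC (le_trans (@fejer_mean_dist N.+1 G M x _ mG GM _ _ K0 GK))//.
rewrite [leRHS]splitr lerD2l mulrA.
suff : K * 4 / (e / 2) <= N.+1%:R.
  by rewrite ler_pdivrMr// [N.+1%:R * _]mulrC -ler_pdivrMr ?ltr0n.
rewrite (le_trans _ (_ : N%:R <= N.+1%:R))// ?ler_nat//.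
by near: N; exact: nbhs_infty_ger.
Unshelve. all: by end_near.
Qed.

Section bessel_bound.
Variables (p : R -> R) (c : R).
Hypotheses (mp : measurable_fun unitI p) (ip : L1 p) (ip2 : L1 (fun x => p x ^+ 2)).
Hypothesis pc : forall N, (\int[mu]_(x in unitI) p x) ^+ 2 +
  2 * \sum_(1 <= j < N) (cosfc p j ^+ 2 + sinfc p j ^+ 2) <= c.

(* [\int (2 p q - q^2) <= c] for all [q] in a class is the duality form of
   [|p|^2 <= c]: it is an equality of norms once [q] can be taken equal to [p]. *)
Let dual q := \int[mu]_(x in unitI) (2 * (p x * q x) - q x ^+ 2).

(** Completing the square coefficient by coefficient: the maximising polynomial is the partial
    Fourier sum of [p], bounded by [pc]. *)
Let dual_trigpoly N a b : dual (trigpoly N a b) <= c.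
Proof.
have i1 := integrable_mul_trigpoly N a b ip.
have i2 : L1 (fun x => trigpoly N a b x ^+ 2).
  by under eq_fun do rewrite expr2; apply: integrable_mul_trigpoly; exact: integrable_trigpoly.
rewrite /dual RintegralB//; [|exact: mI|exact: (integrable_scale mI)].
rewrite RintegralZl//; last exact: mI.
rewrite Rintegral_mul_trigpoly// Rintegral_trigpoly_sqr.
apply: le_trans (pc N); set P0 := \int[mu]_(x in unitI) p x.
have : 2 * \sum_(1 <= j < N) (a j * cosfc p j + b j * sinfc p j) <=
    \sum_(1 <= j < N) (cosfc p j ^+ 2 + sinfc p j ^+ 2) + \sum_(1 <= j < N) (a j ^+ 2 + b j ^+ 2).
  rewrite mulr_sumr -big_split/=; apply: ler_sum => j _.
  by have := sqr_ge0 (a j - cosfc p j); have := sqr_ge0 (b j - sinfc p j); rewrite !sqrrB; lra.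
by have := sqr_ge0 (a 0%N - P0); rewrite sqrrB; lra.
Qed.

Let measurable_trigpoly N a b : measurable_fun setT (trigpoly N a b).
Proof.
apply: measurable_funD => //; apply: measurable_funM => //.
by apply: measurable_sum => j; apply: measurable_funD; apply: measurable_funM => //;
  [exact: measurable_cosn|exact: measurable_sinn].
Qed.

(** The Fejer means of [G] are trigonometric polynomials, stay bounded by [M] and converge on []0,
    1[], so dominated convergence applies. *)
Let dual_continuous G (M : R) : continuous G -> (forall t, `|G t| <= M) -> dual G <= c.
Proof.
move=> cG GM; have mG : measurable_fun setT G by exact: continuous_measurable_fun.
have M0 : 0 <= M by rewrite (le_trans _ (GM 0)).
have iG : L1 G by exact: integrable_unitI_bounded mG GM.
pose u N x := 2 * (p x * fejer_mean N.+1 G x) - fejer_mean N.+1 G x ^+ 2.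
have mF N : measurable_fun unitI (fejer_mean N G).
  by rewrite fejer_meanE//; apply: measurable_funTS; exact: measurable_trigpoly.
have mu_ (q : R -> R) : measurable_fun unitI q ->
    measurable_fun unitI (fun x => 2 * (p x * q x) - q x ^+ 2).
  move=> mq; apply: measurable_funB; last exact: measurable_funX.
  by apply: measurable_funM => //; exact: measurable_funM.
have ig : L1 (fun x => 2 * M * `|p x| + M ^+ 2).
  apply: (integrable_add mI); last exact: integrable_cst_unitI.
  by apply: (integrable_scale mI); have := integrable_norm ip.
have := @Rintegral_dominated_le _ _ R mu unitI u (fun x => 2 * (p x * G x) - G x ^+ 2)
  (fun x => 2 * M * `|p x| + M ^+ 2) c mI.
case => //.
- by move=> N; apply: mu_; exact: mF.
- by apply: mu_; exact: measurable_funTS.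
- exists [set 0]; split; [exact: measurable_set1|exact: lebesgue_measure_set1|].
  move=> x /= H; apply: contrapT => x0; apply: H => xI.
  have x01 : 0 < x < 1.
    move: xI; rewrite /unitI/= in_itv/= => /andP[x_ge0 ->]; rewrite andbT lt_neqAle x_ge0 andbT.
    by apply/eqP => x0'; apply: x0.
  have cv := fejer_mean_cvg cG GM x01.
  apply: cvgB; last by rewrite expr2; under eq_fun do rewrite expr2; exact: cvgM.
  by apply: cvgMr; apply: cvgMr.
- move=> N x xI; have FM := @fejer_mean_bound N.+1 G M x isT mG GM.
  rewrite (le_trans (ler_normB _ _))// !normrM (ger0_norm (ler0n _ 2)).
  apply: lerD; last by rewrite expr2 ler_pM.
  by rewrite -mulrA ler_pM2l// mulrC ler_wpM2r.
- move=> N; have := dual_trigpoly N.+1 (fun j => (1 - j%:R / N.+1%:R) * cosfc G j)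
    (fun j => (1 - j%:R / N.+1%:R) * sinfc G j).
  by rewrite /u fejer_meanE.
Qed.

Let dual_bounded G (M : R) : measurable_fun setT G -> (forall t, `|G t| <= M) -> dual G <= c.
Proof.
move=> mG GM; have M0 : 0 <= M by rewrite (le_trans _ (GM 0)).
have iG : L1 G by exact: integrable_unitI_bounded mG GM.
have [g_ [cg _ gG]] := approximation_continuous_integrable mI unitI_finite iG.
(* This formula clips [g_ n] to [[-M, M]] while keeping it continuous; as [G] takes its values
   there, clipping does not increase the distance to [G]. *)
pose cl n x := 2^-1 * (`|g_ n x + M| - `|g_ n x - M|).
have ccl n : continuous (cl n).
  move=> x; apply: cvgMr; apply: cvgB; apply: cvg_norm.
    by apply: cvgD; [exact: cg|exact: cvg_cst].
  by apply: cvgB; [exact: cg|exact: cvg_cst].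
have clM n x : `|cl n x| <= M.
  rewrite ler_norml /cl; case: (ger0P (g_ n x + M)); case: (ger0P (g_ n x - M)); lra.
have mcl n : measurable_fun setT (cl n) by exact: continuous_measurable_fun.
have clG n x : `|G x - cl n x| <= `|G x - g_ n x|.
  have := GM x; rewrite ler_norml /cl => /andP[G1 G2].
  have := ler_norm (G x - g_ n x); have := ler_norm (- (G x - g_ n x)); rewrite normrN.
  set t := `|G x - g_ n x| => h1 h2; rewrite ler_norml.
  by case: (ger0P (g_ n x + M)); case: (ger0P (g_ n x - M)) => h3 h4; apply/andP; split; lra.
have idual q (K : R) : measurable_fun setT q -> (forall t, `|q t| <= K) ->
    L1 (fun x => 2 * (p x * q x) - q x ^+ 2).
  move=> mq qK; apply: (integrable_sub mI).
    apply: (integrable_scale mI); apply: (@integrable_mul_bounded _ _ _ _ _ mI _ _ K) => //.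
    exact: measurable_funTS.
  under eq_fun do rewrite expr2.
  apply: (@integrable_mul_bounded _ _ _ _ _ mI _ _ K) => //; last exact: measurable_funTS.
  exact: integrable_unitI_bounded mq qK.
have iGcl n : L1 (fun x => `|G x - cl n x|).
  have : L1 (fun x => G x - cl n x).
    by apply: (integrable_sub mI) => //; exact: integrable_unitI_bounded (clM n).
  by move=> /integrable_norm.
pose P2 := \int[mu]_(x in unitI) (p x ^+ 2).
have P20 : 0 <= P2 by apply: Rintegral_ge0 => x _; exact: sqr_ge0.
pose an n := \int[mu]_(x in unitI) `|G x - cl n x|.
(* The cross term pairs the unbounded [p] with a difference [D] that is small in L^1 only. Weighting
   gives [2 |p| D <= e p^2 + D^2 / e], and [D <= 2 M] makes the last term linear in [D]. Below, [e]
   is fixed first and [n] afterwards. *)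
have key (e : R) n : 0 < e -> dual G <= c + e * P2 + (2 * M / e + 2 * M) * an n.
  move=> e0; apply: (@le_trans _ _ (dual (cl n) + e * P2 + (2 * M / e + 2 * M) * an n)).
    rewrite /dual /P2 /an -!RintegralZl//; try exact: mI.
    have i2 := idual _ _ (mcl n) (clM n).
    have iep : L1 (fun x => e * p x ^+ 2) by exact: (integrable_scale mI).
    have ian : L1 (fun x => (2 * M / e + 2 * M) * `|G x - cl n x|) by exact: (integrable_scale mI).
    rewrite -!RintegralD//; try exact: mI; last exact: (integrable_add mI).
    apply: le_Rintegral; [exact: mI|exact: idual mG GM| |].
      by do 2?[apply: (integrable_add mI)].
    move=> x _; set D : R := `|G x - cl n x|.
    have D0 : 0 <= D by exact: normr_ge0.
    have D2 : D <= 2 * M.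
      by rewrite /D (le_trans (ler_normB _ _))//; have := GM x; have := clM n x; lra.
    have -> : 2 * (p x * G x) - G x ^+ 2 = 2 * (p x * cl n x) - cl n x ^+ 2 +
      (G x - cl n x) * (2 * p x - G x - cl n x) by ring.
    rewrite -[leRHS]addrA lerD2l; apply: (le_trans (ler_norm _)); rewrite normrM -/D.
    apply: (@le_trans _ _ (D * (2 * `|p x| + 2 * M))).
      apply: ler_wpM2l => //; rewrite -addrA (le_trans (ler_normD _ _))//.
      rewrite normrM (ger0_norm (ler0n _ 2)) lerD2l -opprD normrN (le_trans (ler_normD _ _))//.
      by have := GM x; have := clM n x; lra.
    suff : 2 * `|p x| * D <= e * p x ^+ 2 + 2 * M / e * D by lra.
    apply: (@le_trans _ _ (e * p x ^+ 2 + D ^+ 2 / e)).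
      have := sqr_ge0 (e * `|p x| - D); rewrite -[p x ^+ 2]real_normK ?num_real//.
      have -> : e * `|p x| ^+ 2 + D ^+ 2 / e = 2 * `|p x| * D + (e * `|p x| - D) ^+ 2 / e.
        by field; exact: lt0r_neq0.
      by move=> H; rewrite lerDl divr_ge0// ltW.
    by rewrite lerD2l expr2 mulrAC ler_wpM2r// ler_wpM2r// invr_ge0 ltW.
  by rewrite !lerD2r; exact: dual_continuous (ccl n) (clM n).
have an_small (e : R) : 0 < e -> exists n, an n <= e.
  move=> e0; have : nbhs (0%:E : \bar R) [set y | (y < e%:E)%E].
    exact: (@nbhs_open_ereal_lt _ 0 (fun=> e)).
  move=> /gG[n _ /(_ n (leqnn n))] /= H; exists n.
  rewrite -lee_fin /an -EFin_Rintegral//; last exact: mI.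
  apply: (le_trans _ (ltW H)); apply: ge0_le_integral_nonmeasurable.
    by move=> x _; rewrite lee_fin.
  by move=> x _ /=; rewrite lee_fin.
apply/ler_addgt0Pr => e e0.
pose e1 := e / (2 * (P2 + 1)).
have e10 : 0 < e1 by rewrite divr_gt0 ?mulr_gt0//; lra.
pose K := 2 * M / e1 + 2 * M.
have e1i : 0 <= e1^-1 by rewrite invr_ge0 ltW.
have K0 : 0 <= K by rewrite /K addr_ge0 ?mulr_ge0.
have [|n an1] := an_small (e / (2 * (K + 1))); first by rewrite divr_gt0 ?mulr_gt0//; lra.
apply: (le_trans (key _ n e10)); rewrite -/K -addrA lerD2l [leRHS]splitr; apply: lerD.
  rewrite /e1 mulrAC ler_pdivrMr; last by lra.
  have -> : e / 2 * (2 * (P2 + 1)) = e * P2 + e by field.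
  by rewrite lerDl ltW.
apply: (le_trans (ler_wpM2l K0 an1)); rewrite mulrCA ler_pM2l// ler_pdivrMr; last by lra.
have -> : 2^-1 * (2 * (K + 1)) = K + 1 by field.
by lra.
Qed.

Lemma parseval_le : \int[mu]_(x in unitI) (p x ^+ 2) <= c.
Proof.
pose pI := p \_ unitI.
have mpI : measurable_fun setT pI by apply/(measurable_restrictT _ measurable_unitI).
(* [G n] is [p] clipped to [[-n, n]]. Then [2 p G - G^2] is dominated by [p^2] and equals it once
   [n >= |p x|]. *)
pose G n x := 2^-1 * (`|pI x + n%:R| - `|pI x - n%:R|).
have mG n : measurable_fun setT (G n).
  apply: measurable_funM => //.
  by apply: measurable_funB; apply: measurableT_comp => //;
    [exact: measurable_funD|exact: measurable_funB].
have GM n x : `|G n x| <= n%:R.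
  have n0 : (0 : R) <= n%:R by [].
  by rewrite ler_norml /G; case: (ger0P (pI x + n%:R)); case: (ger0P (pI x - n%:R)); lra.
pose u n x := 2 * (p x * G n x) - G n x ^+ 2.
have := @Rintegral_dominated_le _ _ R mu unitI u (fun x => p x ^+ 2) (fun x => p x ^+ 2) c mI.
case => //.
- move=> n; apply: measurable_funB.
    by apply: measurable_funM => //; apply: measurable_funM => //; apply: measurable_funTS; exact: mG.
  by apply: measurable_funX; apply: measurable_funTS; exact: mG.
- exact: measurable_funX.
- apply: aeW => x xI; apply: cvg_near_cst; near=> n.
  have pn : `|p x| <= n%:R by near: n; exact: nbhs_infty_ger.
  rewrite /u; suff -> : G n x = p x by ring.
  move: pn; rewrite ler_norml /G /pI restrict_unitIE//.
  by case: (ger0P (p x + n%:R)); case: (ger0P (p x - n%:R)); lra.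
- move=> n x xI.
  have n0 : (0 : R) <= n%:R by [].
  rewrite /u /G /pI restrict_unitIE//.
  case: (ger0P (p x + n%:R)); case: (ger0P (p x - n%:R)) => h1 h2;
    rewrite ler_norml; apply/andP; split; nra.
- by move=> n; exact: dual_bounded (mG n) (GM n).
Unshelve. all: by end_near.
Qed.

End bessel_bound.
End parseval.

(** * Independence and bounded random variables *)

Section bounded_random_variables.
Context d (T : measurableType d) (R : realType) (P : probability T R).
Implicit Types F G : T -> R.

Definition bounded_rv F : Prop :=
  measurable_fun setT F /\ exists M : R, forall w, `|F w| <= M.

Local Notation "''Ex' F" := (\int[P]_w F w) (at level 10, F at level 8).

Lemma bounded_rv_integrable F : bounded_rv F -> P.-integrable setT (EFin \o F).
Proof.
move=> [mF [M FM]]; apply: (@integrable_bounded _ _ _ _ _ measurableT _ M) => //.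
by rewrite (le_lt_trans (probability_le1 _ _)) ?ltry.
Qed.

Lemma bounded_rv_cst (c : R) : bounded_rv (fun=> c).
Proof. by split => //; exists `|c|. Qed.

Lemma bounded_rvD F G : bounded_rv F -> bounded_rv G -> bounded_rv (fun w => F w + G w).
Proof.
move=> [mF [M FM]] [mG [N GN]]; split; first exact: measurable_funD.
by exists (M + N) => w; rewrite (le_trans (ler_normD _ _))// lerD.
Qed.

Lemma bounded_rvM F G : bounded_rv F -> bounded_rv G -> bounded_rv (fun w => F w * G w).
Proof.
move=> [mF [M FM]] [mG [N GN]]; split; first exact: measurable_funM.
by exists (M * N) => w; rewrite normrM ler_pM.
Qed.

Lemma bounded_rv_sum (I : Type) (s : seq I) (F : I -> T -> R) :
  (forall i, bounded_rv (F i)) -> bounded_rv (fun w => \sum_(i <- s) F i w).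
Proof.
move=> bF; elim: s => [|i s IH].
  by under eq_fun do rewrite big_nil; exact: bounded_rv_cst.
by under eq_fun do rewrite big_cons; exact: bounded_rvD.
Qed.

Lemma expectation_cst (c : R) : 'Ex (fun=> c) = c.
Proof. by rewrite Rintegral_cst// [X in fine X]probability_setT mulr1. Qed.

Lemma expectationD_bounded F G : bounded_rv F -> bounded_rv G ->
  'Ex (fun w => F w + G w) = 'Ex F + 'Ex G.
Proof. by move=> /bounded_rv_integrable iF /bounded_rv_integrable iG; rewrite RintegralD. Qed.

Lemma expectationZ_bounded (c : R) F : bounded_rv F -> 'Ex (fun w => c * F w) = c * 'Ex F.
Proof. by move=> /bounded_rv_integrable iF; rewrite RintegralZl. Qed.

Lemma expectation_sum_bounded (I : Type) (s : seq I) (F : I -> T -> R) :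
  (forall i, bounded_rv (F i)) ->
  'Ex (fun w => \sum_(i <- s) F i w) = \sum_(i <- s) 'Ex (F i).
Proof. by move=> bF; rewrite (Rintegral_bigsum measurableT)// => i; exact: bounded_rv_integrable. Qed.

Lemma expectation_le_bounded F G : bounded_rv F -> bounded_rv G -> (forall w, F w <= G w) ->
  'Ex F <= 'Ex G.
Proof. by move=> /bounded_rv_integrable iF /bounded_rv_integrable iG FG; exact: le_Rintegral. Qed.

Lemma ge0_expectation_indep_mul F G : measurable_fun setT F -> measurable_fun setT G ->
  (forall w, 0 <= F w) -> (forall w, 0 <= G w) ->
  (forall B C : set R, measurable B -> measurable C ->
    P (F @^-1` B `&` G @^-1` C) = P (F @^-1` B) * P (G @^-1` C))%E ->
  (\int[P]_w (F w * G w)%:E = (\int[P]_w (F w)%:E) * (\int[P]_w (G w)%:E))%E.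
Proof.
move=> mF mG F0 G0 FG.
pose F' : {mfun T >-> R} := HB.pack F (isMeasurableFun.Build _ _ _ _ _ mF).
pose G' : {mfun T >-> R} := HB.pack G (isMeasurableFun.Build _ _ _ _ _ mG).
have mH : measurable_fun setT (fun w => (F w, G w)) by exact/measurable_fun_pairP.
pose H' : {mfun T >-> (R * R)%type} := HB.pack (fun w => (F w, G w)) (isMeasurableFun.Build _ _ _ _ _ mH).
(* The product must be a non-negative function on the whole plane to be integrated against the joint
   law; the positive parts change nothing on the range of [F] and [G]. *)
pose h (z : R * R) : \bar R := (Num.max 0 z.1 * Num.max 0 z.2)%:E.
have mmax : measurable_fun setT (Num.max 0 : R -> R) by exact: measurable_maxr.
have mh : measurable_fun setT h.
  by apply/measurable_EFinP; apply: measurable_funM; apply: measurableT_comp.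
have h0 z : (0 <= h z)%E by rewrite lee_fin mulr_ge0// le_max lexx.
transitivity (\int[distribution P H']_z h z)%E.
  rewrite ge0_integral_pushforward//; apply: eq_integral => w _.
  by rewrite /h/= !max_r.
have HE X : measurable X -> (distribution P F' \x distribution P G')%E X = distribution P H' X.
  exact: product_measure_unique.
transitivity (\int[distribution P F' \x distribution P G']_z h z)%E.
  by apply: eq_measure_integral => X mX _; apply/esym; exact: HE.
rewrite fubini_tonelli1//.
rewrite /fubini_F /h /=.
have maxE (K : {mfun T >-> R}) : (forall w, 0 <= K w) ->
    (\int[distribution P K]_x (Num.max 0 x)%:E = \int[P]_w (K w)%:E)%E.
  move=> K0; rewrite ge0_integral_pushforward//.
  - by apply: eq_integral => w _ /=; rewrite max_r.
  - exact/measurable_EFinP.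
  - by move=> y _; rewrite lee_fin le_max lexx.
transitivity (\int[distribution P F']_x ((Num.max 0 x)%:E * \int[P]_w (G w)%:E))%E.
  apply: eq_integral => x _; rewrite -(maxE G')// -ge0_integralZl_EFin//.
  - by move=> y _; rewrite lee_fin le_max lexx.
  - exact/measurable_EFinP.
  - by rewrite le_max lexx.
rewrite ge0_integralZr//.
- by rewrite (maxE F').
- exact/measurable_EFinP.
- by move=> y _; rewrite lee_fin le_max lexx.
- by apply: integral_ge0 => w _; rewrite lee_fin.
Qed.

(** Adding the bounds [M] and [N] reduces to non-negative variables; after expansion all terms but
    the product cancel. *)
Lemma expectation_indep_mul F G : bounded_rv F -> bounded_rv G ->
  (forall B C : set R, measurable B -> measurable C ->
    P (F @^-1` B `&` G @^-1` C) = P (F @^-1` B) * P (G @^-1` C))%E ->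
  'Ex (fun w => F w * G w) = 'Ex F * 'Ex G.
Proof.
move=> bF bG FG; have [mF [M FM]] := bF; have [mG [N GN]] := bG.
have bF' := bounded_rvD bF (bounded_rv_cst M); have bG' := bounded_rvD bG (bounded_rv_cst N).
have F0 w : 0 <= F w + M by have := FM w; rewrite ler_norml; lra.
have G0 w : 0 <= G w + N by have := GN w; rewrite ler_norml; lra.
have pre (K : T -> R) (c : R) (B : set R) : (fun w => K w + c) @^-1` B = K @^-1` [set x | B (x + c)].
  by [].
have mpre (c : R) (B : set R) : measurable B -> measurable [set x : R | B (x + c)].
  move=> mB; have := @measurable_funD _ R R setT (fun x => x) (cst c) (@measurable_id _ R setT) (measurable_cst c).
  by move=> /(_ measurableT B mB); rewrite setTI.
have := @ge0_expectation_indep_mul _ _ bF'.1 bG'.1 F0 G0.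
have -> : (\int[P]_w ((F w + M) * (G w + N))%:E = ('Ex (fun w => (F w + M) * (G w + N)))%:E)%E.
  by rewrite EFin_Rintegral//; exact: bounded_rv_integrable (bounded_rvM bF' bG').
rewrite !EFin_Rintegral//; try exact: bounded_rv_integrable.
move=> H; have {H} : 'Ex (fun w => (F w + M) * (G w + N)) =
    'Ex (fun w => F w + M) * 'Ex (fun w => G w + N).
  by apply: EFin_inj; rewrite EFinM; apply: H => B C mB mC; rewrite !pre; apply: FG; exact: mpre.
rewrite !expectationD_bounded//; try exact: bounded_rv_cst.
rewrite !expectation_cst.
have -> : (fun w => (F w + M) * (G w + N)) = (fun w => F w * G w + (N * F w + (M * G w + M * N))).
  by apply/funext => w; ring.
have bNF := bounded_rvM (bounded_rv_cst N) bF; have bMG := bounded_rvM (bounded_rv_cst M) bG.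
rewrite !expectationD_bounded ?expectationZ_bounded ?expectation_cst//; first lra.
- exact: bounded_rv_cst.
- exact: bounded_rv_cst.
- exact: bounded_rvD bMG (bounded_rv_cst _).
- exact: bounded_rvM.
- exact: bounded_rvD bNF (bounded_rvD bMG (bounded_rv_cst _)).
Qed.

End bounded_random_variables.

(** * Independence of an observation from the preceding ones *)

Section independent_past.
Context d (T : measurableType d) (R : realType) (P : probability T R).
Variables (n : nat) (Y : 'I_n -> {RV P >-> R}).
Hypothesis indepY : mutually_independent Y.

(** Cylinders over the first [m] observations: a pi-system on which mutual independence gives the
    product formula directly. *)
Definition past (m : nat) : set (set T) :=
  [set A | exists2 B : 'I_n -> set R, (forall i, measurable (B i)) &
     A = \bigcap_(i in [set i : 'I_n | (i < m)%N]) (Y i @^-1` B i)].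

Lemma setI_closed_past m : setI_closed (past m).
Proof.
move=> _ _ [B mB ->] [C mC ->]; exists (fun i => B i `&` C i).
  by move=> i; exact: measurableI.
by rewrite -bigcapI.
Qed.

Lemma measurable_past m A : past m A -> measurable A.
Proof.
move=> [B mB ->]; apply: fin_bigcap_measurable => // i _.
by rewrite -[X in measurable X]setTI; exact: (@measurable_funPT _ _ _ _ (Y i) _ (B i)).
Qed.

Lemma past_indep m (j : 'I_n) A (C : set R) : (m <= j)%N -> past m A -> measurable C ->
  P (A `&` Y j @^-1` C) = (P A * P (Y j @^-1` C))%E.
Proof.
move=> mj [B mB ->] mC.
pose J := [set i : 'I_n | (i < m)%N]%SET.
have JE : [set i : 'I_n | (i < m)%N] = [set` J] by apply/seteqP; split => i /=; rewrite inE.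
have jJ : j \notin J by rewrite inE -leqNgt.
pose B' i := if i == j then C else B i.
have mB' i : measurable (B' i) by rewrite /B'; case: ifP.
rewrite JE (indepY J mB).
have := indepY (j |: J)%SET mB'.
rewrite big_setU1//= {2}/B' eqxx.
rewrite (eq_bigr (fun i => P (Y i @^-1` B i))); last first.
  by move=> i iJ; rewrite /B'; case: eqP => // ij; rewrite ij (negbTE jJ) in iJ.
rewrite muleC => <-; congr (P _); apply/seteqP; split => w /=.
- move=> [Bw Cw] i; rewrite /= !inE => /orP[/eqP ->|iJ]; first by rewrite /B' eqxx.
  by rewrite /B'; case: eqP => [ij|_]; [rewrite ij|apply: Bw; rewrite /= inE].
- move=> H; split; last by have := H j; rewrite /= !inE eqxx /B' eqxx; apply.
  move=> i /= iJ; have := H i; rewrite /= !inE in iJ *; rewrite iJ orbT => /(_ isT).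
  by rewrite /B'; case: eqP => // ij; move: iJ; rewrite ij ltnNge mj.
Qed.

(** For fixed [C] both sides are finite measures in [A] that agree on the pi-system [past m], hence
    on the sigma-algebra it generates. *)
Lemma sigma_past_indep m (j : 'I_n) A (C : set R) : (m <= j)%N -> <<s past m >> A ->
  measurable C -> P (A `&` Y j @^-1` C) = (P A * P (Y j @^-1` C))%E.
Proof.
move=> mj sA mC.
have mYC : measurable (Y j @^-1` C).
  by rewrite -[X in measurable X]setTI; exact: (@measurable_funPT _ _ _ _ (Y j) _ C).
have PYC : P (Y j @^-1` C) \is a fin_num by exact: fin_num_measure.
have c0 : 0 <= fine (P (Y j @^-1` C)) by exact: fine_ge0.
pose m1 : {measure set T -> \bar R} := mrestr P mYC.
pose m2 : {measure set T -> \bar R} := mscale (NngNum c0) P.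
have -> : P (A `&` Y j @^-1` C) = m1 A by [].
have -> : (P A * P (Y j @^-1` C) = m2 A)%E by rewrite /m2/= /mscale/= fineK// muleC.
have pT : past m setT.
  by exists (fun=> setT) => //; apply/seteqP; split.
apply: (g_sigma_algebra_measure_unique (past m) _ (fun=> setT)) => //.
- exact: measurable_past.
- by apply/seteqP; split => // x _; exists 0%N.
- exact: setI_closed_past.
- move=> {sA A}A pA; rewrite [LHS](past_indep mj pA mC).
  by rewrite /m2/= /mscale/= fineK// muleC.
- by move=> k; rewrite /m1/= /mrestr setTI (le_lt_trans (probability_le1 _ _)) ?ltry.
Qed.

(** The same carrier as [T] with the sigma-algebra of the past, so that being determined by the past
    becomes ordinary measurability. *)
Definition pastType (m : nat) := g_sigma_algebraType (past m).

Lemma measurable_past_obs m (i : 'I_n) : (i < m)%N ->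
  measurable_fun setT (Y i : pastType m -> R).
Proof.
move=> im _ B mB; rewrite setTI; apply: sub_sigma_algebra.
exists (fun k => if k == i then B else setT).
  by move=> k; case: ifP.
apply/seteqP; split => w /=.
  by move=> Bw k _ /=; case: eqP => // ->.
by move=> /(_ i im) /=; rewrite eqxx.
Qed.

Lemma expectation_past_mul m (j : 'I_n) (F : T -> R) (G : R -> R) (M : R) : (m <= j)%N ->
  bounded_rv F -> measurable_fun setT (F : pastType m -> R) ->
  measurable_fun setT G -> (forall y, `|G y| <= M) ->
  \int[P]_w (F w * G (Y j w)) = (\int[P]_w F w) * (\int[P]_w G (Y j w)).
Proof.
move=> mj bF pF mG GM; apply: expectation_indep_mul => //.
  by split; [exact: measurableT_comp|exists M].
move=> B C mB mC.
rewrite (_ : _ @^-1` C = Y j @^-1` (G @^-1` C))//; apply: (sigma_past_indep mj).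
  by have := pF measurableT B mB; rewrite setTI.
by rewrite -[X in measurable X]setTI; exact: mG.
Qed.

End independent_past.

(** * Exponential moments of sums of independent vectors *)

(** [exp(u) <= (1 - u/2)^-2], and [(1 - u/2)^2 (1 + u + 2 u^2) - 1] equals
    [u^2 (1 - u) (5/2 - u) / 2], which is non-negative for [u <= 1]. There is no lower restriction
    on [u]. *)
Lemma expR_le_quadratic (R : realType) (u : R) : u <= 1 -> expR u <= 1 + u + 2 * u ^+ 2.
Proof.
move=> u1; have e1 : 1 - u / 2 <= expR (- (u / 2)) by exact: expR_ge1Dx.
have v0 : 0 < 1 - u / 2 by lra.
have e2 : (1 - u / 2) ^+ 2 * expR u <= 1.
  have -> : expR u = (expR (- (u / 2)) ^+ 2)^-1.
    by rewrite -expRM_natl -expRN; congr expR; rewrite mulr2n; field.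
  rewrite ler_pdivrMr ?exprn_gt0 ?expR_gt0// mul1r.
  by rewrite ler_sqr ?nnegrE ?expR_ge0 ?(ltW v0).
rewrite -(ler_pM2l (exprn_gt0 2 v0)); apply: (le_trans e2).
have : 0 <= u ^+ 2 * ((1 - u) * (5 / 2 - u)) by rewrite mulr_ge0 ?sqr_ge0// mulr_ge0; lra.
by lra.
Qed.

Lemma ler_sqrt_tangent (R : rcfType) (a b : R) : 0 < a -> 0 <= b ->
  Num.sqrt b <= Num.sqrt a + (b - a) / (2 * Num.sqrt a).
Proof.
move=> a0 b0; have s0 : 0 < Num.sqrt a by rewrite sqrtr_gt0.
have t0 := sqrtr_ge0 b.
have := sqr_sqrtr b0; have := sqr_sqrtr (ltW a0).
move: s0 t0; set s := Num.sqrt a; set t := Num.sqrt b => s0 t0 <- <-.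
rewrite -subr_ge0 (_ : _ - _ = (t - s) ^+ 2 / (2 * s)).
  by rewrite divr_ge0 ?sqr_ge0// mulr_ge0// ltW.
by field; exact: lt0r_neq0.
Qed.

Lemma cauchy_schwarz_sum (R : realFieldType) (I : finType) (a b : I -> R) :
  (\sum_i a i * b i) ^+ 2 <= (\sum_i a i ^+ 2) * (\sum_i b i ^+ 2).
Proof.
set A := \sum_i a i ^+ 2; set B := \sum_i b i ^+ 2; set C := \sum_i a i * b i.
have A0 : 0 <= A by apply: sumr_ge0 => i _; exact: sqr_ge0.
have Q t : 0 <= t ^+ 2 * A - 2 * t * C + B.
  have -> : t ^+ 2 * A - 2 * t * C + B = \sum_i (t * a i - b i) ^+ 2.
    rewrite /A /B /C !mulr_sumr -sumrN -!big_split/=.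
    by apply: eq_bigr => i _; ring.
  by apply: sumr_ge0 => i _; exact: sqr_ge0.
have [A00|An0] := eqVneq A 0.
  have C0 : C = 0.
    rewrite /C big1// => i _; suff -> : a i = 0 by rewrite mul0r.
    apply/eqP; rewrite -sqrf_eq0; apply/eqP.
    by apply: (psumr_eq0P _ A00) => // k _; exact: sqr_ge0.
  by rewrite C0 A00 mul0r expr0n.
have Ap : 0 < A by rewrite lt_def An0.
have := Q (C / A); rewrite (_ : _ + B = B - C ^+ 2 / A); last by field.
by rewrite subr_ge0 ler_pdivrMr// mulrC.
Qed.

Section hilbert_concentration.
Context d (T : measurableType d) (R : realType) (P : probability T R).
Variables (n : nat) (Y : 'I_n -> {RV P >-> R}).
Hypothesis indepY : mutually_independent Y.
Variables (I : finType) (x : I -> R -> R) (A b2 V tau : R).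
Hypothesis mx : forall a, measurable_fun setT (x a).
Hypothesis A0 : 0 < A.
Hypothesis tau0 : 0 <= tau.
Hypothesis b20 : 0 <= b2.
Hypothesis V0 : 0 <= V.
Hypothesis tau_b2 : tau ^+ 2 * b2 <= 1.
Hypothesis x_b2 : forall y, \sum_a x a y ^+ 2 <= b2.
Hypothesis x_centered : forall a j, \int[P]_w x a (Y j w) = 0.
Hypothesis x_var : forall (th : I -> R) j,
  \sum_a \sum_b th a * th b * \int[P]_w (x a (Y j w) * x b (Y j w)) <= V * \sum_a th a ^+ 2.

Definition psum (m : nat) (y : 'I_n -> R) (a : I) : R :=
  \sum_(i < n) (if (i < m)%N then x a (y i) else 0).

(* Summands are added along the tangent of the square root, whose slope [A]
   keeps bounded near the origin. *)
Definition smoothnorm m y : R := Num.sqrt (A + \sum_a psum m y a ^+ 2).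

Let N := smoothnorm.
Let H m y : R := expR (tau * N m y).
Let th m y a : R := tau * psum m y a / N m y.
Let mu1 a b j : R := \int[P]_w (x a (Y j w) * x b (Y j w)).

Let sum_ge0 m y : 0 <= \sum_a psum m y a ^+ 2.
Proof. by apply: sumr_ge0 => a _; exact: sqr_ge0. Qed.

Let N_ge m y : Num.sqrt A <= N m y.
Proof. by rewrite ler_wsqrtr// lerDl. Qed.

Let sA_gt0 : 0 < Num.sqrt A. Proof. by rewrite sqrtr_gt0. Qed.

Let N_gt0 m y : 0 < N m y.
Proof. exact: lt_le_trans (N_ge m y). Qed.

Let N_sqr m y : N m y ^+ 2 = A + \sum_a psum m y a ^+ 2.
Proof. by rewrite sqr_sqrtr// addr_ge0// ltW. Qed.

Let psumS m y a (mn : (m < n)%N) : psum m.+1 y a = psum m y a + x a (y (Ordinal mn)).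
Proof.
rewrite /psum (bigD1 (Ordinal mn))//= ltnSn [in RHS](bigD1 (Ordinal mn))//= ltnn add0r addrC.
congr (_ + _); apply: eq_bigr => i im; rewrite ltnS leq_eqVlt.
by case: eqP => // E; move: im; rewrite -val_eqE/= E eqxx.
Qed.

Let th_sqr m y : \sum_a th m y a ^+ 2 <= tau ^+ 2.
Proof.
rewrite /th (eq_bigr (fun a => tau ^+ 2 / N m y ^+ 2 * psum m y a ^+ 2)); last first.
  by move=> a _; field; exact: lt0r_neq0.
rewrite -mulr_sumr mulrAC ler_pdivrMr ?exprn_gt0// ler_wpM2l ?sqr_ge0// N_sqr.
by rewrite lerDr ltW.
Qed.

(** The new summand changes [N^2] by [2 <S, x> + |x|^2]. Along the tangent of the square root the
    first part contributes [u] after scaling by [tau], the second at most [b2 / (2 sqrt A)].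
    Cauchy-Schwarz with [|th| <= tau] and [tau^2 b2 <= 1] gives [u <= 1], as the quadratic bound
    requires. *)
Let H_step m y (mn : (m < n)%N) (u : R) :
  u = \sum_a th m y a * x a (y (Ordinal mn)) ->
  H m.+1 y <= expR (tau * (b2 / (2 * Num.sqrt A))) * (H m y * (1 + u + 2 * u ^+ 2)).
Proof.
set z := y (Ordinal mn) => uE.
have u1 : u <= 1.
  have : u ^+ 2 <= 1.
    rewrite uE; apply: (le_trans (cauchy_schwarz_sum _ _)); apply: le_trans tau_b2.
    by apply: ler_pM => //; apply: sumr_ge0 => a _; exact: sqr_ge0.
  by move=> u21; have [//|u_gt1] := leP u 1; nra.
have NS : N m.+1 y <= N m y + (\sum_a psum m y a * x a z) / N m y + b2 / (2 * Num.sqrt A).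
  have E : A + \sum_a psum m.+1 y a ^+ 2 = N m y ^+ 2 +
      (2 * \sum_a psum m y a * x a z + \sum_a x a z ^+ 2).
    rewrite N_sqr -!addrA; congr (_ + _); rewrite mulr_sumr -!big_split/=.
    by apply: eq_bigr => a _; rewrite (psumS _ _ mn) -/z; ring.
  have := @ler_sqrt_tangent _ (N m y ^+ 2) (A + \sum_a psum m.+1 y a ^+ 2).
  rewrite sqrtr_sqr gtr0_norm// => /(_ (exprn_gt0 2 (N_gt0 m y))) H1.
  apply: (le_trans (H1 _)); first by rewrite addr_ge0// ltW.
  rewrite E addrAC subrr add0r -addrA lerD2l mulrDl; apply: lerD.
    by rewrite -mulf_div divff// mul1r.
  apply: ler_pM => //.
  - by apply: sumr_ge0 => a _; exact: sqr_ge0.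
  - by rewrite invr_ge0 mulr_ge0// ltW.
  - by rewrite lef_pV2 ?posrE ?mulr_gt0// ler_pM2l.
apply: (@le_trans _ _ (expR (tau * (b2 / (2 * Num.sqrt A))) * (H m y * expR u))).
  rewrite /H -!expRD ler_expR; apply: (le_trans (ler_wpM2l tau0 NS)).
  rewrite le_eqVlt; apply/orP; left; apply/eqP; rewrite uE /th.
  rewrite [X in _ = _ + (_ + X)](eq_bigr (fun a => tau / N m y * (psum m y a * x a z))).
    by rewrite -mulr_sumr; ring.
  by move=> a _; ring.
by apply: ler_wpM2l; [exact: expR_ge0|apply: ler_wpM2l; [exact: expR_ge0|exact: expR_le_quadratic]].
Qed.

(** The measurable structure is left arbitrary because measurability is needed twice: on [T], and on
    [pastType] for the independence argument. *)
Let mpsum d' (T' : measurableType d') (Z : 'I_n -> T' -> R) m a :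
  (forall i : 'I_n, (i < m)%N -> measurable_fun setT (Z i)) ->
  measurable_fun setT (fun w => psum m (Z^~ w) a).
Proof.
move=> mZ; apply: measurable_sum => i; case im : (i < m)%N => //.
by apply: measurableT_comp => //; exact: mZ.
Qed.

Let mN d' (T' : measurableType d') (Z : 'I_n -> T' -> R) m :
  (forall i : 'I_n, (i < m)%N -> measurable_fun setT (Z i)) ->
  measurable_fun setT (fun w => N m (Z^~ w)).
Proof.
move=> mZ; apply: (@measurableT_comp _ _ _ _ _ _ (@Num.sqrt R)).
  by apply: continuous_measurable_fun; exact: sqrt_continuous.
apply: measurable_funD => //; apply: measurable_sum => a; apply: measurable_funX.
exact: mpsum.
Qed.

Let mH d' (T' : measurableType d') (Z : 'I_n -> T' -> R) m :
  (forall i : 'I_n, (i < m)%N -> measurable_fun setT (Z i)) ->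
  measurable_fun setT (fun w => H m (Z^~ w)).
Proof.
move=> mZ; apply: (@measurableT_comp _ _ _ _ _ _ (@expR R)) => //.
by apply: measurable_funM => //; exact: mN.
Qed.

Let mth d' (T' : measurableType d') (Z : 'I_n -> T' -> R) m a :
  (forall i : 'I_n, (i < m)%N -> measurable_fun setT (Z i)) ->
  measurable_fun setT (fun w => th m (Z^~ w) a).
Proof.
move=> mZ; apply: measurable_funM; first by apply: measurable_funM => //; exact: mpsum.
(* Measurability of the inverse of the positive function [N] is obtained by writing it as
   [exp(- ln N)]. *)
apply: (@eq_measurable_fun _ _ _ _ _ (fun w => expR (- ln (N m (Z^~ w))))).
  by move=> w _; rewrite expRN lnK// posrE.
apply: (@measurableT_comp _ _ _ _ _ _ (@expR R)) => //.
apply: measurableT_comp => //; apply: (@measurableT_comp _ _ _ _ _ _ (@ln R)) => //.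
exact: mN.
Qed.

Let x_le a y : `|x a y| <= 1 + b2.
Proof.
have : x a y ^+ 2 <= b2.
  apply: le_trans (x_b2 y); rewrite (bigD1 a)//= lerDl.
  by apply: sumr_ge0 => i _; exact: sqr_ge0.
by rewrite ler_norml => h; apply/andP; split; nra.
Qed.

Let psum_le m y a : `|psum m y a| <= n%:R * (1 + b2).
Proof.
rewrite (le_trans (ler_norm_sum _ _ _))//.
apply: (@le_trans _ _ (\sum_(i < n) (1 + b2))).
  by apply: ler_sum => i _; case: ifP => // _; rewrite normr0 addr_ge0.
by rewrite sumr_const card_ord mulr_natl.
Qed.

Let mYi (i : 'I_n) : measurable_fun setT (Y i).
Proof. exact: measurable_funPT. Qed.

Let bH m : bounded_rv (fun w => H m (Y^~ w)).
Proof.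
split; first by apply: (@mH _ T (fun i w => Y i w)) => i _; exact: mYi.
exists (expR (tau * Num.sqrt (A + \sum_(a in I) (n%:R * (1 + b2)) ^+ 2))) => w.
rewrite ger0_norm ?expR_ge0// ler_expR ler_wpM2l// ler_wsqrtr// lerD2l.
by apply: ler_sum => a _; rewrite -[leLHS]real_normK ?num_real// ler_sqr ?nnegrE ?psum_le// mulr_ge0// addr_ge0.
Qed.

Let bth m a : bounded_rv (fun w => th m (Y^~ w) a).
Proof.
split; first by apply: (@mth _ T (fun i w => Y i w)) => i _; exact: mYi.
exists (1 + tau ^+ 2) => w.
have : th m (Y^~ w) a ^+ 2 <= tau ^+ 2.
  apply: le_trans (th_sqr m (Y^~ w)); rewrite (bigD1 a)//= lerDl.
  by apply: sumr_ge0 => i _; exact: sqr_ge0.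
have := sqr_ge0 tau; move: (tau ^+ 2) => t t0 h.
by rewrite ler_norml; apply/andP; split; nra.
Qed.

Let bx a j : bounded_rv (fun w => x a (Y j w)).
Proof. by split; [exact: measurableT_comp|exists (1 + b2) => w; exact: x_le]. Qed.

Let mpast m (i : 'I_n) : (i < m)%N -> measurable_fun setT (Y i : pastType Y m -> R).
Proof. exact: measurable_past_obs. Qed.

(** In place of conditional expectations, [1 + u + 2 u^2] is expanded in coordinates: each term is a
    past-measurable factor times a function of the new observation. The linear terms vanish by
    centring, the quadratic ones contribute at most [2 tau^2 V]. *)
Lemma expectation_exp_smoothnorm_step m : (m < n)%N ->
  \int[P]_w H m.+1 (Y^~ w) <=
  expR (tau * (b2 / (2 * Num.sqrt A)) + 2 * tau ^+ 2 * V) * \int[P]_w H m (Y^~ w).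
Proof.
move=> mn; set j := Ordinal mn; set c := expR (tau * (b2 / (2 * Num.sqrt A))).
pose F1 a w := H m (Y^~ w) * th m (Y^~ w) a.
pose F2 a b w := H m (Y^~ w) * (th m (Y^~ w) a * th m (Y^~ w) b).
have bF1 a : bounded_rv (F1 a) by exact: bounded_rvM.
have bF2 a b : bounded_rv (F2 a b) by apply: bounded_rvM => //; exact: bounded_rvM.
have E1 a : \int[P]_w (F1 a w * x a (Y j w)) = 0.
  rewrite (expectation_past_mul indepY (leqnn _) (bF1 a) _ (mx a) (x_le a)) ?x_centered ?mulr0//.
  by apply: measurable_funM; [apply: mH|apply: mth] => i; exact: mpast.
have E2 a b : \int[P]_w (F2 a b w * (x a (Y j w) * x b (Y j w))) =
    (\int[P]_w F2 a b w) * mu1 a b j.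
  apply: (@expectation_past_mul _ _ _ _ _ _ indepY m j (F2 a b) (fun y => x a y * x b y)
     ((1 + b2) * (1 + b2)) (leqnn _) (bF2 a b)).
  - apply: measurable_funM; first by apply: mH => i; exact: mpast.
    by apply: measurable_funM; apply: mth => i; exact: mpast.
  - exact: measurable_funM.
  - by move=> y; rewrite normrM ler_pM.
pose Q w := H m (Y^~ w) + \sum_a F1 a w * x a (Y j w) +
  2 * \sum_a \sum_b F2 a b w * (x a (Y j w) * x b (Y j w)).
have bs1 : bounded_rv (fun w => \sum_a F1 a w * x a (Y j w)).
  by apply: bounded_rv_sum => a; exact: bounded_rvM.
have bs2 : bounded_rv (fun w => \sum_a \sum_b F2 a b w * (x a (Y j w) * x b (Y j w))).
  by apply: bounded_rv_sum => a; apply: bounded_rv_sum => b; apply: bounded_rvM => //; exact: bounded_rvM.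
have b2s2 := bounded_rvM (bounded_rv_cst T 2) bs2.
have bQ : bounded_rv Q by apply: bounded_rvD => //; exact: bounded_rvD.
have HQ w : H m.+1 (Y^~ w) <= c * Q w.
  apply: (le_trans (@H_step m (Y^~ w) mn _ erefl)); rewrite -/c -/j.
  apply: ler_wpM2l; first exact: expR_ge0.
  rewrite le_eqVlt; apply/orP; left; apply/eqP; rewrite /Q 2!mulrDr mulr1.
  congr (_ + _ + _).
    by rewrite mulr_sumr; apply: eq_bigr => a _; rewrite /F1; ring.
  rewrite mulrCA; congr (2 * _).
  rewrite expr2 mulr_suml mulr_sumr; apply: eq_bigr => a _.
  by rewrite mulr_sumr mulr_sumr; apply: eq_bigr => b _; rewrite /F2; ring.
have HE := @expectation_le_bounded _ _ _ P _ _ (bH m.+1) (bounded_rvM (bounded_rv_cst T c) bQ) HQ.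
apply: (le_trans HE) => {HE}.
rewrite expectationZ_bounded// expRD -/c -mulrA ler_wpM2l ?expR_ge0//.
rewrite /Q expectationD_bounded//; last exact: bounded_rvD.
rewrite expectationD_bounded// expectationZ_bounded//.
rewrite expectation_sum_bounded; last by move=> a; exact: bounded_rvM.
rewrite big1 ?addr0; last by move=> a _; exact: E1.
rewrite expectation_sum_bounded; last first.
  by move=> a; apply: bounded_rv_sum => b; apply: bounded_rvM => //; exact: bounded_rvM.
rewrite (eq_bigr (fun a => \sum_b \int[P]_w (mu1 a b j * F2 a b w))); last first.
  move=> a _; rewrite expectation_sum_bounded; last first.
    by move=> b; apply: bounded_rvM => //; exact: bounded_rvM.
  by apply: eq_bigr => b _; rewrite E2 mulrC expectationZ_bounded.
have bm a b : bounded_rv (fun w => mu1 a b j * F2 a b w).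
  by apply: bounded_rvM => //; exact: bounded_rv_cst.
have bsm a : bounded_rv (fun w => \sum_b mu1 a b j * F2 a b w).
  by apply: bounded_rv_sum => b.
rewrite (eq_bigr (fun a => \int[P]_w (\sum_b mu1 a b j * F2 a b w))); last first.
  by move=> a _; rewrite expectation_sum_bounded.
rewrite -expectation_sum_bounded//.
have EH0 : 0 <= \int[P]_w H m (Y^~ w) by apply: Rintegral_ge0 => w _; exact: expR_ge0.
have : \int[P]_w (\sum_a \sum_b mu1 a b j * F2 a b w) <= V * tau ^+ 2 * \int[P]_w H m (Y^~ w).
  rewrite -expectationZ_bounded//; apply: expectation_le_bounded.
  - exact: bounded_rv_sum.
  - by apply: bounded_rvM => //; exact: bounded_rv_cst.
  move=> w; rewrite (eq_bigr (fun a => H m (Y^~ w) *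
      \sum_b th m (Y^~ w) a * th m (Y^~ w) b * mu1 a b j)); last first.
    by move=> a _; rewrite mulr_sumr; apply: eq_bigr => b _; rewrite /F2; ring.
  rewrite -mulr_sumr mulrC; apply: ler_wpM2r; first exact: expR_ge0.
  by apply: (le_trans (x_var (th m (Y^~ w)) j)); rewrite ler_wpM2l.
move=> H2; apply: (@le_trans _ _ ((1 + 2 * tau ^+ 2 * V) * \int[P]_w H m (Y^~ w))); first by lra.
by apply: ler_wpM2r => //; exact: expR_ge1Dx.
Qed.

Lemma expectation_exp_smoothnorm :
  \int[P]_w expR (tau * smoothnorm n (Y^~ w)) <=
  expR (tau * Num.sqrt A + n%:R * (tau * (b2 / (2 * Num.sqrt A)) + 2 * tau ^+ 2 * V)).
Proof.
suff S m : (m <= n)%N -> \int[P]_w H m (Y^~ w) <=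
    expR (tau * Num.sqrt A + m%:R * (tau * (b2 / (2 * Num.sqrt A)) + 2 * tau ^+ 2 * V)).
  exact: S.
elim: m => [_|m IH mn].
  rewrite mul0r addr0 -[leRHS](@expectation_cst _ _ _ P).
  apply: expectation_le_bounded => //; first exact: bounded_rv_cst.
  move=> w; rewrite /H /N /smoothnorm big1 ?addr0// => a _.
  by rewrite /psum big1 ?expr0n.
apply: (le_trans (expectation_exp_smoothnorm_step mn)).
apply: (le_trans (ler_wpM2l (expR_ge0 _) (IH (ltnW mn)))).
rewrite -expRD ler_expR; set t := _ + 2 * tau ^+ 2 * V.
by rewrite -[m.+1%:R]natr1 mulrDl mul1r; lra.
Qed.

Lemma bounded_rv_exp_smoothnorm : bounded_rv (fun w => expR (tau * smoothnorm n (Y^~ w))).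
Proof. exact: bH. Qed.

End hilbert_concentration.

(** * The stochastic error *)

(** With [N^2 = 4 q^2 + Z], the excess is positive only if [N > 4 q], as [16 - 4 = 12]. With
    [u = N - 4 q] it equals [u^2 + 8 q u], and both powers of [tau u] are bounded by its
    exponential. *)
Lemma max0_sub_le_exp (R : realType) (tau q Z : R) : 0 < tau -> 0 <= q -> 0 <= Z ->
  Num.max 0 (Z - 12 * q ^+ 2) <=
  (2 / tau ^+ 2 + 8 * q / tau) * expR (tau * (Num.sqrt (4 * q ^+ 2 + Z) - 4 * q)).
Proof.
move=> t0 q0 Z0; set N := Num.sqrt _.
have NE : N ^+ 2 = 4 * q ^+ 2 + Z by rewrite sqr_sqrtr// addr_ge0// mulr_ge0// sqr_ge0.
have c0 : 0 <= 2 / tau ^+ 2 + 8 * q / tau.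
  by rewrite addr_ge0 ?divr_ge0 ?mulr_ge0 ?exprn_ge0// ltW.
rewrite ge_max mulr_ge0 ?expR_ge0//=.
have [N4|N4] := leP N (4 * q).
  apply: (@le_trans _ _ 0); last by rewrite mulr_ge0 ?expR_ge0.
  have : N ^+ 2 <= (4 * q) ^+ 2 by rewrite ler_sqr ?nnegrE ?sqrtr_ge0// mulr_ge0.
  by rewrite NE exprMn; lra.
have -> : Z - 12 * q ^+ 2 = (N - 4 * q) ^+ 2 + 8 * q * (N - 4 * q).
  have -> : Z = N ^+ 2 - 4 * q ^+ 2 by rewrite NE; ring.
  by ring.
set u := N - 4 * q; have u0 : 0 <= u by rewrite subr_ge0 ltW.
have tu : 0 <= tau * u by rewrite mulr_ge0// ltW.
have e1 : tau * u <= expR (tau * u) by rewrite (le_trans _ (expR_ge1Dx _))// lerDr.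
have e2 : (tau * u) ^+ 2 <= 2 * expR (tau * u).
  by have := expR_ge1Dxn 1 tu; rewrite !factS fact0; lra.
have tn0 : tau != 0 by exact: lt0r_neq0.
rewrite (_ : u ^+ 2 + _ = (tau * u) ^+ 2 / tau ^+ 2 + 8 * q / tau * (tau * u)); last by field.
rewrite [leRHS]mulrDl; apply: lerD.
  by rewrite [leRHS]mulrAC ler_wpM2r// invr_ge0 sqr_ge0.
by rewrite ler_wpM2l// divr_ge0 ?mulr_ge0// ltW.
Qed.

Lemma ler_sum_inj (R : realFieldType) (k N : nat) (Q : pred 'I_k) (h : 'I_k -> nat) (G : nat -> R) :
  (forall m, 0 <= G m) -> {in Q &, injective h} -> (forall l, Q l -> (h l < N)%N) ->
  \sum_(l | Q l) G (h l) <= \sum_(0 <= m < N) G m.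
Proof.
move=> G0 inj hN; case: N hN => [|N] hN.
  by rewrite big_geq// big1// => l /hN.
rewrite big_mkord (partition_big (fun l => inord (h l) : 'I_N.+1) predT)//=.
apply: ler_sum => m _.
apply: (@le_trans _ _ (\sum_(l | Q l && (inord (h l) == m)) G m)).
  rewrite le_eqVlt; apply/orP; left; apply/eqP; apply: eq_bigr => l /andP[Ql /eqP <-].
  by rewrite inordK// hN.
rewrite sumr_const -[leRHS]mulr1n; apply: ler_wpMn2l => //.
apply/card_le1_eqP => l1 l2; rewrite !unfold_in => /andP[Q1 /eqP E1] /andP[Q2 /eqP E2].
apply: inj => //; have := congr1 val (etrans E1 (esym E2)).
by rewrite /= !inordK ?hN.
Qed.

Section trigonometric_noise.
Context {R : realType}.

Definition trig (b : bool) (j : nat) : R -> R := if b then cosn j else sinn j.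

Lemma measurable_trig b j : measurable_fun setT (trig b j).
Proof. by case: b; [exact: measurable_cosn|exact: measurable_sinn]. Qed.

Lemma normr_trig b j x : `|trig b j x| <= 1.
Proof. by case: b; [exact: normr_cosn|exact: normr_sinn]. Qed.

Definition natdist (j l : nat) : nat := (j - l) + (l - j).

Context d (T : measurableType d) (P : probability T R).
Variables (n : nat) (Y : 'I_n -> {RV P >-> R}).
Hypothesis indepY : mutually_independent Y.
Variable e : bool -> nat -> R.
Hypothesis Ee : forall b j i, \int[P]_w trig b j (Y i w) = e b j.

Let G m : R := `|e true m| + `|e false m|.

Lemma bounded_rv_trig b j i : bounded_rv (fun w => trig b j (Y i w)).
Proof.
split; last by exists 1 => w; exact: normr_trig.
by apply: measurableT_comp; [exact: measurable_trig|exact: measurable_funPT].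
Qed.

Let E_half (s : R) b b' j l i : `|s| = 1 ->
  `|\int[P]_w (2^-1 * (trig b j (Y i w) + s * trig b' l (Y i w)))| <= 2^-1 * (G j + G l).
Proof.
move=> s1; rewrite expectationZ_bounded; last first.
  by apply: bounded_rvD; [|apply: bounded_rvM; [exact: bounded_rv_cst|]]; exact: bounded_rv_trig.
rewrite expectationD_bounded; [|exact: bounded_rv_trig|]; last first.
  by apply: bounded_rvM; [exact: bounded_rv_cst|exact: bounded_rv_trig].
rewrite expectationZ_bounded; last exact: bounded_rv_trig.
rewrite !Ee normrM ger0_norm ?invr_ge0// ler_pM2l ?invr_gt0//.
rewrite (le_trans (ler_normD _ _))// normrM s1 mul1r.
by apply: lerD; rewrite /G; [case: b|case: b']; rewrite ?lerDl ?lerDr.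
Qed.

Lemma expectation_trig_mul b b' j l i :
  `|\int[P]_w (trig b j (Y i w) * trig b' l (Y i w))| <= 2^-1 * (G (natdist j l) + G (j + l)%N).
Proof.
wlog lj : b b' j l / (l <= j)%N.
  move=> H; have [lj|/ltnW jl] := leqP l j; first exact: H.
  have := H b' b l j jl; rewrite /natdist [(l - j + _)%N]addnC [(l + j)%N]addnC.
  by under eq_Rintegral do rewrite mulrC.
have N1 : `|(-1 : R)| = 1 by rewrite normrN normr1.
have -> : natdist j l = (j - l)%N by rewrite /natdist (eqP (_ : l - j == 0)%N) ?addn0 ?subn_eq0.
case: b; case: b'.
- have := @E_half 1 true true (j - l) (j + l) i (normr1 _).
  by apply: le_trans; under [X in _ <= `|X|]eq_Rintegral do rewrite mul1r -cosn_cosn//.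
- have := @E_half (-1) false false (j + l) (j - l) i N1; rewrite addrC.
  by apply: le_trans; under [X in _ <= `|X|]eq_Rintegral do rewrite mulN1r -cosn_sinn//.
- have := @E_half 1 false false (j - l) (j + l) i (normr1 _).
  by apply: le_trans; under [X in _ <= `|X|]eq_Rintegral do rewrite mul1r -sinn_cosn//.
- have := @E_half (-1) true true (j - l) (j + l) i N1.
  by apply: le_trans; under [X in _ <= `|X|]eq_Rintegral do rewrite mulN1r -sinn_sinn//.
Qed.

Variables (k : nat) (M : R).
Hypothesis GM : \sum_(0 <= m < (2 * k).+1) G m <= M.

Let G_ge0 m : 0 <= G m. Proof. by rewrite addr_ge0. Qed.

(** On each of the ranges [l <= j] and [l > j], and for the sums [j + l], the frequency is an
    injective function of [l] with values at most [2 k]; each of the three contributes at most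
    [M]. *)
Lemma schur_row_sum (j : 'I_k) :
  \sum_(l < k) (G (natdist j.+1 l.+1) + G (j.+1 + l.+1)%N) <= 3 * M.
Proof.
have GN N : (N <= (2 * k).+1)%N -> \sum_(0 <= m < N) G m <= M.
  move=> N2; apply: le_trans GM; rewrite [leRHS](big_cat_nat (n := N))//=.
  by rewrite lerDl; apply: sumr_ge0.
rewrite big_split/= (bigID (fun l : 'I_k => (l <= j)%N))/=.
have -> : 3 * M = M + M + M by ring.
apply: lerD; first apply: lerD.
- rewrite (eq_bigr (fun l : 'I_k => G (j - l)%N)); last first.
    by move=> l lj; rewrite /natdist !subSS (eqP (_ : l - j == 0)%N) ?addn0 ?subn_eq0.
  apply: (le_trans (@ler_sum_inj R k (2 * k).+1 (fun l => l <= j)%N (fun l => j - l)%N G G_ge0 _ _)).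
  + by move=> l1 l2 /= h1 h2 E; apply/val_inj; rewrite -[val l1](subKn h1) -[val l2](subKn h2) E.
  + by move=> l _; rewrite ltnS (leq_trans (leq_subr _ _))// (leq_trans (ltnW (ltn_ord j)))// leq_pmull.
  + exact: GM.
- rewrite (eq_bigr (fun l : 'I_k => G (l - j)%N)); last first.
    move=> l; rewrite -ltnNge => /ltnW lj.
    by rewrite /natdist !subSS (eqP (_ : j - l == 0)%N) ?add0n ?subn_eq0.
  apply: (le_trans (@ler_sum_inj R k (2 * k).+1 (fun l => ~~ (l <= j))%N (fun l => l - j)%N G G_ge0 _ _)).
  + move=> l1 l2 /=; rewrite !unfold_in -!ltnNge => /ltnW h1 /ltnW h2 E.
    by apply/val_inj; rewrite -[val l1](subnK h1) -[val l2](subnK h2) E.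
  + by move=> l _; rewrite ltnS (leq_trans (leq_subr _ _))// (leq_trans (ltnW (ltn_ord l)))// leq_pmull.
  + exact: GM.
- apply: (le_trans (@ler_sum_inj R k (2 * k).+1 predT (fun l => j.+1 + l.+1)%N G G_ge0 _ _)).
  + by move=> l1 l2 _ _ /addnI [] /val_inj.
  + by move=> l _; rewrite ltnS mul2n -addnn leq_add// ltn_ord.
  + exact: GM.
Qed.

Variables (v : nat -> R) (vk : R).
Hypothesis v0 : forall j, 0 <= v j.
Hypothesis v_vk : forall j, (j <= k)%N -> v j <= vk.

(* There is one pair of coordinates per positive frequency.  Negative
   frequencies duplicate it, so the squared norm of [psum noise_coord n] is
   n^2 / 2 times the weighted noise. *)
Definition noise_coord (a : 'I_k * bool) (y : R) : R :=
  Num.sqrt (v a.1.+1) * (trig a.2 a.1.+1 y - e a.2 a.1.+1).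

Lemma noise_coord_centered a i : \int[P]_w noise_coord a (Y i w) = 0.
Proof.
rewrite /noise_coord expectationZ_bounded; last first.
  by apply: bounded_rvD; [exact: bounded_rv_trig|exact: bounded_rv_cst].
rewrite expectationD_bounded; [|exact: bounded_rv_trig|exact: bounded_rv_cst].
by rewrite Ee expectation_cst subrr mulr0.
Qed.

(** Pointwise [c cos + s sin <= (c^2 + s^2 + 1) / 2]; for [c] and [s] the means, integration turns
    the left side into [c^2 + s^2]. *)
Lemma sqr_expectation_trig_le1 j : (0 < n)%N -> e true j ^+ 2 + e false j ^+ 2 <= 1.
Proof.
move=> n0; pose i := Ordinal n0.
set c := e true j; set s := e false j.
have bc := bounded_rvM (bounded_rv_cst T c) (bounded_rv_trig true j i).
have bs := bounded_rvM (bounded_rv_cst T s) (bounded_rv_trig false j i).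
have : \int[P]_w (c * trig true j (Y i w) + s * trig false j (Y i w)) <=
    \int[P]_w (2^-1 * (c ^+ 2 + s ^+ 2 + 1)).
  apply: expectation_le_bounded; [exact: bounded_rvD|exact: bounded_rv_cst|].
  move=> w /=; have := cosn_sqrD_sinn_sqr j (Y i w).
  have := sqr_ge0 (c - cosn j (Y i w)); have := sqr_ge0 (s - sinn j (Y i w)).
  by rewrite !sqrrB; lra.
rewrite expectationD_bounded// expectation_cst !expectationZ_bounded; try exact: bounded_rv_trig.
by rewrite !Ee -/c -/s; lra.
Qed.

Lemma noise_coord_sqr y : (0 < n)%N -> \sum_a noise_coord a y ^+ 2 <= 4 * k%:R * vk.
Proof.
move=> n0; rewrite (eq_bigr (fun p : 'I_k * bool => noise_coord (p.1, p.2) y ^+ 2)); last by case.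
rewrite -(pair_bigA _ (fun (j : 'I_k) b => noise_coord (j, b) y ^+ 2))/=.
apply: (@le_trans _ _ (\sum_(j < k) 4 * vk)); last first.
  by rewrite sumr_const card_ord -mulr_natl; lra.
apply: ler_sum => j _; rewrite big_bool/= /noise_coord/= !exprMn sqr_sqrtr// -mulrDr.
have := sqr_expectation_trig_le1 j.+1 n0; have := cosn_sqrD_sinn_sqr j.+1 y.
have := v_vk (ltn_ord j); have := v0 j.+1.
set c := cosn _ _; set s := sinn _ _; set c' := e true _; set s' := e false _.
move=> v1 v2 h1 h2; rewrite mulrC; apply: ler_pM => //; first by rewrite addr_ge0 ?sqr_ge0.
by have := sqr_ge0 (c + c'); have := sqr_ge0 (s + s'); rewrite !sqrrB !sqrrD; lra.
Qed.

(* Schur's test: products of trigonometric functions only involve the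
   frequencies j + l and |j - l|, so that the row sums of the covariance matrix
   are controlled by the l1-norm of [e]. *)
Lemma noise_coord_variance (th : 'I_k * bool -> R) i :
  \sum_a \sum_b th a * th b * \int[P]_w (noise_coord a (Y i w) * noise_coord b (Y i w)) <=
  3 * M * vk * \sum_a th a ^+ 2.
Proof.
pose psi a := th a * Num.sqrt (v a.1.+1).
pose K (a b : 'I_k * bool) := 2^-1 * (G (natdist a.1.+1 b.1.+1) + G (a.1.+1 + b.1.+1)%N).
have K0 a b : 0 <= K a b by rewrite mulr_ge0 ?invr_ge0// addr_ge0.
have Ksym a b : K a b = K b a.
  by rewrite /K /natdist [(b.1.+1 - _ + _)%N]addnC [(b.1.+1 + _)%N]addnC.
have Krow a : \sum_b K a b <= 3 * M.
  rewrite (eq_bigr (fun p : 'I_k * bool => K a (p.1, p.2))); last by case.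
  rewrite -(pair_bigA _ (fun (l : 'I_k) b => K a (l, b)))/=.
  apply: le_trans (schur_row_sum a.1); apply: ler_sum => l _.
  by rewrite big_bool/= /K/=; lra.
pose tt (a b : 'I_k * bool) := \int[P]_w (trig a.2 a.1.+1 (Y i w) * trig b.2 b.1.+1 (Y i w)).
pose m (a : 'I_k * bool) := e a.2 a.1.+1.
have cov a b : th a * th b * \int[P]_w (noise_coord a (Y i w) * noise_coord b (Y i w)) =
    psi a * psi b * tt a b - (psi a * m a) * (psi b * m b).
  have bt (c : 'I_k * bool) := bounded_rv_trig c.2 c.1.+1 i.
  rewrite (_ : \int[P]_w _ = Num.sqrt (v a.1.+1) * Num.sqrt (v b.1.+1) * (tt a b - m a * m b)).
    by rewrite /psi; ring.
  have btt : bounded_rv (fun w => trig a.2 a.1.+1 (Y i w) * trig b.2 b.1.+1 (Y i w)).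
    exact: bounded_rvM.
  have b1 := bounded_rvM (bounded_rv_cst T (- m b)) (bt a).
  have b2 := bounded_rvM (bounded_rv_cst T (- m a)) (bt b).
  have b3 := bounded_rv_cst T (m a * m b).
  transitivity (\int[P]_w (Num.sqrt (v a.1.+1) * Num.sqrt (v b.1.+1) *
     (trig a.2 a.1.+1 (Y i w) * trig b.2 b.1.+1 (Y i w) +
      ((- m b) * trig a.2 a.1.+1 (Y i w) + ((- m a) * trig b.2 b.1.+1 (Y i w) + m a * m b))))).
    by apply: eq_Rintegral => w _; rewrite /noise_coord -/(m a) -/(m b); ring.
  rewrite expectationZ_bounded; last by do 3?[apply: bounded_rvD => //].
  rewrite !expectationD_bounded//; [|exact: bounded_rvD|by do 2?[apply: bounded_rvD => //]].
  rewrite (expectation_cst P (m a * m b)) (expectationZ_bounded P (- m b) (bt a)) (expectationZ_bounded P (- m a) (bt b)) !Ee -/(m a) -/(m b) -/(tt a b).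
  by congr (_ * _); ring.
rewrite (eq_bigr (fun a => \sum_b (psi a * psi b * tt a b) - (psi a * m a) * \sum_b psi b * m b)); last first.
  by move=> a _; rewrite mulr_sumr -sumrB; apply: eq_bigr => b _; exact: cov.
rewrite sumrB -mulr_suml -expr2.
(* The products of means sum to a square with a negative sign: second moments dominate
   covariances. *)
apply: (@le_trans _ _ (\sum_a \sum_b psi a * psi b * tt a b)); first by rewrite gerBl sqr_ge0.
(* Splitting [psi a psi b] into half squares; by symmetry of [K] and exchange of the sums both
   halves reduce to row sums. *)
apply: (@le_trans _ _ (\sum_a \sum_b (2^-1 * (psi a ^+ 2 * K a b) + 2^-1 * (psi b ^+ 2 * K b a)))).
  apply: ler_sum => a _; apply: ler_sum => b _.
  rewrite (le_trans (ler_norm _))// normrM.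
  apply: (@le_trans _ _ (`|psi a * psi b| * K a b)).
    by rewrite ler_wpM2l//; exact: expectation_trig_mul.
  rewrite (Ksym b a) -mulrDr -mulrDl mulrA ler_wpM2r// normrM.
  rewrite -[psi a ^+ 2]real_normK ?num_real// -[psi b ^+ 2]real_normK ?num_real//.
  by have := sqr_ge0 (`|psi a| - `|psi b|); rewrite sqrrB; lra.
under eq_bigr do rewrite big_split/=.
rewrite big_split/= [X in _ + X]exchange_big/= -big_split/=.
rewrite mulr_sumr; apply: ler_sum => a _.
rewrite -!mulr_sumr -mulrDl (_ : 2^-1 + 2^-1 = 1); last by field.
rewrite mul1r.
apply: (@le_trans _ _ (psi a ^+ 2 * (3 * M))); first by rewrite ler_wpM2l ?sqr_ge0// mulr_sumr; exact: Krow.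
rewrite /psi exprMn sqr_sqrtr// mulrC -!mulrA; have M0 : 0 <= M.
  by apply: le_trans GM; apply: sumr_ge0.
rewrite ler_wpM2l// ler_wpM2l// mulrA -expr2 [leLHS]mulrC ler_wpM2r ?sqr_ge0//.
by rewrite v_vk// ltn_ord.
Qed.

Lemma psum_noise_sqr y :
  \sum_a psum noise_coord n y a ^+ 2 =
  \sum_(1 <= j < k.+1) v j * ((\sum_(i < n) cosn j (y i) - n%:R * e true j) ^+ 2 +
     (\sum_(i < n) sinn j (y i) - n%:R * e false j) ^+ 2).
Proof.
rewrite big_add1 big_mkord.
rewrite (eq_bigr (fun p : 'I_k * bool => psum noise_coord n y (p.1, p.2) ^+ 2)); last by case.
rewrite -(pair_bigA _ (fun (j : 'I_k) b => psum noise_coord n y (j, b) ^+ 2))/=.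
apply: eq_bigr => j _; rewrite big_bool/= mulrDr.
have E b : psum noise_coord n y (j, b) =
    Num.sqrt (v j.+1) * (\sum_(i < n) trig b j.+1 (y i) - n%:R * e b j.+1).
  rewrite /psum (eq_bigr (fun i : 'I_n => noise_coord (j, b) (y i))); last first.
    by move=> i _; rewrite ltn_ord.
  rewrite /noise_coord/= -mulr_sumr sumrB sumr_const card_ord mulr_natl.
  by [].
by rewrite !E !exprMn sqr_sqrtr.
Qed.

(** With [t = sqrt(k lambda)], the exponent collects [t] from [tau sqrt A], at most [t/2] from the
    quadratic increments (by [lambda >= 1]), [3 M / 2] from the variance and [-2 t] from the
    threshold [4 q]: in total [3 M / 2 - t/2]. *)
Lemma noise_excess (lambda : R) : (0 < k)%N -> (k <= n)%N -> 1 <= lambda -> 0 < vk ->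
  exists2 B : T -> R, bounded_rv B &
    (forall w, Num.max 0 (\sum_(1 <= j < k.+1) v j *
       ((\sum_(i < n) cosn j (Y i w) - n%:R * e true j) ^+ 2 +
        (\sum_(i < n) sinn j (Y i w) - n%:R * e false j) ^+ 2) -
        12 * (n%:R * k%:R * vk * lambda)) <= B w) /\
    \int[P]_w B w <= n%:R * vk * (8 + 16 * Num.sqrt (k%:R * lambda)) *
       expR (3 / 2 * M - 2^-1 * Num.sqrt (k%:R * lambda)).
Proof.
move=> k0 kn l1 vk0; have n0 : (0 < n)%N by exact: leq_trans kn.
have [nR kR] : 0 < n%:R :> R /\ 0 < k%:R :> R by rewrite !ltr0n.
have l0 : 0 < lambda by exact: lt_le_trans l1.
have M0 : 0 <= M by apply: le_trans GM; apply: sumr_ge0.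
pose s := Num.sqrt (n%:R * vk); pose t := Num.sqrt (k%:R * lambda).
have s0 : 0 < s by rewrite sqrtr_gt0 mulr_gt0.
have t0 : 0 < t by rewrite sqrtr_gt0 mulr_gt0.
have s2 : s ^+ 2 = n%:R * vk by rewrite sqr_sqrtr// ltW// mulr_gt0.
have t2 : t ^+ 2 = k%:R * lambda by rewrite sqr_sqrtr// ltW// mulr_gt0.
(* [tau] is chosen so that [tau^2 b2 = k / n], which is at most 1. *)
pose q := s * t; pose tau := (2 * s)^-1.
have q0 : 0 < q by exact: mulr_gt0.
have tau0 : 0 < tau by rewrite invr_gt0 mulr_gt0.
have q2 : q ^+ 2 = n%:R * k%:R * vk * lambda by rewrite exprMn s2 t2; ring.
pose A := 4 * q ^+ 2.
have A0 : 0 < A by rewrite mulr_gt0 ?exprn_gt0.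
have sA : Num.sqrt A = 2 * q.
  by rewrite /A (_ : 4 * q ^+ 2 = (2 * q) ^+ 2) ?sqrtr_sqr ?gtr0_norm ?mulr_gt0//; ring.
pose b2 := 4 * k%:R * vk.
have b20 : 0 <= b2 by rewrite !mulr_ge0// ltW.
pose V := 3 * M * vk.
have V0 : 0 <= V by rewrite !mulr_ge0// ltW.
have tau2 : tau ^+ 2 = (4 * (n%:R * vk))^-1 by rewrite /tau exprVn exprMn s2; congr (_ * _)^-1; ring.
have tb2 : tau ^+ 2 * b2 <= 1.
  rewrite tau2 mulrC ler_pdivrMr ?mulr_gt0// mul1r /b2 -mulrA ler_pM2l// ler_pM2r//.
  by rewrite ler_nat.
have mx a : measurable_fun setT (noise_coord a).
  by apply: measurable_funM => //; apply: measurable_funB => //; exact: measurable_trig.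
pose Z w := \sum_a psum noise_coord n (Y^~ w) a ^+ 2.
have mgf := expectation_exp_smoothnorm indepY mx A0 (ltW tau0) b20 V0 tb2
  (fun y => noise_coord_sqr y n0) noise_coord_centered noise_coord_variance.
have bS := bounded_rv_exp_smoothnorm Y A mx (ltW tau0) b20 (fun y => noise_coord_sqr y n0).
pose c := 2 / tau ^+ 2 + 8 * q / tau.
have c0 : 0 <= c by rewrite addr_ge0// divr_ge0 ?mulr_ge0 ?sqr_ge0// ltW.
pose B w := c * expR (- (tau * (4 * q))) * expR (tau * smoothnorm noise_coord A n (Y^~ w)).
exists B; first by apply: bounded_rvM => //; exact: bounded_rv_cst.
split.
  move=> w; have := @max0_sub_le_exp R tau q (Z w) tau0 (ltW q0) (sumr_ge0 _ (fun a _ => sqr_ge0 _)).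
  rewrite -q2 -psum_noise_sqr -/(Z w) => /le_trans; apply.
  rewrite /B -/c mulrBr addrC expRD mulrA.
  exact: lexx.
rewrite expectationZ_bounded//.
apply: (@le_trans _ _ (c * expR (- (tau * (4 * q))) * expR
  (tau * Num.sqrt A + n%:R * (tau * (b2 / (2 * Num.sqrt A)) + 2 * tau ^+ 2 * V)))).
  by rewrite ler_wpM2l// mulr_ge0// expR_ge0.
rewrite -mulrA -expRD.
have -> : c = n%:R * vk * (8 + 16 * t).
  rewrite /c tau2 -s2 /q /tau; field; exact: lt0r_neq0.
rewrite -/t ler_wpM2l//; first by rewrite !mulr_ge0 ?addr_ge0 ?mulr_ge0// ltW.
rewrite ler_expR sA.
have e1 : n%:R * (2 * tau ^+ 2 * V) = 3 / 2 * M.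
  by rewrite tau2 /V; field; rewrite !lt0r_neq0.
have e2 : n%:R * (tau * (b2 / (2 * (2 * q)))) <= tau * q.
  rewrite [leLHS](_ : _ = tau * (n%:R * k%:R * vk / q)); last first.
    by rewrite /b2; field; exact: lt0r_neq0.
  have h0 : 0 <= n%:R * k%:R * vk by rewrite !mulr_ge0// ltW.
  by rewrite ler_wpM2l// ?(ltW tau0)// ler_pdivrMr// -expr2 q2 ler_peMr.
have e3 : tau * q = 2^-1 * t.
  by rewrite /tau /q; field; exact: lt0r_neq0.
rewrite mulrDr e1; lra.
Qed.

End trigonometric_noise.

(** * Weights and the oracle inequality *)

Lemma sum_inv_sqr (R : realFieldType) (n : nat) : \sum_(1 <= k < n.+1) ((k%:R : R) ^+ 2)^-1 <= 2.
Proof.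
case: n => [|n]; first by rewrite big_geq.
suff : \sum_(1 <= k < n.+2) ((k%:R : R) ^+ 2)^-1 <= 2 - n.+1%:R^-1.
  by move=> /le_trans; apply; rewrite gerBl invr_ge0.
elim: n => [|n IH]; first by rewrite big_nat1 expr1n invr1; lra.
rewrite big_nat_recr//=; apply: (le_trans (lerD IH (lexx _))).
have x0 : (0 : R) < n.+1%:R by [].
have y0 : (0 : R) < n.+2%:R by [].
have -> : (n.+2%:R : R) = n.+1%:R + 1 by rewrite -natr1.
rewrite -subr_ge0; set x : R := n.+1%:R in x0 *.
rewrite (_ : _ - _ = (x * (x + 1) ^+ 2)^-1); last by field; rewrite !lt0r_neq0//; lra.
by rewrite invr_ge0 mulr_ge0 ?sqr_ge0// ltW.
Qed.

Lemma mulr_expN_le (R : realType) (x : R) : x * expR (- x) <= 1.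
Proof.
rewrite expRN ler_pdivrMr ?expR_gt0// mul1r (le_trans _ (expR_ge1Dx x))//.
by rewrite lerDr.
Qed.

Lemma mulr_expN_le_sqr (R : realType) (x : R) : 0 < x -> x * expR (- x) <= 6 / x ^+ 2.
Proof.
move=> x0; rewrite expRN ler_pdivrMr ?expR_gt0// mulrAC ler_pdivlMr ?exprn_gt0//.
have := expR_ge1Dxn 2 (ltW x0); rewrite !factS fact0 -exprS; lra.
Qed.

Section weights.
Context {R : realType}.
Variables (n : nat) (c : nat -> R).
Hypothesis n0 : (0 < n)%N.

Lemma argminP : (0 < argmin n c < n.+1)%N /\ forall l, (0 < l < n.+1)%N -> c (argmin n c) <= c l.
Proof.
pose i0 : 'I_n := Ordinal n0.
pose P k := all (fun l => c k <= c l) (iota 1 n).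
(* A minimiser exists, so the filtered list is non-empty and [argmin] never returns its default
   0. *)
have hasP : has P (iota 1 n).
  case: (@Order.TotalTheory.arg_minP _ _ 'I_n i0 predT (fun i => c i.+1) isT) => i _ imin.
  apply/hasP; exists i.+1; first by rewrite mem_iota/= add1n ltnS.
  apply/allP => l; rewrite mem_iota add1n => /andP[l0 ln].
  case: l l0 ln => // l _; rewrite ltnS => ln.
  exact: (imin (Ordinal ln)).
have : argmin n c \in [seq k <- iota 1 n | P k].
  rewrite /argmin -/P; move: hasP; rewrite has_filter.
  by case: [seq k <- iota 1 n | P k] => //= a s _; rewrite mem_head.
rewrite mem_filter mem_iota add1n => /andP[/allP Pa a1]; split => // l l1.
by apply: Pa; rewrite mem_iota add1n.
Qed.

Lemma admissible_weightsP (W : (nat -> R) -> nat -> R) : admissible_weights n W ->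
  [/\ forall k, 0 <= W c k, \sum_(1 <= k < n.+1) W c k = 1 &
      forall k m, (0 < k < n.+1)%N -> (0 < m < n.+1)%N ->
        W c k <= expR (- (n%:R * (c k - c m)))].
Proof.
have sge (m : nat) : (0 < m < n.+1)%N -> forall F : nat -> R, (forall l, 0 <= F l) ->
    F m <= \sum_(1 <= l < n.+1) F l.
  move=> mn F F0; rewrite (bigD1_seq m) ?mem_index_iota ?iota_uniq//= lerDl.
  by apply: sumr_ge0.
have nR : (0 : R) <= n%:R by [].
case=> [[eta eta0 ->]|->].
- set S := \sum_(1 <= l < n.+1) expR (- eta%:R * n%:R * c l).
  have S0 : 0 < S.
    have n1 : (0 < 1 < n.+1)%N by rewrite /= ltnS.
    apply: lt_le_trans (sge 1%N n1 (fun l => expR (- eta%:R * n%:R * c l)) _); first exact: expR_gt0.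
    by move=> l; exact: expR_ge0.
  have bw k : bayes_weights n eta c k = expR (- eta%:R * n%:R * c k) / S by [].
  split.
  + by move=> k; rewrite bw divr_ge0 ?expR_ge0// ltW.
  + by under eq_bigr do rewrite bw; rewrite -mulr_suml divff// lt0r_neq0.
  + move=> k m kn mn; rewrite bw.
    have [ck|ck] := leP (c k) (c m).
      apply: (@le_trans _ _ 1).
        by rewrite ler_pdivrMr// mul1r; apply: (sge k kn (fun l => expR (- eta%:R * n%:R * c l))) => l; exact: expR_ge0.
      by rewrite -expR0 ler_expR oppr_ge0 mulr_ge0_le0// subr_le0.
    apply: (@le_trans _ _ (expR (- (eta%:R * n%:R * (c k - c m))))).
      rewrite ler_pdivrMr//.
      apply: (@le_trans _ _ (expR (- (eta%:R * n%:R * (c k - c m))) * expR (- eta%:R * n%:R * c m))).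
        by rewrite -expRD le_eqVlt; apply/orP; left; apply/eqP; congr expR; ring.
      rewrite ler_wpM2l ?expR_ge0//.
      by apply: (sge m mn (fun l => expR (- eta%:R * n%:R * c l))) => l; exact: expR_ge0.
    rewrite ler_expR lerN2 -mulrA ler_peMl//; last by rewrite ler1n.
    by rewrite mulr_ge0// subr_ge0 ltW.
- have [a1 amin] := argminP.
  split.
  + by move=> k; rewrite /ms_weights.
  + rewrite (bigD1_seq (argmin n c)) ?mem_index_iota ?iota_uniq//= {1}/ms_weights eqxx.
    by rewrite big1 ?addr0// => k /negbTE kE; rewrite /ms_weights kE.
  + move=> k m kn mn; rewrite /ms_weights; have [->|_] := eqVneq; last by rewrite expR_ge0.
    by rewrite -expR0 ler_expR oppr_ge0 mulr_ge0_le0// subr_le0 amin.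
Qed.

End weights.

(** * A deterministic oracle inequality *)

Section oracle.
Context {R : realType}.
Variables (n m : nat) (w : nat -> R) (h b z t p loss : nat -> R) (beta : R).
Hypotheses (m0 : (0 < m)%N) (mn : (m <= n)%N).
Let nR : R := n%:R.
Let H k := \sum_(1 <= j < k.+1) h j.
Let Z k := \sum_(1 <= j < k.+1) z j.
Hypothesis w0 : forall k, 0 <= w k.
Hypothesis w1 : \sum_(1 <= k < n.+1) w k = 1.
Hypothesis wexp : forall k, (0 < k < n.+1)%N ->
  w k <= expR (- (nR * ((- H k + p k) - (- H m + p m)))).
Hypotheses (b0 : forall j, 0 <= b j) (z0 : forall j, 0 <= z j) (h0 : forall j, 0 <= h j).
Hypotheses (hle : forall j, h j <= 3 / 2 * z j + 3 * b j) (hge : forall j, b j / 2 - z j <= h j).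
Hypothesis t0 : forall k, 0 <= t k.
Hypothesis pt : forall k, (0 < k < n.+1)%N -> 7 / 2 * t k <= p k.
Hypothesis pk : forall k, (0 < k < n.+1)%N -> 84 * k%:R / nR <= p k.
Hypothesis tailb : forall k, (m <= k)%N -> \sum_(m.+1 <= j < k.+1) b j <= beta.
Hypothesis loss_small : forall k, (0 < k < m)%N ->
  loss k <= Z k + \sum_(k.+1 <= j < m.+1) b j + beta.
Hypothesis loss_large : forall k, (m <= k)%N -> loss k <= Z k + beta.

Let n0 : 0 < nR. Proof. by rewrite ltr0n (leq_trans m0). Qed.
Let beta0 : 0 <= beta. Proof. by have := tailb (leqnn m); rewrite big_geq. Qed.
Let sum0 (F : nat -> R) a c : (forall j, 0 <= F j) -> 0 <= \sum_(a <= j < c) F j.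
Proof. by move=> F0; apply: sumr_ge0. Qed.
Let p0 k : (0 < k < n.+1)%N -> 0 <= p k.
Proof. by move=> kn; rewrite (le_trans _ (pt kn))// mulr_ge0// divr_ge0. Qed.
Let w_le1 k : (0 < k < n.+1)%N -> w k <= 1.
Proof.
move=> kn; rewrite -w1 (bigD1_seq k) ?mem_index_iota ?iota_uniq//= lerDl.
by apply: sumr_ge0.
Qed.

Let split_sum (F : nat -> R) a c : (a <= c)%N ->
  \sum_(1 <= j < c.+1) F j = \sum_(1 <= j < a.+1) F j + \sum_(a.+1 <= j < c.+1) F j.
Proof. by move=> ac; rewrite (big_cat_nat (n := a.+1)). Qed.

Let mn1 : (0 < m < n.+1)%N. Proof. by rewrite m0 ltnS. Qed.

(** To be read with [h], [b], [z] twice the squared moduli of the estimated coefficient, the true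
    one and their difference; [- H k + p k] is then the criterion up to an additive constant. In
    each regime either the loss is comparable with that of [m], or the weight is exponentially
    small. *)
Let oracle_term k : (0 < k < n.+1)%N ->
  w k * loss k <= w k * (43 * beta + 18 * p m + 5 * Z m) + (k <= m)%:R * (4 / nR) +
    2 * Num.max 0 (Z k - t k) + 3 / nR * (k%:R ^+ 2)^-1.
Proof.
have bt0 := beta0; have nn0 := n0.
move=> kn; have pm := p0 mn1; have pk0 := p0 kn; have wk := w0 k; have wk1 := w_le1 kn.
have Zm : 0 <= Z m by exact: sum0.
have ex0 : 0 <= 2 * Num.max 0 (Z k - t k) by rewrite mulr_ge0// le_max lexx.
have q0 : 0 <= 3 / nR * (k%:R ^+ 2)^-1 by rewrite mulr_ge0 ?invr_ge0 ?sqr_ge0 ?divr_ge0// ltW.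
have [km|mk] := leqP k m.
  rewrite mul1r; suff : w k * loss k <= w k * (43 * beta + 18 * p m + 5 * Z m) + 4 / nR by lra.
  have ZkZm : Z k <= Z m by rewrite /Z (split_sum z km) lerDl; exact: sum0.
  have [->|km'] := eqVneq k m.
    have : w m * loss m <= w m * (43 * beta + 18 * p m + 5 * Z m).
      by apply: ler_wpM2l => //; have := loss_large (leqnn m); lra.
    have : 0 <= 4 / nR by rewrite divr_ge0// ltW.
    by lra.
  have {}km' : (0 < k < m)%N by case/andP: kn => -> _; rewrite /= ltn_neqAle km' km.
  set D := \sum_(k.+1 <= j < m.+1) b j.
  have D0 : 0 <= D by exact: sum0.
  have lk : w k * loss k <= w k * (Z m + beta) + w k * D.
    by rewrite -mulrDr ler_wpM2l//; have := loss_small km'; rewrite -/D; lra.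
  suff : w k * D <= w k * (4 * (p m + Z m)) + 4 / nR.
    have : 0 <= w k * (42 * beta + 14 * p m) by rewrite mulr_ge0// addr_ge0 ?mulr_ge0.
    lra.
  (* If the missing bias [D] exceeds [4 (p m + Z m)], the criterion gap [D/2 - Z m - p m] is at
     least [D/4], and [D exp(- n D / 4) <= 4 / n]. *)
  have [Dle|Dgt] := leP D (4 * (p m + Z m)).
    by rewrite (le_trans (ler_wpM2l wk Dle))// lerDl divr_ge0// ltW.
  have HD : D / 2 - Z m <= H m - H k.
    rewrite /H (split_sum h km) addrAC subrr add0r /Z (split_sum z km).
    have : \sum_(k.+1 <= j < m.+1) (b j / 2 - z j) <= \sum_(k.+1 <= j < m.+1) h j.
      by apply: ler_sum => j _.
    by rewrite sumrB -mulr_suml -/D; have := @sum0 z 1 k.+1 z0; lra.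
  have wkD : w k <= expR (- (nR * D / 4)).
    apply: (le_trans (wexp kn)); rewrite ler_expR lerN2 -mulrA ler_pM2l//; lra.
  apply: (@le_trans _ _ (4 / nR)).
    apply: (le_trans (ler_wpM2r D0 wkD)); rewrite mulrC.
    have := mulr_expN_le (nR * D / 4) => h1.
    by rewrite ler_pdivlMr//; lra.
  by rewrite lerDr mulr_ge0// mulr_ge0// addr_ge0.
rewrite mul0r addr0; have lk : w k * loss k <= w k * beta + w k * Z k.
  by rewrite -mulrDr ler_wpM2l//; have := loss_large (ltnW mk); lra.
have c0 : 0 <= w k * (4 * p m + 5 * Z m) by rewrite mulr_ge0// addr_ge0// mulr_ge0.
suff : w k * Z k <= 14 * (w k * (3 * beta + p m)) + 2 * Num.max 0 (Z k - t k) + 3 / nR * (k%:R ^+ 2)^-1.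
  by lra.
have d0 : 0 <= 14 * (w k * (3 * beta + p m)) by rewrite !mulr_ge0// addr_ge0// mulr_ge0.
have Zk : 0 <= Z k by exact: sum0.
have [Zbig|Zle] := ltP (2 * t k) (Z k).
  have : w k * Z k <= 2 * Num.max 0 (Z k - t k).
    apply: (@le_trans _ _ (Z k)); first by rewrite ler_piMl.
    apply: (@le_trans _ _ (2 * (Z k - t k))); first lra.
    by rewrite ler_pM2l// le_max lexx orbT.
  by lra.
have ptk := pt kn.
have Hd : H k - H m <= 6 / 7 * p k + 3 * beta.
  rewrite /H (split_sum h (ltnW mk)) addrAC subrr add0r.
  have : \sum_(m.+1 <= j < k.+1) h j <= \sum_(m.+1 <= j < k.+1) (3 / 2 * z j + 3 * b j).
    by apply: ler_sum => j _.
  rewrite big_split/= -!mulr_sumr; have := tailb (ltnW mk).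
  have : \sum_(m.+1 <= j < k.+1) z j <= Z k by rewrite /Z (split_sum z (ltnW mk)) lerDr; exact: sum0.
  by lra.
(* The gap is at least [p k / 7 - (p m + 3 beta)]; a penalty above the cut leaves [p k / 14]. *)
have [ple|pgt] := leP (p k) (14 * (3 * beta + p m)).
  have : w k * Z k <= w k * (14 * (3 * beta + p m)) by rewrite ler_wpM2l//; have := t0 k; lra.
  by lra.
have pp : 0 < p k by apply: le_lt_trans pgt; rewrite mulr_ge0// addr_ge0// mulr_ge0.
(* [p k >= 84 k / n] gives [x >= 6 k], so [x exp(-x) <= 6 / x^2] yields the summable [k^-2]. *)
pose x := nR * p k / 14.
have x6 : 6 * k%:R <= x.
  have := pk kn; rewrite ler_pdivrMr// => h1; rewrite /x ler_pdivlMr//; lra.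
have kR : (0 : R) < k%:R by rewrite ltr0n; case/andP: kn.
have x0 : 0 < x by rewrite (lt_le_trans _ x6)// mulr_gt0.
have wkx : w k <= expR (- x).
  apply: (le_trans (wexp kn)); rewrite ler_expR lerN2 /x -mulrA ler_pM2l//; lra.
have : w k * Z k <= 3 / nR * (k%:R ^+ 2)^-1.
  apply: (@le_trans _ _ (expR (- x) * p k)).
    by apply: ler_pM => //; have := t0 k; lra.
  have -> : expR (- x) * p k = 14 / nR * (x * expR (- x)).
    by rewrite /x; field; exact: lt0r_neq0.
  apply: (@le_trans _ _ (14 / nR * (6 / x ^+ 2))).
    by rewrite ler_wpM2l ?divr_ge0 ?(ltW n0)//; exact: mulr_expN_le_sqr.
  have -> : 3 / nR * (k%:R ^+ 2)^-1 = 14 / nR * (3 / 14 * (k%:R ^+ 2)^-1).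
    by field; rewrite !lt0r_neq0.
  rewrite ler_wpM2l ?divr_ge0 ?(ltW n0)//.
  apply: (@le_trans _ _ (6 * ((6 * k%:R) ^+ 2)^-1)).
    rewrite ler_wpM2l// lef_pV2 ?posrE ?exprn_gt0 ?mulr_gt0//.
    by rewrite ler_sqr ?nnegrE ?(ltW x0)// mulr_ge0// ltW.
  rewrite exprMn invfM mulrA ler_wpM2r ?invr_ge0 ?sqr_ge0//; lra.
by lra.
Qed.

(** The weights sum to 1, at most [m] indices pay [4 / n], and the inverse squares sum to at most 2.
    Replacing [5 Z m] by [5 (p m + X)] turns the coefficients 18 and 2 into 23 and 7. *)
Lemma oracle_inequality :
  \sum_(1 <= k < n.+1) w k * loss k <= 43 * beta + 23 * p m + 4 * m%:R / nR + 6 / nR +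
    7 * \sum_(1 <= k < n.+1) Num.max 0 (Z k - t k).
Proof.
set X := \sum_(1 <= k < n.+1) Num.max 0 (Z k - t k).
have bt0 := beta0; have nn0 := n0.
have := @ler_sum_nat R 1 n.+1 _ _ oracle_term.
rewrite !big_split/= -!mulr_suml w1 -!mulr_sumr mul1r -/X => Hs.
have Zm : Z m <= p m + X.
  have : Num.max 0 (Z m - t m) <= X.
    rewrite /X (bigD1_seq m) ?mem_index_iota ?iota_uniq//= lerDl.
    by apply: sumr_ge0 => k _; rewrite le_max lexx.
  have : Z m - t m <= Num.max 0 (Z m - t m) by rewrite le_max lexx orbT.
  by have := pt mn1; have := t0 m; lra.
have cnt : \sum_(1 <= k < n.+1) ((k <= m)%:R : R) = m%:R.
  rewrite (big_cat_nat (n := m.+1))//= ?ltnS//.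
  rewrite big_nat (eq_bigr (fun=> 1)); last by move=> k; rewrite ltnS => /andP[_ ->].
  rewrite -big_nat big_const_nat iter_addr_0 subSS subn0.
  rewrite [X in _ + X]big_nat big1 ?addr0// => k /andP[mk _].
  by rewrite leqNgt mk.
have S2 := @sum_inv_sqr R n.
have : 3 / nR * \sum_(1 <= k < n.+1) ((k%:R : R) ^+ 2)^-1 <= 6 / nR.
  by have := ler_wpM2l (_ : 0 <= 3 / nR) S2; rewrite divr_ge0 ?(ltW n0)// => /(_ isT); lra.
move: Hs; rewrite cnt; lra.
Qed.

End oracle.

(** * Growth of the penalty sequences *)

(** [exp(1/6) <= 6/5] and [(6/5)^6 < 3]. This serves to get [log(k + 2) >= 1] for [k >= 1]. *)
Lemma expR1_le3 (R : realType) : expR (1 : R) <= 3.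
Proof.
have h : expR (6^-1 : R) <= 6 / 5.
  have := expR_ge1Dx (- 6^-1 : R); rewrite expRN => h.
  rewrite -[leLHS]invrK -[leRHS]invrK lef_pV2 ?posrE ?invr_gt0 ?expR_gt0//; lra.
have -> : expR (1 : R) = expR (6^-1) ^+ 6.
  by rewrite -expRM_natl; congr expR; field.
rewrite (le_trans (lerXn2r 6 _ _ h)) ?nnegrE ?expR_ge0 ?divr_ge0//.
lra.
Qed.

Section sequence_estimates.
Context {R : realType}.
Implicit Types u v s : nat -> R.

Lemma runmax_ge u k j : (j <= k)%N -> u j <= runmax u k.
Proof. by move=> jk; apply: le_bigmax_seq; rewrite ?mem_index_iota. Qed.

Lemma runmax_le u k c : (forall j, (j <= k)%N -> u j <= c) -> runmax u k <= c.
Proof.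
move=> uc; rewrite /runmax big_nat; apply: bigmax_le => [|j]; first exact: uc.
by rewrite ltnS => /andP[_]; exact: uc.
Qed.

Let logmax u k : R := ln (Num.max (k%:R * runmax u k) k.+2%:R).

Let ln2_gt0 k : 0 < ln (k.+2%:R : R).
Proof. by rewrite ln_gt0// ltr1n. Qed.

Let max_gt0 u k : 0 < Num.max (k%:R * runmax u k) k.+2%:R :> R.
Proof. by rewrite lt_max ltr0n orbT. Qed.

Let logmax_ge u k : ln (k.+2%:R : R) <= logmax u k.
Proof. by rewrite ler_ln ?posrE// le_max lexx orbT. Qed.

Let lamE u k : lam u k = (logmax u k / ln (k.+2%:R : R)) ^+ 2.
Proof.
rewrite /lam -/(logmax u k) expr_div_n !ger0_norm//; first exact: ltW.
by rewrite (le_trans _ (logmax_ge u k))// ltW.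
Qed.

Lemma lam_ge1 u k : 1 <= lam u k.
Proof.
by rewrite lamE exprn_ege1// ler_pdivlMr// mul1r.
Qed.

Lemma mul_runmax_le_expR u k :
  k%:R * runmax u k <= expR (Num.sqrt (lam u k) * ln (k.+2%:R : R)).
Proof.
rewrite lamE sqrtr_sqr ger0_norm; last first.
  by rewrite divr_ge0// ?(le_trans _ (logmax_ge u k))// ltW.
by rewrite divfK ?lt0r_neq0// lnK ?posrE// le_max lexx.
Qed.

(** The running maximum costs a factor [d]. In the logarithm [d] is additive, and
    [log d + l <= (1 + log d) l] for [l >= 1]; squaring gives the other factor of [zeta d]. *)
Lemma Lam_le_zeta v s d k : (0 < k)%N -> 1 <= d -> (forall j, 0 <= v j <= d * s j) ->
  Lam v k <= zeta d * Lam s k.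
Proof.
move=> k0 d1 vds; have d0 : 0 < d by exact: lt_le_trans d1.
have rv : runmax v k <= d * runmax s k.
  apply: runmax_le => j jk; have /andP[_ /le_trans] := vds j; apply.
  by rewrite ler_pM2l// runmax_ge.
have rv0 : 0 <= runmax v k.
  by have /andP[h _] := vds 0%N; rewrite (le_trans h)// runmax_ge.
rewrite /Lam /zeta (_ : _ * (1 + _) ^+ 2 * _ = ((1 + ln d) ^+ 2 * lam s k) * (d * runmax s k)); last by ring.
apply: ler_pM => //; first by rewrite (le_trans _ (lam_ge1 v k)).
rewrite !lamE -exprMn.
have lnd : 0 <= ln d by exact: ln_ge0.
have l1 : 1 <= logmax s k.
  apply: le_trans (logmax_ge s k); rewrite -[leLHS]expRK ler_ln ?posrE ?expR_gt0//.
  by rewrite (le_trans (expR1_le3 R))// ler_nat.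
have i0 : 0 <= (ln (k.+2%:R : R))^-1 by rewrite invr_ge0 ltW.
have lv0 : 0 <= logmax v k by rewrite (le_trans _ (logmax_ge v k))// ltW.
have ls0 : 0 <= logmax s k by exact: le_trans l1.
rewrite lerXn2r ?nnegrE ?mulr_ge0 ?addr_ge0//.
rewrite mulrA ler_pM2r ?invr_gt0//.
apply: (@le_trans _ _ (ln d + logmax s k)); last first.
  by have := mulr_ge0 lnd (_ : 0 <= logmax s k - 1); rewrite subr_ge0 l1 => /(_ isT); lra.
rewrite -lnM ?posrE// ler_ln ?posrE ?mulr_gt0// ge_max; apply/andP; split.
  apply: (@le_trans _ _ (d * (k%:R * runmax s k))); first by rewrite mulrCA ler_wpM2l.
  by rewrite ler_pM2l// le_max lexx.
apply: (@le_trans _ _ (d * k.+2%:R)); first by rewrite ler_peMl.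
by rewrite ler_pM2l// le_max lexx orbT.
Qed.

Let rem v k : R :=
  runmax v k * (8 + 16 * Num.sqrt (k%:R * lam v k)) * expR (- (2^-1 * Num.sqrt (k%:R * lam v k))).

Let sqrt_klam v k : (0 < k)%N -> 1 <= Num.sqrt (k%:R * lam v k).
Proof.
move=> k0; rewrite -[leLHS]sqrtr1 ler_wsqrtr//.
by rewrite mulr_ege1 ?ler1n// lam_ge1.
Qed.

Let rem_le v k : (0 < k)%N -> 0 <= runmax v k -> rem v k <= 48 * runmax v k.
Proof.
move=> k0 v0; rewrite /rem; set x := Num.sqrt _; have x1 : 1 <= x by exact: sqrt_klam.
rewrite -mulrA mulrC ler_wpM2r//.
apply: (@le_trans _ _ (24 * x * expR (- (2^-1 * x)))); first by rewrite ler_wpM2r ?expR_ge0//; lra.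
by have := mulr_expN_le (2^-1 * x); lra.
Qed.

(** The threshold on [k] ensures [k + 2 <= 1 + y^4 / 4!] with [y = sqrt(k) / 4], hence
    [log(k + 2) <= sqrt(k) / 4] and [v_(k) <= exp(x / 4)]. What remains is [24 x exp(- x / 4)],
    bounded via [(x/4)^5 / 5! <= exp(x / 4)] and [x^4 >= k^2]. *)
Let rem_le_large v k : 16 * 400 <= (k%:R : R) -> 0 <= runmax v k ->
  rem v k <= 96 * 120 * 256 * (k%:R ^+ 2)^-1.
Proof.
move=> k6 v0; rewrite /rem; set x := Num.sqrt _.
have k0 : (0 < k)%N by rewrite -(ltr0n R); lra.
have kR : 0 < k%:R :> R by rewrite ltr0n.
have x1 : 1 <= x by exact: sqrt_klam.
have l1 := lam_ge1 v k.
have vx : runmax v k <= expR (x / 4).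
  apply: (@le_trans _ _ (k%:R * runmax v k)); first by rewrite ler_peMl// ler1n.
  apply: (le_trans (mul_runmax_le_expR v k)); rewrite ler_expR.
  have xE : x = Num.sqrt (lam v k) * Num.sqrt k%:R by rewrite mulrC -sqrtrM.
  rewrite xE -mulrA ler_wpM2l ?sqrtr_ge0//.
  rewrite -[leRHS]expRK ler_ln ?posrE ?expR_gt0//.
  have y0 : 0 <= Num.sqrt (k%:R : R) / 4 by rewrite divr_ge0 ?sqrtr_ge0.
  apply: le_trans (expR_ge1Dxn 3 y0).
  have -> : (Num.sqrt (k%:R : R) / 4) ^+ 4 = k%:R ^+ 2 / 256.
    rewrite expr_div_n; congr (_ / _); last by ring.
    by rewrite -[in RHS](sqr_sqrtr (ltW kR)) -exprM.
  rewrite -[k.+2]addn2 natrD !factS fact0.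
  have : 16 * 400 * k%:R <= k%:R ^+ 2 :> R by rewrite expr2 ler_pM2r.
  lra.
apply: (@le_trans _ _ (expR (x / 4) * (24 * x) * expR (- (2^-1 * x)))).
  by rewrite ler_wpM2r ?expR_ge0// ler_pM//; lra.
have -> : expR (x / 4) * (24 * x) * expR (- (2^-1 * x)) = 24 * x * expR (- (x / 4)).
  rewrite mulrAC -expRD mulrC; congr (_ * expR _); lra.
rewrite expRN ler_pdivrMr ?expR_gt0// mulrAC ler_pdivlMr ?exprn_gt0//.
have y0 : 0 <= x / 4 by lra.
have := expR_ge1Dxn 4 y0; rewrite !factS fact0 => h.
have : k%:R ^+ 2 <= x ^+ 4.
  have -> : x ^+ 4 = (x ^+ 2) ^+ 2 by ring.
  rewrite sqr_sqrtr; last by rewrite mulr_ge0// (le_trans _ l1).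
  by rewrite lerXn2r ?nnegrE ?mulr_ge0// ?ler_pMr ?(le_trans _ l1)// ltW.
have x0 : 0 <= x by lra.
move=> /(ler_wpM2l x0); rewrite expr_div_n in h.
rewrite (_ : (4 : R) ^+ 5 = 1024) in h; last by ring.
rewrite -exprS.
lra.
Qed.

(** [K] precedes [v] and [n]: the finitely many small [k] are controlled through the envelope
    [d * s], the large ones by a bound free of [v]. *)
Lemma noise_remainder_bounded s d : exists K : R, forall v n, (forall j, 0 <= v j <= d * s j) ->
  \sum_(1 <= k < n.+1) runmax v k * (8 + 16 * Num.sqrt (k%:R * lam v k)) *
    expR (- (2^-1 * Num.sqrt (k%:R * lam v k))) <= K.
Proof.
have [k0 k0P] : exists k0 : nat, 16 * 400 <= (k0%:R : R).
  by exists (Num.bound (16 * 400 : R)); apply/ltW/archi_boundP; do !apply: mulr_ge0; exact: ler0n.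
have [c c0 large] : exists2 c : R, 0 <= c & forall v k, 16 * 400 <= (k%:R : R) -> 0 <= runmax v k ->
    rem v k <= c * (k%:R ^+ 2)^-1.
  by exists (96 * 120 * 256) => [|v k]; [do !apply: mulr_ge0; exact: ler0n|exact: rem_le_large].
pose S := runmax (fun j => d * s j) k0.
exists (k0%:R * (48 * S) + c * 2) => v n vds.
have v0 k : 0 <= runmax v k.
  by have /andP[h _] := vds 0%N; rewrite (le_trans h)// runmax_ge.
have S0 : 0 <= S.
  have /andP[h1 h2] := vds 0%N; rewrite (le_trans h1)// (le_trans h2)//.
  exact: (runmax_ge (fun j => d * s j)).
apply: (@le_trans _ _ (\sum_(1 <= k < n.+1) ((k < k0)%:R * (48 * S) + c * (k%:R ^+ 2)^-1))).
  apply: ler_sum_nat => k /andP[kp _]; rewrite -/(rem v k).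
  have [kk|kk] := ltnP k k0.
    rewrite mul1r; apply: (@le_trans _ _ (48 * S)); last first.
      by rewrite lerDl mulr_ge0// invr_ge0 sqr_ge0.
    apply: (le_trans (rem_le kp (v0 k))); rewrite ler_pM2l//.
    apply: runmax_le => j jk; have /andP[_ /le_trans] := vds j; apply.
    by apply: (runmax_ge (fun j => d * s j)); rewrite (leq_trans jk)// ltnW.
  rewrite mul0r add0r; apply: large => //.
  by rewrite (le_trans k0P)// ler_nat.
rewrite big_split/= -mulr_suml -mulr_sumr; apply: lerD; last first.
  by rewrite ler_wpM2l//; exact: sum_inv_sqr.
rewrite ler_wpM2r ?mulr_ge0//.
have -> : \sum_(1 <= k < n.+1) ((k < k0)%:R : R) = (\sum_(1 <= k < n.+1) (k < k0))%N%:R by rewrite natr_sum.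
rewrite ler_nat.
suff : (\sum_(1 <= k < n.+1) (k < k0) <= minn n k0)%N by rewrite leq_min => /andP[].
elim: n => [|n IH]; first by rewrite big_geq.
rewrite big_nat_recr//= (leq_trans (leq_add IH (leqnn _)))// leq_min.
have [h|h] := ltnP n.+1 k0; rewrite /= ?addn1 ?addn0.
  by rewrite ltnS geq_minl (leq_ltn_trans (geq_minl _ _))// (ltn_trans _ h).
by rewrite geq_minr andbT (leq_trans (geq_minl _ _)).
Qed.

End sequence_estimates.

(** * Estimators and losses *)

Section estimator_as_trigpoly.
Context {R : realType}.
Local Notation mu := (@lebesgue_measure R).
Implicit Types (a b : nat -> R) (z : R[i]).

Lemma cabsM z z' : cabs (z * z') = cabs z * cabs z'.
Proof. exact: ComplexField.Normc.normcM. Qed.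

Lemma cabsV z : cabs z^-1 = (cabs z)^-1.
Proof. exact: ComplexField.Normc.normcV. Qed.

Lemma sum_Complex (I : Type) (r : seq I) (a b : I -> R) :
  \sum_(i <- r) Complex (a i) (b i) = Complex (\sum_(i <- r) a i) (\sum_(i <- r) b i).
Proof.
by elim: r => [|i r IH]; rewrite ?big_nil// !big_cons IH.
Qed.

Lemma Complex_realM (x y : R) : Complex x 0 * Complex y 0 = Complex (x * y) 0.
Proof. by congr Complex; rewrite ?mul0r ?mulr0 ?subr0 ?addr0. Qed.

Lemma ebasis_nat j (x : R) : ebasis j%:Z x = Complex (cosn j x) (- sinn j x).
Proof. by rewrite /ebasis/= cosN sinN. Qed.

Lemma ebasis_oppn j (x : R) : ebasis (- j%:Z) x = conjc (ebasis j%:Z x).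
Proof.
rewrite ebasis_nat /ebasis/= rmorphN/= mulrN mulNr opprK opprK.
by congr Complex.
Qed.

Lemma normsq_real (p : R -> R) : mu.-integrable unitI (EFin \o (fun x => p x ^+ 2)) ->
  normsq (fun x => Complex (p x) 0) = (\int[mu]_(x in unitI) (p x ^+ 2))%:E.
Proof.
move=> ip; rewrite /normsq -(EFin_Rintegral measurable_unitR ip).
by apply: eq_integral => x _; rewrite cabs_sqr/= expr0n/= addr0.
Qed.

Lemma Rintegral_density (p : R -> R) : density p -> \int[mu]_(x in unitI) p x = 1.
Proof. by case=> _ _ p1 _; rewrite /Rintegral p1. Qed.

Section ftilde.
Variables (n : nat) (phi : R -> R).
Hypotheses (n0 : (0 < n)%N) (dphi : density phi).
Implicit Type y : 'I_n -> R.

Definition fhat y (j : nat) : R[i] := (fcoef phi j%:Z)^-1 * ghat y j%:Z.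

Lemma ghat_nat y j : ghat y j%:Z =
  Complex (n%:R^-1 * \sum_(i < n) cosn j (y i)) (n%:R^-1 * \sum_(i < n) sinn j (y i)).
Proof.
rewrite /ghat (eq_bigr (fun i => Complex (cosn j (y i)) (sinn j (y i)))); last first.
  by move=> i _; rewrite /ebasis mulrN opprK.
rewrite sum_Complex.
have -> : (n%:R : R[i])^-1 = Complex (n%:R^-1) 0.
  rewrite -[n%:R in LHS](rmorph_nat (real_complex R)) -fmorphV//.
by congr Complex; rewrite mul0r ?subr0 ?addr0.
Qed.

Lemma ghat_oppn y j : ghat y (- j%:Z) = conjc (ghat y j%:Z).
Proof.
rewrite /ghat rmorphM rmorph_sum fmorphV rmorph_nat/=; congr (_ * _).
by apply: eq_bigr => i _; exact: ebasis_oppn.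
Qed.

Lemma fcoef_density0 (p : R -> R) : density p -> fcoef p 0%:Z = 1.
Proof.
move=> dp; rewrite fcoef_nat; congr Complex.
  by rewrite -(Rintegral_density dp); apply: eq_Rintegral => x _; rewrite cosn0 mulr1.
rewrite /sinfc; under eq_Rintegral do rewrite sinn0 mulr0.
by rewrite /Rintegral integral0.
Qed.

Lemma fhat0 y : fhat y 0 = 1.
Proof.
rewrite /fhat fcoef_density0// ghat_nat invr1 mul1r; congr Complex.
  under eq_bigr do rewrite cosn0.
  by rewrite sumr_const card_ord -mulr_natl mulr1 mulVf// pnatr_eq0 -lt0n.
by under eq_bigr do rewrite sinn0; rewrite big1// mulr0.
Qed.

(** [phi] and the data are real, so the terms at [j] and [-j] are conjugate and the complex-valued
    estimator is in fact real. *)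
Lemma ftildeE y k x : ftilde phi y k x =
  Complex (trigpoly k.+1 (fun j => complex.Re (fhat y j)) (fun j => complex.Im (fhat y j)) x) 0.
Proof.
rewrite /ftilde /trigpoly fhat0 ebasis_nat cosn0 sinn0 oppr0.
rewrite (eq_bigr (fun j => Complex (2 * (complex.Re (fhat y j) * cosn j x +
    complex.Im (fhat y j) * sinn j x)) 0)); last first.
  move=> j _; rewrite -/(fhat y j).
  have -> : fcoef phi (- j%:Z) = conjc (fcoef phi j%:Z).
    by rewrite fcoef_nat fcoef_oppn//; exact: integrable_density.
  rewrite ghat_oppn ebasis_oppn -conjc_inv -!rmorphM/= -/(fhat y j) ebasis_nat.
  by case: (fhat y j) => p q; congr Complex => /=; ring.
rewrite mulr_sumr sum_Complex; congr Complex.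
by rewrite big1// addr0.
Qed.

Lemma normsq_ftilde y k : normsq (ftilde phi y k) =
  (1 + \sum_(1 <= j < k.+1) 2 * cabs (fhat y j) ^+ 2)%:E.
Proof.
rewrite (funext (ftildeE y k)).
rewrite normsq_real; last first.
  under eq_fun do rewrite expr2; apply: integrable_mul_trigpoly; exact: integrable_trigpoly.
rewrite Rintegral_trigpoly_sqr fhat0/= expr1n mulr_sumr; congr (1 + _)%:E.
by apply: eq_bigr => j _; rewrite cabs_sqr.
Qed.

End ftilde.
End estimator_as_trigpoly.

Lemma sqr_weighted_mean_le (R : realFieldType) (I : Type) (r : seq I) (w u : I -> R) :
  (forall i, 0 <= w i) -> \sum_(i <- r) w i = 1 ->
  (\sum_(i <- r) w i * u i) ^+ 2 <= \sum_(i <- r) w i * u i ^+ 2.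
Proof.
move=> w0 w1; set c := \sum_(i <- r) w i * u i.
have : 0 <= \sum_(i <- r) w i * (u i - c) ^+ 2 by apply: sumr_ge0 => i _; rewrite mulr_ge0 ?sqr_ge0.
rewrite (eq_bigr (fun i => w i * u i ^+ 2 - 2 * c * (w i * u i) + c ^+ 2 * w i)); last by move=> i _; ring.
rewrite big_split/= sumrB -!mulr_sumr w1 -/c; nra.
Qed.

Section losses.
Context {R : realType}.
Local Notation mu := (@lebesgue_measure R).

Lemma integrable_density_sqr (p : R -> R) : density p ->
  mu.-integrable unitI (EFin \o (fun x => p x ^+ 2)).
Proof.
case=> mp _ _ p2; apply/integrableP; split.
  by apply/measurable_EFinP; exact: measurable_funX.
apply: le_lt_trans p2; rewrite le_eqVlt; apply/orP; left; apply/eqP.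
apply: eq_integral => x _.
by rewrite cabs_sqr/= expr0n addr0 ger0_norm// sqr_ge0.
Qed.

Lemma cabs_fcoef_nat_sqr (p : R -> R) j : cabs (fcoef p j%:Z) ^+ 2 = cosfc p j ^+ 2 + sinfc p j ^+ 2.
Proof. by rewrite cabs_sqr fcoef_nat. Qed.

Lemma integrable_sub_trigpoly_sqr N (a b : nat -> R) (p : R -> R) : density p ->
  mu.-integrable unitI (EFin \o (fun x => (trigpoly N a b x - p x) ^+ 2)).
Proof.
move=> dp; have ip := integrable_density dp; have ip2 := integrable_density_sqr dp.
have mI := @measurable_unitR R.
rewrite (_ : (fun x => _) = (fun x => trigpoly N a b x * trigpoly N a b x +
    (-2 * (p x * trigpoly N a b x) + p x ^+ 2))); last by apply/funext => x; ring.
apply: (integrable_add mI); first by apply: integrable_mul_trigpoly; exact: integrable_trigpoly.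
by apply: (integrable_add mI) => //; apply: (integrable_scale mI); exact: integrable_mul_trigpoly.
Qed.

Lemma Rintegral_sub_trigpoly_sqr N (a b : nat -> R) (p : R -> R) : density p -> a 0%N = 1 ->
  \int[mu]_(x in unitI) ((trigpoly N a b x - p x) ^+ 2) =
  \int[mu]_(x in unitI) (p x ^+ 2) - 1 - \sum_(1 <= j < N) 2 * (cosfc p j ^+ 2 + sinfc p j ^+ 2) +
  \sum_(1 <= j < N) 2 * ((a j - cosfc p j) ^+ 2 + (b j - sinfc p j) ^+ 2).
Proof.
move=> dp a0; have ip := integrable_density dp; have ip2 := integrable_density_sqr dp.
have mI := @measurable_unitR R.
have iT2 : mu.-integrable unitI (EFin \o (fun x => trigpoly N a b x ^+ 2)).
  by under eq_fun do rewrite expr2; apply: integrable_mul_trigpoly; exact: integrable_trigpoly.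
have ipT := integrable_mul_trigpoly N a b ip.
transitivity (\int[mu]_(x in unitI) (trigpoly N a b x ^+ 2 + (-2 * (p x * trigpoly N a b x) + p x ^+ 2))).
  by apply: eq_Rintegral => x _; ring.
have i1 := integrable_scale mI (-2) ipT.
rewrite RintegralD//; last exact: (integrable_add mI).
rewrite RintegralD// RintegralZl// Rintegral_trigpoly_sqr Rintegral_mul_trigpoly// Rintegral_density// a0.
rewrite (_ : \sum_(1 <= j < N) 2 * ((a j - _) ^+ 2 + _) =
   2 * \sum_(1 <= j < N) (a j ^+ 2 + b j ^+ 2) - 4 * \sum_(1 <= j < N) (a j * cosfc p j + b j * sinfc p j) +
   \sum_(1 <= j < N) 2 * (cosfc p j ^+ 2 + sinfc p j ^+ 2)); last first.
  by rewrite !mulr_sumr -sumrB -big_split/=; apply: eq_bigr => j _; ring.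
ring.
Qed.

(** Completeness of the trigonometric system enters here: bounds on finite tails of coefficients
    control the whole L^2 norm. *)
Lemma density_sqr_le_tail (p : R -> R) m beta : density p -> 0 <= beta ->
  (forall N, \sum_(m.+1 <= j < N) 2 * cabs (fcoef p j%:Z) ^+ 2 <= beta) ->
  \int[mu]_(x in unitI) (p x ^+ 2) <= 1 + \sum_(1 <= j < m.+1) 2 * cabs (fcoef p j%:Z) ^+ 2 + beta.
Proof.
move=> dp b0 tailb; have [mp _ _ _] := dp.
apply: parseval_le => //; [exact: integrable_density|exact: integrable_density_sqr|].
move=> N; rewrite Rintegral_density// expr1n -addrA lerD2l mulr_sumr.
under eq_bigr do rewrite -cabs_fcoef_nat_sqr.
have [Nm|mN] := leqP N m.+1.
  apply: (@le_trans _ _ (\sum_(1 <= j < m.+1) 2 * cabs (fcoef p j%:Z) ^+ 2)); last by rewrite lerDl.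
  have [N1|N1] := leqP N 1; first by rewrite big_geq// sumr_ge0// => j _; rewrite mulr_ge0 ?sqr_ge0.
  rewrite [leRHS](big_cat_nat (n := N))//=; last exact: ltnW.
  by rewrite lerDl; apply: sumr_ge0 => j _; rewrite mulr_ge0 ?sqr_ge0.
by rewrite (big_cat_nat (n := m.+1))//= ?lerD2l// ltnW.
Qed.

Variables (n : nat) (f phi : R -> R) (kappa : R).
Hypotheses (n0 : (0 < n)%N) (df : density f) (dphi : density phi) (kappa84 : 84 <= kappa).
Hypothesis phi_neq0 : forall j : nat, fcoef phi j%:Z != 0.
Implicit Type y : 'I_n -> R.

Definition gcoef (j : nat) : R[i] := fcoef f j%:Z * fcoef phi j%:Z.

Let loss y k := \int[mu]_(x in unitI) ((trigpoly k.+1 (fun j => complex.Re (fhat phi y j))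
  (fun j => complex.Im (fhat phi y j)) x - f x) ^+ 2).

Let integrable_loss y k : mu.-integrable unitI (EFin \o (fun x =>
  (trigpoly k.+1 (fun j => complex.Re (fhat phi y j))
  (fun j => complex.Im (fhat phi y j)) x - f x) ^+ 2)).
Proof.
exact: integrable_sub_trigpoly_sqr.
Qed.

Lemma normsq_agg_le (W : (nat -> R) -> nat -> R) y (w := W (crit kappa phi y)) :
  (forall k, 0 <= w k) -> \sum_(1 <= k < n.+1) w k = 1 ->
  (normsq (fun x => (ftilde_agg kappa phi W y x - ofreal f x)%R) <=
   (\sum_(1 <= k < n.+1) w k * loss y k)%:E)%E.
Proof.
move=> w0 w1; have mI := @measurable_unitR R.
pose F k x := w k * (trigpoly k.+1 (fun j => complex.Re (fhat phi y j))
  (fun j => complex.Im (fhat phi y j)) x - f x) ^+ 2.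
have iF k : mu.-integrable unitI (EFin \o F k) by apply: (integrable_scale mI); exact: integrable_loss.
have -> : \sum_(1 <= k < n.+1) w k * loss y k = \int[mu]_(x in unitI) (\sum_(1 <= k < n.+1) F k x).
  by rewrite (Rintegral_bigsum mI)//; apply: eq_bigr => k _; rewrite RintegralZl//; exact: integrable_loss.
rewrite -(EFin_Rintegral mI); last exact: (integrable_bigsum mI).
apply: ge0_le_integral_nonmeasurable => // x _; first by rewrite lee_fin sqr_ge0.
rewrite lee_fin /F -[leLHS]/(cabs _ ^+ 2).
pose u k := trigpoly k.+1 (fun j => complex.Re (fhat phi y j)) (fun j => complex.Im (fhat phi y j)) x.
have -> : ftilde_agg kappa phi W y x - ofreal f x = Complex (\sum_(1 <= k < n.+1) w k * (u k - f x)) 0.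
  rewrite /ftilde_agg (eq_bigr (fun k => Complex (w k * u k) 0)); last first.
    by move=> k _; rewrite (ftildeE n0 dphi) Complex_realM.
  under [in RHS]eq_bigr do rewrite mulrBr.
  rewrite sumrB -mulr_suml w1 mul1r sum_Complex; congr Complex.
  by rewrite /= big1// subr0.
by rewrite cabs_sqr/= expr0n addr0; apply: sqr_weighted_mean_le.
Qed.

Lemma fhat_sub_fcoef y j : cabs (fhat phi y j - fcoef f j%:Z) ^+ 2 =
  vseq phi j * cabs (ghat y j%:Z - gcoef j) ^+ 2.
Proof.
rewrite (_ : fhat phi y j - _ = (fcoef phi j%:Z)^-1 * (ghat y j%:Z - gcoef j)).
  by rewrite cabsM exprMn cabsV exprVn.
by rewrite /fhat /gcoef mulrBr (mulrC (fcoef f _)) mulKf.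
Qed.

Lemma vseq0 : vseq phi 0 = 1.
Proof.
by rewrite /vseq fcoef_density0// cabs_sqr/= expr0n addr0 expr1n invr1.
Qed.

Lemma vseq_ge0 j : 0 <= vseq phi j.
Proof. by rewrite invr_ge0 sqr_ge0. Qed.

Lemma Lam_vseq_ge1 k : 1 <= Lam (vseq phi) k.
Proof. by rewrite mulr_ege1 ?lam_ge1// -vseq0 runmax_ge. Qed.

(** The loss at cutoff [k] is exactly the energy of [f] beyond [k] plus the noise up to [k]; the
    first part is compared with [beta] by [density_sqr_le_tail]. *)
Lemma pathwise_risk_bound (W : (nat -> R) -> nat -> R) y m beta :
  admissible_weights n W -> (0 < m)%N -> (m <= n)%N ->
  (forall N, \sum_(m.+1 <= j < N) 2 * cabs (fcoef f j%:Z) ^+ 2 <= beta) ->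
  (normsq (fun x => (ftilde_agg kappa phi W y x - ofreal f x)%R) <=
   (43 * beta + 23 * pen n kappa phi m + 4 * m%:R / n%:R + 6 / n%:R +
    7 * \sum_(1 <= k < n.+1) Num.max 0
      (\sum_(1 <= j < k.+1) 2 * (vseq phi j * cabs (ghat y j%:Z - gcoef j) ^+ 2) -
       24 * k%:R * Lam (vseq phi) k / n%:R))%:E)%E.
Proof.
move=> adm m0 mn tailb.
have [w0 w1 wexp] := admissible_weightsP (crit kappa phi y) n0 adm.
apply: (le_trans (normsq_agg_le w0 w1)); rewrite lee_fin.
have nR : 0 < (n%:R : R) by rewrite ltr0n.
have L1 k := Lam_vseq_ge1 k; have k84 := kappa84.
have beta0 : 0 <= beta by have := tailb 0%N; rewrite big_geq.
pose h j := 2 * cabs (fhat phi y j) ^+ 2.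
pose b j := 2 * cabs (fcoef f j%:Z) ^+ 2.
have b0 j : 0 <= b j by rewrite mulr_ge0 ?sqr_ge0.
have kR k : 0 <= (k%:R / n%:R : R) by rewrite divr_ge0.
have Lk k : 1 * (k%:R / n%:R) <= Lam (vseq phi) k * (k%:R / n%:R) by rewrite ler_wpM2r.
have L0 k : 0 <= Lam (vseq phi) k * (k%:R / n%:R) by apply: le_trans (Lk k); rewrite mul1r.
have penE k : pen n kappa phi k = kappa * (Lam (vseq phi) k * (k%:R / n%:R)) by rewrite /pen; ring.
have zE j : 2 * (vseq phi j * cabs (ghat y j%:Z - gcoef j) ^+ 2) = 2 * cabs (fhat phi y j - fcoef f j%:Z) ^+ 2.
  by rewrite fhat_sub_fcoef.
have sq : \int[mu]_(x in unitI) (f x ^+ 2) <= 1 + \sum_(1 <= j < m.+1) b j + beta.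
  exact: density_sqr_le_tail df beta0 tailb.
have lossE k : loss y k = \int[mu]_(x in unitI) (f x ^+ 2) - 1 - \sum_(1 <= j < k.+1) b j +
    \sum_(1 <= j < k.+1) 2 * (vseq phi j * cabs (ghat y j%:Z - gcoef j) ^+ 2).
  rewrite /loss Rintegral_sub_trigpoly_sqr ?fhat0//; congr (_ - _ + _).
    by apply: eq_bigr => j _; rewrite /b cabs_fcoef_nat_sqr.
  apply: eq_bigr => j _; rewrite zE cabs_sqr fcoef_nat.
  by case: (fhat phi y j) => p q /=.
apply: (@oracle_inequality R n m (W (crit kappa phi y)) h b
  (fun j => 2 * (vseq phi j * cabs (ghat y j%:Z - gcoef j) ^+ 2))
  (fun k => 24 * k%:R * Lam (vseq phi) k / n%:R) (pen n kappa phi) (loss y) beta) => //.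
- move=> k kn; have := wexp k m kn; rewrite m0 ltnS mn => /(_ isT).
  rewrite /crit !normsq_ftilde//= => /le_trans; apply.
  rewrite ler_expR lerN2 ler_pM2l// -/(h _).
  by rewrite /h; lra.
- by move=> j; rewrite zE mulr_ge0 ?sqr_ge0.
(* For each real coordinate the difference of the two sides is, up to the common factor 2, half the
   square supplied as hint; the next condition uses its hints in the same way. *)
- move=> j; rewrite zE /h /b !cabs_sqr.
  case: (fhat phi y j) => p q; case: (fcoef f j%:Z) => p' q' /=.
  by have := sqr_ge0 (p - 3 * p'); have := sqr_ge0 (q - 3 * q'); nra.
- move=> j; rewrite zE /h /b !cabs_sqr.
  case: (fhat phi y j) => p q; case: (fcoef f j%:Z) => p' q' /=.
  by have := sqr_ge0 (2 * p - p'); have := sqr_ge0 (2 * q - q'); nra.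
- by move=> k; rewrite -mulrA; have := Lk k; have := kR k; nra.
(* [7/2 * 24 = 84] is where the lower bound on [kappa] comes from. *)
- move=> k kn; rewrite penE (_ : 24 * _ * _ / _ = 24 * (Lam (vseq phi) k * (k%:R / n%:R))); last by ring.
  by have := ler_wpM2r (L0 k) k84; lra.
- by move=> k kn; rewrite penE; have := ler_wpM2r (L0 k) k84; have := Lk k; lra.
- move=> k /andP[k0 km]; rewrite lossE; move: sq.
  by rewrite (big_cat_nat (n := k.+1))//= ?ltnS ?(ltnW km)//; lra.
- move=> k mk; rewrite lossE; move: sq.
  rewrite [X in _ - 1 - X](big_cat_nat (n := m.+1))//=.
  have : 0 <= \sum_(m.+1 <= j < k.+1) b j by exact: sumr_ge0.
  lra.
Qed.

End losses.

(** * Risk over the classes *)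

Lemma ge0_esum_int_ge (R : realType) (a : int -> \bar R) N : (forall j, 0 <= a j)%E ->
  (\sum_(0 <= m < N) a m%:Z <= \esum_(j in [set: int]) a j)%E.
Proof.
move=> a0; apply: esum_ge.
exists [set m%:Z | m in `I_N]; first by split=> //; apply: finite_image; exact: finite_II.
rewrite fsbig_image; last by move=> i j _ _ [].
by rewrite -(fsbig_ord _ N (fun i : nat => a i%:Z)) big_mkord.
Qed.

Section classes.
Context {R : realType}.
Implicit Types (ff s : nat -> R) (f phi : R -> R).

Lemma classF_sum ff r f N : (forall k, 0 < ff k) -> classF ff r f ->
  \sum_(0 <= m < N) cabs (fcoef f m%:Z) ^+ 2 / ff m <= r.
Proof.
move=> ff0 [_ fr]; rewrite -lee_fin -sumEFin; apply: le_trans fr.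
apply: (ge0_esum_int_ge (a := fun j => (cabs (fcoef f j) ^+ 2 / ff `|j|%N)%:E)).
by move=> j; rewrite lee_fin divr_ge0 ?sqr_ge0// ltW.
Qed.

(** Beyond [m] the weight [ff m / ff j] is at least 1. The class sum is bounded below by its
    non-negative frequencies alone, which accounts for the 2 on the right. *)
Lemma classF_tail ff r f m N : (forall k, 0 < ff k) -> nonincreasing_seq ff -> classF ff r f ->
  \sum_(m.+1 <= j < N) 2 * cabs (fcoef f j%:Z) ^+ 2 <= 2 * (r * ff m).
Proof.
move=> ff0 ffd fr; rewrite -mulr_sumr ler_pM2l//.
apply: (@le_trans _ _ (\sum_(m.+1 <= j < N) cabs (fcoef f j%:Z) ^+ 2 / ff j * ff m)).
  apply: ler_sum_nat => j /andP[mj _]; rewrite -mulrA ler_peMr ?sqr_ge0//.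
  by rewrite mulrC ler_pdivlMr// mul1r ffd// ltnW.
rewrite -mulr_suml ler_pM2r//; apply: le_trans (classF_sum N ff0 fr).
have t0 j : 0 <= cabs (fcoef f j%:Z) ^+ 2 / ff j by rewrite divr_ge0 ?sqr_ge0// ltW.
have [Nm|mN] := leqP N m.+1; first by rewrite big_geq//; apply: sumr_ge0 => j _; exact: t0.
by rewrite [leRHS](big_cat_nat (leq0n _) (ltnW mN))/= lerDr; apply: sumr_ge0 => j _; exact: t0.
Qed.

Variables (s : nat -> R) (d : R) (phi : R -> R).
Hypotheses (s0 : forall k, 0 < s k) (d1 : 1 <= d) (phis : classE s d phi).

Let phi_sqr_gt0 (j : nat) : 0 < cabs (fcoef phi j%:Z) ^+ 2.
Proof.
have [_ /(_ j%:Z) /andP[h _]] := phis; rewrite -(pmulr_rgt0 _ (s0 j)).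
by rewrite (lt_le_trans _ h)// invr_gt0 (lt_le_trans _ d1).
Qed.

Lemma classE_fcoef_neq0 (j : nat) : fcoef phi j%:Z != 0.
Proof.
apply/eqP => E; have := phi_sqr_gt0 j.
by rewrite E cabs_sqr/= expr0n addr0 ltxx.
Qed.

Lemma classE_vseq j : 0 <= vseq phi j <= d * s j.
Proof.
rewrite invr_ge0 sqr_ge0/=; have [_ /(_ j%:Z) /andP[+ _]] := phis.
have d0 : 0 < d by exact: lt_le_trans d1.
rewrite -div1r ler_pdivrMr// => h.
by rewrite /vseq -div1r ler_pdivrMr//; nra.
Qed.

Lemma classE_fcoef_le (j : nat) : cabs (fcoef phi j%:Z) ^+ 2 <= d / s j.
Proof.
by rewrite ler_pdivlMr// mulrC; have [_ /(_ j%:Z) /andP[_]] := phis.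
Qed.

Lemma gcoef_sum_le ff r f N : (forall k, 0 < ff k) -> classF ff r f ->
  (l1norm (fun k => (ff k / s k)%R) < +oo)%E ->
  \sum_(0 <= m < N) (`|complex.Re (gcoef f phi m)| + `|complex.Im (gcoef f phi m)|) <=
  r + d * fine (l1norm (fun k => ff k / s k)).
Proof.
move=> ff0 fr l1; have d0 : 0 < d by exact: lt_le_trans d1.
apply: (@le_trans _ _ (\sum_(0 <= m < N) (cabs (fcoef f m%:Z) ^+ 2 / ff m + d * (ff m / s m)))).
  (* The crude factor 2 for the real and imaginary parts is exactly the one available in
     [2 x y <= x^2 / ff + ff y^2]. *)
  apply: ler_sum => m _; apply: (@le_trans _ _ (2 * cabs (gcoef f phi m))).
    have := cabs_sqr (gcoef f phi m); have := cabs_ge0 (gcoef f phi m).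
    set c := cabs _; set p := complex.Re _; set q := complex.Im _ => c0 cE.
    have h (u v : R) : c ^+ 2 = u ^+ 2 + v ^+ 2 -> `|u| <= c.
      by move=> E; rewrite -ler_sqr ?nnegrE// real_normK ?num_real// E lerDl sqr_ge0.
    have := h p q cE; have := h q p; rewrite addrC => /(_ cE); lra.
  rewrite /gcoef cabsM.
  set x := cabs (fcoef f _); set y := cabs (fcoef phi _).
  have y2 : ff m * y ^+ 2 <= d * (ff m / s m) by rewrite [leRHS]mulrCA ler_pM2l//; exact: classE_fcoef_le.
  suff : 2 * (x * y) - ff m * y ^+ 2 <= x ^+ 2 / ff m by lra.
  rewrite ler_pdivlMr//; have := sqr_ge0 (x - ff m * y).
  rewrite sqrrB exprMn; have := ff0 m; nra.
rewrite big_split/= -mulr_sumr; apply: lerD; first exact: classF_sum.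
rewrite ler_pM2l// -lee_fin fineK; last first.
  rewrite ge0_fin_numE// /l1norm; exact: nneseries_ge0.
rewrite -sumEFin /l1norm; apply: le_trans (nneseries_lim_ge N _) => //.
by apply: lee_sum => k _; rewrite lee_fin ler_norm.
Qed.

End classes.

Section expected_noise.
Context {R : realType} d (T : measurableType d) (P : probability T R).
Variables (n : nat) (f phi : R -> R) (Y : 'I_n -> {RV P >-> R}) (M : R).
Hypotheses (n0 : (0 < n)%N) (df : density f) (dphi : density phi).
Hypothesis iidY : iid_sample Y (cconv f phi).
Hypothesis GM : forall N,
  \sum_(0 <= m < N) (`|complex.Re (gcoef f phi m)| + `|complex.Im (gcoef f phi m)|) <= M.
Let v := vseq phi.

(** [noise_excess] rescaled by [2 / n^2], which undoes the sum over observations and counts both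
    signs of [j]; the level [12 n k v_(k) lambda] becomes [24 k Lambda_k / n]. *)
Lemma expected_noise_excess k : (0 < k < n.+1)%N -> exists2 B : T -> R, bounded_rv B &
  (forall w, Num.max 0 (\sum_(1 <= j < k.+1) 2 * (v j *
      cabs (ghat (fun i => Y i w) j%:Z - gcoef f phi j) ^+ 2) - 24 * k%:R * Lam v k / n%:R) <= B w) /\
  \int[P]_w B w <= 2 / n%:R * expR (3 / 2 * M) * (runmax v k * (8 + 16 * Num.sqrt (k%:R * lam v k)) *
    expR (- (2^-1 * Num.sqrt (k%:R * lam v k)))).
Proof.
move=> /andP[k0 kn]; have [indep dY] := iidY.
pose e b j := if b then complex.Re (gcoef f phi j) else complex.Im (gcoef f phi j).
have Ee b j i : \int[P]_w trig b j (Y i w) = e b j.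
  rewrite /trig /e /gcoef !fcoef_nat; case: b => /=.
    exact: expectation_cosn.
  by rewrite (expectation_sinn df dphi (dY i)) addrC.
have vk1 : 1 <= runmax v k by rewrite -(vseq0 dphi) runmax_ge.
have vk0 : 0 < runmax v k by exact: lt_le_trans vk1.
have nR : 0 < n%:R :> R by rewrite ltr0n.
have [B bB [HB EB]] := noise_excess indep Ee (GM (2 * k).+1) (@vseq_ge0 _ phi)
  (fun j => @runmax_ge _ v k j) k0 kn (lam_ge1 v k) vk0.
have c0 : 0 <= 2 / n%:R ^+ 2 :> R by rewrite divr_ge0 ?sqr_ge0.
exists (fun w => 2 / n%:R ^+ 2 * B w); first by apply: bounded_rvM => //; exact: bounded_rv_cst.
split.
  move=> w; apply: le_trans (ler_wpM2l c0 (HB w)).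
  rewrite maxr_pMr// mulr0 mulrBr le_eqVlt; apply/orP; left; apply/eqP; congr (Num.max 0 (_ - _)).
    rewrite mulr_sumr; apply: eq_bigr => j _.
    rewrite ghat_nat cabs_sqr /e.
    rewrite -/v; move: (\sum_(i < n) cosn _ _) (\sum_(i < n) sinn _ _) (v j) => c s vj.
    by case: (gcoef f phi j) => p q /=; field; exact: lt0r_neq0.
  by rewrite /Lam; field; exact: lt0r_neq0.
rewrite expectationZ_bounded//; apply: le_trans (ler_wpM2l c0 EB) _.
rewrite expRD -subr_ge0 le_eqVlt; apply/orP; left; apply/eqP.
by field; exact: lt0r_neq0.
Qed.

Variables (kappa : R) (W : (nat -> R) -> nat -> R).
Hypotheses (kappa84 : 84 <= kappa) (adm : admissible_weights n W).
Hypothesis phi_neq0 : forall j : nat, fcoef phi j%:Z != 0.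

Lemma expected_risk_bound m beta K : (0 < m)%N -> (m <= n)%N ->
  (forall N, \sum_(m.+1 <= j < N) 2 * cabs (fcoef f j%:Z) ^+ 2 <= beta) ->
  \sum_(1 <= k < n.+1) runmax v k * (8 + 16 * Num.sqrt (k%:R * lam v k)) *
    expR (- (2^-1 * Num.sqrt (k%:R * lam v k))) <= K ->
  (\int[P]_w normsq (fun x =>
     (ftilde_agg kappa phi W (fun i => Y i w) x - ofreal f x)%R) <=
   (43 * beta + 23 * pen n kappa phi m + 4 * m%:R / n%:R +
     (6 + 14 * expR (3 / 2 * M) * K) / n%:R)%:E)%E.
Proof.
move=> m0 mn tailb vK.
have nR : 0 < n%:R :> R by rewrite ltr0n.
pose Q k (Bk : T -> R) := bounded_rv Bk /\ ((0 < k < n.+1)%N ->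
  (forall w, Num.max 0 (\sum_(1 <= j < k.+1) 2 * (v j *
      cabs (ghat (fun i => Y i w) j%:Z - gcoef f phi j) ^+ 2) - 24 * k%:R * Lam v k / n%:R) <= Bk w) /\
  \int[P]_w Bk w <= 2 / n%:R * expR (3 / 2 * M) * (runmax v k * (8 + 16 * Num.sqrt (k%:R * lam v k)) *
    expR (- (2^-1 * Num.sqrt (k%:R * lam v k))))).
have /choice[B HB] : forall k, exists Bk, Q k Bk.
  move=> k.
  have [kn|kn] := boolP (0 < k < n.+1)%N; last by exists (cst 0); split; [exact: bounded_rv_cst|rewrite (negbTE kn)].
  by have [Bk bBk HBk] := expected_noise_excess kn; exists Bk.
have bB k : bounded_rv (B k) by have [] := HB k.
set A := 43 * beta + 23 * pen n kappa phi m + 4 * m%:R / n%:R.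
have bS : bounded_rv (fun w => \sum_(1 <= k < n.+1) B k w) by exact: bounded_rv_sum.
have bS7 : bounded_rv (fun w => 7 * \sum_(1 <= k < n.+1) B k w).
  by apply: bounded_rvM => //; exact: bounded_rv_cst.
have bF : bounded_rv (fun w => A + 6 / n%:R + 7 * \sum_(1 <= k < n.+1) B k w).
  by apply: bounded_rvD => //; exact: bounded_rv_cst.
(* The pathwise bound moves the expectation onto bounded measurable variables, where linearity is
   available. *)
apply: (@le_trans _ _ (\int[P]_w (A + 6 / n%:R + 7 * \sum_(1 <= k < n.+1) B k w)%:E)%E).
  apply: ge0_le_integral_nonmeasurable => // w _.
    by apply: integral_ge0 => x _; rewrite lee_fin sqr_ge0.
  apply: (le_trans (pathwise_risk_bound n0 df dphi kappa84 phi_neq0 (fun i => Y i w) adm m0 mn tailb)).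
  rewrite lee_fin lerD2l ler_pM2l//; apply: ler_sum_nat => k kn.
  by have [_ /(_ kn) [h _]] := HB k; exact: h.
rewrite EFin_Rintegral//; last exact: bounded_rv_integrable.
rewrite lee_fin expectationD_bounded//; last exact: bounded_rv_cst.
rewrite expectation_cst expectationZ_bounded// expectation_sum_bounded//.
rewrite -addrA lerD2l [leRHS]mulrDl lerD2l.
apply: (@le_trans _ _ (7 * (2 / n%:R * expR (3 / 2 * M) * K))); last first.
  by rewrite le_eqVlt; apply/orP; left; apply/eqP; ring.
rewrite ler_pM2l//.
apply: (@le_trans _ _ (2 / n%:R * expR (3 / 2 * M) * \sum_(1 <= k < n.+1) runmax v k *
   (8 + 16 * Num.sqrt (k%:R * lam v k)) * expR (- (2^-1 * Num.sqrt (k%:R * lam v k))))).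
  rewrite mulr_sumr; apply: ler_sum_nat => k kn.
  by have [_ /(_ kn) [_]] := HB k.
by rewrite ler_wpM2l// mulr_ge0 ?expR_ge0// divr_ge0// ltW.
Qed.

End expected_noise.

Lemma bigmin_attained (R : realType) (F : nat -> R) n : (0 < n)%N ->
  exists2 m, (0 < m <= n)%N & \big[Num.min/F 1%N]_(1 <= k < n.+1) F k = F m.
Proof.
move=> n0; rewrite big_nat.
elim/big_ind: _ => [|x y [k kn ->] [l ln ->]|k kn]; first by exists 1%N.
- by rewrite minEle; case: ifP => _; [exists k|exists l].
- by exists k.
Qed.

(** The minimiser [m] serves as the reference cutoff of the oracle inequality; its bias and variance
    terms are each below the maximum. *)
Lemma rate_attained (R : realType) (ff s : nat -> R) r d n : (0 < n)%N ->
  exists2 m, (0 < m <= n)%N &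
    ff m <= rate ff s r d n /\ m%:R * Lam s m / n%:R <= rate ff s r d n.
Proof.
move=> n0; pose F k := Num.max (ff k) (Num.max (k%:R * Lam s k / n%:R)
  (expR (- lam s k * k%:R / (kfs ff s r d)%:~R))).
have [m mn E] := bigmin_attained F n0.
exists m => //; rewrite (E : rate ff s r d n = F m).
by rewrite /F !le_max !lexx !orbT.
Qed.

Lemma zeta_ge1 (R : realType) (d : R) : 1 <= d -> 1 <= zeta d.
Proof.
move=> d1; rewrite mulr_ege1// exprn_ege1// lerDl; exact: ln_ge0.
Qed.

Theorem proposition2p7 (R : realType) (kappa : R) (hkappa : 84 <= kappa) :
  exists C : R, 0 < C /\
  forall (ff s : nat -> R) (r d : R),
    (forall k, 0 < ff k) -> (forall k, 0 < s k) ->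
    nonincreasing_seq ff -> nonincreasing_seq (fun k => (s k)^-1) ->
    ff 0%N = 1 -> s 0%N = 1 ->
    ff @ \oo --> (0 : R) -> (fun k => (s k)^-1) @ \oo --> (0 : R) ->
    (l1norm (fun k => (ff k / s k)%R) < +oo)%E ->
    1 <= r -> 1 <= d ->
    exists C' : R, forall n : nat, (0 < n)%N ->
      forall W : (nat -> R) -> nat -> R, admissible_weights n W ->
        (maximal_risk kappa ff s r d n W <=
          (C * (r + zeta d) * rate ff s r d n + C' * n%:R^-1)%R%:E)%E.
Proof.
(* [86 = 43 * 2] from the bias tail [2 r ff_m], [23 kappa] from the penalty at [m], and 4 from
   [4 m / n], which is below the rate because [Lam s m >= 1]. *)
exists (86 + 23 * kappa + 4); split; first by have := hkappa; lra.
move=> ff s r d ff0 s0 ffd _ _ s01 _ _ l1 r1 d1.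
have [K HK] := noise_remainder_bounded s d.
pose M := r + d * fine (l1norm (fun k => ff k / s k)).
(* [K] and [M] involve only [s], [d], [ff] and [r], so this constant is fixed before [n], the
   weights, [f] and [phi]. *)
exists (6 + 14 * expR (3 / 2 * M) * K) => n n0 W adm.
have [m /andP[m0 mn] [ffF XF]] := rate_attained ff s r d n0.
apply: ge_ereal_sup => e [f [phi [fr phis]]] [t [T [P [Y [iidY ->]]]]].
have [df _] := fr; have [dphi _] := phis.
apply: (le_trans (expected_risk_bound (M := M) n0 df dphi iidY _ hkappa adm _ m0 mn
    (fun N => classF_tail m N ff0 ffd fr) (HK _ _ (classE_vseq s0 d1 phis)))).
- by move=> N; exact: gcoef_sum_le.
- exact: classE_fcoef_neq0 s0 d1 phis.
rewrite lee_fin lerD2r.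
have nR : 0 < n%:R :> R by rewrite ltr0n.
pose X := Lam s m * (m%:R / n%:R).
have q0 : 0 <= m%:R / n%:R :> R by rewrite divr_ge0.
have qX : m%:R / n%:R <= X.
  by rewrite ler_peMl// mulr_ege1 ?lam_ge1// -s01 runmax_ge.
have penX : pen n kappa phi m <= kappa * (zeta d * X).
  rewrite /pen (_ : _ / _ = kappa * (Lam (vseq phi) m * (m%:R / n%:R))); last by ring.
  rewrite ler_wpM2l//; first by have := hkappa; lra.
  by rewrite /X mulrA ler_wpM2r//; exact: Lam_le_zeta (classE_vseq s0 d1 phis).
have {}XF : X <= rate ff s r d n.
  by apply: le_trans XF; rewrite /X le_eqVlt; apply/orP; left; apply/eqP; ring.
set F := rate _ _ _ _ _ in ffF XF *.
have z1 := zeta_ge1 d1.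
have F0 : 0 <= F by rewrite (le_trans _ XF)// (le_trans _ qX).
have e1 : r * ff m <= r * F by rewrite ler_wpM2l//; lra.
have e2 : kappa * (zeta d * X) <= kappa * (zeta d * F).
  by rewrite ler_wpM2l ?ler_wpM2l//; have := hkappa; lra.
have e3 : 1 * F <= zeta d * F by rewrite ler_wpM2r.
have e4 : 0 <= kappa * (r * F) by rewrite !mulr_ge0//; have := hkappa; lra.
have e5 : 0 <= r * F by rewrite mulr_ge0//; lra.
rewrite -(mulrA 4); lra.
Qed.
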